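(* Let $A_0$ be a $d\times d$ expansive integral matrix with $\det A_0=\pm2$. Let $S$ be a $d\times d$ integral matrix with $\det S=\pm1$ and $A$ an integral matrix with $A_0=S^{-1}AS$, such that $A\mathbb{Z}^d=A^\tau\mathbb{Z}^d$ and there are $\vec\ell_A,\vec q_A\in\mathbb{Z}^d$ with: $\mathbb{Z}^d=(\vec\ell_A+A\mathbb{Z}^d)\dot\cup A\mathbb{Z}^d$; $\vec q_A\circ A\mathbb{Z}^d\subseteq2\mathbb{Z}$ and $\vec q_A\circ(\vec\ell_A+A\mathbb{Z}^d)\subseteq2\mathbb{Z}+1$; for $\vec m\in A\mathbb{Z}^d$, $\vec n\in\mathbb{Z}^d$: $\mathbb{Z}^d=(\vec n-A\mathbb{Z}^d)\dot\cup(\vec\ell_A-\vec m-\vec n+A\mathbb{Z}^d)$; for $\vec m\in\vec\ell_A+A\mathbb{Z}^d$, $\vec n\in\mathbb{Z}^d$: $\vec n-A\mathbb{Z}^d=\vec\ell_A-\vec m-\vec n+A\mathbb{Z}^d$. Let $\{h_{\vec n}\}$ be a finite solution, supported in $\Lambda_0=\mathbb{Z}^d\cap[-N_0,N_0]^d$, of $\sum_{\vec n}h_{\vec n}\overline{h_{\vec n+\vec k}}=\delta_{\vec0,\vec k}$ ($\vec k\in A\mathbb{Z}^d$), $\sum_{\vec n}h_{\vec n}=\sqrt2$. Let $m_0(\vec t)=\frac1{\sqrt2}\sum_{\vec n\in\Lambda_0}h_{\vec n}e^{-i\vec n\circ\vec t}$, $\varphi_A=\mathcal F^{-1}g$ with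 $g(\vec\xi)=(2\pi)^{-d/2}\prod_{j\ge1}m_0((A^\tau)^{-j}\vec\xi)$, and $\psi_A=\sum_{\vec n\in\mathbb{Z}^d}(-1)^{\vec q_A\circ\vec n}\overline{h_{\vec\ell_A-\vec n}}D_AT_{\vec n}\varphi_A$. Define $\varphi_{A_0}(\vec t)=\varphi_A(S\vec t)$ and $\psi_{A_0}(\vec t)=\psi_A(S\vec t)$. Then: (1) $\psi_{A_0}$ is a Parseval's frame wavelet associated with $A_0$; (2) $\varphi_{A_0}=\sum_{\vec n\in\Lambda_0}h_{\vec n}D_{A_0}T_{S^{-1}\vec n}\varphi_{A_0}$ and $\psi_{A_0}=\sum_{\vec n:\,\vec\ell_A-\vec n\in\Lambda_0}(-1)^{\vec q_A\circ\vec n}\overline{h_{\vec\ell_A-\vec n}}D_{A_0}T_{S^{-1}\vec n}\varphi_{A_0}$; (3) $V^{(n)}_{A_0}(\varphi_{A_0})\subset V^{(n+1)}_{A_0}(\varphi_{A_0})$ for all $n\in\mathbb{Z}$; (4) $\overline{\bigcup_{n\in\mathbb{Z}}V^{(n)}_{A_0}(\varphi_{A_0})}=L^2(\mathbb{R}^d)$.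
   Context: $\vec x\circ\vec y=\sum_j x_j\overline{y_j}$; $A^\tau$ is the transpose; a matrix is expansive if all eigenvalues have modulus $>1$. $(T_{\vec\ell}f)(\vec t)=f(\vec t-\vec\ell)$; for an integral matrix $B$ with $|\det B|=2$, $(D_Bf)(\vec t)=\sqrt2 f(B\vec t)$. Fourier transform $(\mathcal Ff)(\vec s)=(2\pi)^{-d/2}\int e^{-i\vec s\circ\vec t}f(\vec t)d\vec t$ extended unitarily to $L^2(\mathbb{R}^d)$. $\psi$ is a Parseval's frame wavelet associated with $B$ if $\sum_{n\in\mathbb{Z},\vec\ell\in\mathbb{Z}^d}|\langle f,D_B^nT_{\vec\ell}\psi\rangle|^2=\|f\|^2$ for all $f\in L^2(\mathbb{R}^d)$. For $f\in L^2(\mathbb{R}^d)$: $V^{(0)}_B(f)=\overline{\mathrm{span}}\{T_{\vec\ell}f:\vec\ell\in\mathbb{Z}^d\}$ and $V^{(n)}_B(f)=D_B^nV^{(0)}_B(f)$, $n\in\mathbb{Z}$. (The matrix $A$, being similar to $A_0$, is expansive with $|\det A|=2$.) *)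

(* Defs.v *)
(* MathComp + MathComp-Analysis (R : realType), complex numbers R[i]
   from mathcomp-real-closed. *)
From mathcomp Require Import all_boot all_order all_algebra.
From mathcomp Require Import all_classical all_reals all_analysis.
From mathcomp Require Export complex.
Export Order.TTheory GRing.Theory Num.Theory.
Import numFieldNormedType.Exports.

Set Implicit Arguments.
Unset Strict Implicit.
Unset Printing Implicit Defensive.

Local Open Scope classical_set_scope.
Local Open Scope ring_scope.

(* Iterated Lebesgue integral over R^n of a nonnegative extended-real function
   (by Tonelli this is the Lebesgue integral over R^n for measurable F). *)
Fixpoint iint {R : realType} (n : nat) : ('cV[R]_n -> \bar R) -> \bar R :=
  match n return ('cV[R]_n -> \bar R) -> \bar R with
  | 0 => fun F => F 0
  | n'.+1 => fun F =>
      (\int[@lebesgue_measure R]_(x in setT)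
          iint (fun v : 'cV[R]_n' => F (col_mx (const_mx (x : R) : 'cV[R]_1) v)))%E
  end.

Section WaveletDefs.
Variable R : realType.
Local Notation C := (R[i]).
Variable d : nat.

(* casts of integral vectors / matrices to real ones *)
Definition cvR (v : 'cV[int]_d) : 'cV[R]_d := map_mx (fun z : int => z%:~R) v.
Definition mxR (M : 'M[int]_d) : 'M[R]_d := map_mx (fun z : int => z%:~R) M.

(* the inner products x o y on R^d and Z^d (no conjugation needed) *)
Definition dotR (x y : 'cV[R]_d) : R := \sum_(j < d) x j 0 * y j 0.
Definition dotZ (x y : 'cV[int]_d) : int := \sum_(j < d) x j 0 * y j 0.

Definition cexpi (x : R) : C := Complex (cos x) (sin x).
Definition sqrt2C : C := Complex (Num.sqrt 2) 0.
Definition cabs2 (z : C) : R := complex.Re z ^+ 2 + complex.Im z ^+ 2.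
(* (2 pi)^(-d/2) *)
Definition c2pi : C := Complex ((Num.sqrt (2 * pi))^-1 ^+ d) 0.

(* Borel sets of R^d: sigma-algebra generated by open boxes *)
Definition boxes : set (set 'cV[R]_d) :=
  [set B | exists a b : 'cV[R]_d, B = [set v : 'cV[R]_d | forall j, a j 0 < v j 0 < b j 0]].
Definition borel_fun (F : 'cV[R]_d -> R) : Prop :=
  forall c : R, <<s boxes >> [set v | F v < c].
Definition measurable_cfun (f : 'cV[R]_d -> C) : Prop :=
  borel_fun (fun v => complex.Re (f v)) /\ borel_fun (fun v => complex.Im (f v)).

(* ||f||_2^2 *)
Definition L2norm2 (f : 'cV[R]_d -> C) : \bar R := iint (fun v => (cabs2 (f v))%:E).
Definition inL2 (f : 'cV[R]_d -> C) : Prop := measurable_cfun f /\ (L2norm2 f < +oo)%E.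
(* ||f - g||_2^2 *)
Definition dist2 (f g : 'cV[R]_d -> C) : \bar R := L2norm2 (fun v => f v - g v).

(* Lebesgue integral of real and complex functions over R^d *)
Definition Rint (F : 'cV[R]_d -> R) : R :=
  fine (iint (fun v => (Num.max (F v) 0)%:E)) - fine (iint (fun v => (Num.max (- F v) 0)%:E)).
Definition cint (f : 'cV[R]_d -> C) : C :=
  Complex (Rint (fun v => complex.Re (f v))) (Rint (fun v => complex.Im (f v))).
Definition inner (f g : 'cV[R]_d -> C) : C := cint (fun v => f v * (g v)^*).

(* translation, dilation and its integer powers *)
Definition transl (l : 'cV[int]_d) (f : 'cV[R]_d -> C) : 'cV[R]_d -> C :=
  fun t => f (t - cvR l).
Definition dil (B : 'M[int]_d) (f : 'cV[R]_d -> C) : 'cV[R]_d -> C :=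
  fun t => sqrt2C * f (mxR B *m t).
Definition dilinv (B : 'M[int]_d) (f : 'cV[R]_d -> C) : 'cV[R]_d -> C :=
  fun t => f (invmx (mxR B) *m t) / sqrt2C.
Definition dilz (B : 'M[int]_d) (n : int) (f : 'cV[R]_d -> C) : 'cV[R]_d -> C :=
  match n with
  | Posz k => iter k (dil B) f
  | Negz k => iter k.+1 (dilinv B) f
  end.

(* Parseval's frame wavelet associated with B *)
Definition parseval_frame_wavelet (B : 'M[int]_d) (psi : 'cV[R]_d -> C) : Prop :=
  inL2 psi /\
  forall f, inL2 f ->
    (\esum_(p in [set: int * 'cV[int]_d])
        (cabs2 (inner f (dilz B p.1 (transl p.2 psi))))%:E = L2norm2 f)%E.

(* closure in L^2 of a set of functions *)
Definition L2closure (X : set ('cV[R]_d -> C)) : set ('cV[R]_d -> C) :=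
  [set f | inL2 f /\ forall e : R, 0 < e -> exists g, X g /\ (dist2 f g < e%:E)%E].
(* linear span of the integer translates of f *)
Definition span_transl (f : 'cV[R]_d -> C) : set ('cV[R]_d -> C) :=
  [set g | exists s : seq (C * 'cV[int]_d),
      g = (fun t => \sum_(p <- s) p.1 * transl p.2 f t)].
Definition V0 (f : 'cV[R]_d -> C) := L2closure (span_transl f).
Definition Vn (B : 'M[int]_d) (n : int) (f : 'cV[R]_d -> C) :=
  [set dilz B n g | g in V0 f].

(* expansive: all complex eigenvalues have modulus > 1 *)
Definition expansive (M : 'M[int]_d) : Prop :=
  forall z : C, root (char_poly (map_mx (fun x : int => x%:~R) M)) z -> 1 < `|z|.

Definition inAZ (A : 'M[int]_d) (v : 'cV[int]_d) : Prop := exists w, v = A *m w.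

(* the points of Lambda_0 = Z^d cap [-N,N]^d, indexed by finite functions *)
Definition boxv (N : nat) (f : {ffun 'I_d -> 'I_(N.*2.+1)}) : 'cV[int]_d :=
  \col_j ((f j)%:Z - N%:Z).

(* m_0 and the partial products defining g *)
Definition m0 (N : nat) (h : 'cV[int]_d -> C) (t : 'cV[R]_d) : C :=
  sqrt2C^-1 * \sum_(f : {ffun 'I_d -> 'I_(N.*2.+1)})
                 h (boxv f) * cexpi (- dotR (cvR (boxv f)) t).
Definition gpart (A : 'M[int]_d) (N : nat) (h : 'cV[int]_d -> C) (J : nat)
    (xi : 'cV[R]_d) : C :=
  c2pi * \prod_(1 <= j < J.+1) m0 N h (iter j (fun v => invmx (mxR A^T) *m v) xi).
Definition is_infprod_g (A : 'M[int]_d) (N : nat) (h : 'cV[int]_d -> C)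
    (g : 'cV[R]_d -> C) : Prop :=
  forall xi, ((fun J => complex.Re (gpart A N h J xi)) @ \oo --> complex.Re (g xi)) /\
             ((fun J => complex.Im (gpart A N h J xi)) @ \oo --> complex.Im (g xi)).

(* inverse Fourier transform on L^2 (Plancherel): L^2-limit of the inverse
   transforms of the truncations g 1_{[-N,N]^d} *)
Definition invFT_trunc (g : 'cV[R]_d -> C) (N : nat) (t : 'cV[R]_d) : C :=
  c2pi * cint (fun xi => (if [forall j, `|xi j 0| <= N%:R] then 1 else 0)
                        * cexpi (dotR xi t) * g xi).
Definition is_invFT (g phi : 'cV[R]_d -> C) : Prop :=
  inL2 phi /\ forall e : R, 0 < e -> exists M : nat, forall N : nat, (M <= N)%N ->
      (dist2 phi (invFT_trunc g N) < e%:E)%E.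

End WaveletDefs.

(* Main.v *)
Require Import Defs.
From HB Require Import structures.
From mathcomp Require Import all_boot all_order all_algebra.
From mathcomp Require Import all_classical all_reals all_analysis.
From mathcomp Require Import measurable_realfun complex ring lra zify.
Import Order.TTheory GRing.Theory Num.Theory.
Import numFieldNormedType.Exports.
Set Implicit Arguments.
Unset Strict Implicit.
Unset Printing Implicit Defensive.
Local Open Scope classical_set_scope.
Local Open Scope ring_scope.

(** Write [L n f] for the sum over [l] of [|<f, D^n T_l phi>|^2], and [M n f] for the same
    sum with [psi]. The orthogonality relations of [h] and the coset conditions make the pair
    of filters [h], [(-1)^(q.n) conj (h (l - n))] an isometry of [l^2(Z^d)]; combined with the
    refinement equation of [phi] this gives [L (n+1) f = L n f + M n f]. Hence the sum of the
    [M n f] telescopes to [lim L n f] at [+oo] minus [lim L n f] at [-oo].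
    At [+oo], if [f] is the inverse Fourier transform of a bounded compactly supported [G],
    Parseval's identity turns [L n f] into the integral of [(2 pi)^d |G xi|^2 |g (A^-Tn xi)|^2],
    which tends to [||f||^2] because [g] is continuous at [0] with [|g 0|^2 = (2 pi)^-d];
    monotonicity then yields the Bessel inequality, and density the limit for all [f].
    At [-oo], a compactly supported [f] is squeezed into a shrinking cube, whose integer
    translates are disjoint and carry less and less of the mass of [phi].
    Everything is first done for [A] and transported to [A0] by the unimodular matrix [S]. *)

(** * Lebesgue measure on column vectors *)

(** The integer translates of [phi] need not be orthogonal, nor even a Riesz system, so no
    projection onto the spaces [V] is available. All arguments are therefore about quadratic
    energies. Orthogonality is replaced by two facts: a family with Bessel constant 1 reconstructs
    [f] with a squared error at most the energy it misses, and the defect in Bessel's inequality,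
    being a nonnegative quadratic form, is stable under small perturbations. The filter bank
    preserves energy only on square summable sequences, and square summability of the coefficients
    is itself a consequence of Bessel. Hence the relation between [L n f], [M n f] and [L (n+1) f]
    is obtained as an inequality, used to prove Bessel, and only then sharpened to an equality. The
    function [g] is merely a pointwise limit, and [phi] an L^2 limit of truncated transforms.
    Identities about [phi] are tested against inverse transforms of bounded functions of bounded
    support, and the refinement equation holds up to a null set. Expansiveness enters as the
    summability of the norms of the powers of the inverse matrix, a property stable under
    transposition and under conjugation by [S]. *)

Section EuclideanMeasurable.
Variable R : realType.

(* ['cV[R]_d] carries no measurable structure; [cvT] adds the Borel sets used in [borel_fun]. *)
Definition cvT (d : nat) := g_sigma_algebraType (@boxes R d).
HB.instance Definition _ d := Measurable.on (cvT d).

Lemma box_measurable d (a b : 'cV[R]_d) :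
  measurable ([set v | forall j, a j 0 < v j 0 < b j 0] : set (cvT d)).
Proof. by apply: sub_sigma_algebra; exists a, b. Qed.

(** Bridge between [borel_fun], which only tests the sets where [f t < c], and [measurable_fun]: the
    complements of these sets are preimages of the rays [[x, +oo[], which generate the Borel
    sets. *)
Lemma measurable_fun_gtr_sets dd (T : measurableType dd) (f : T -> R) :
  (forall c, measurable [set t | f t < c]) <-> measurable_fun setT f.
Proof.
split=> [H|mf c]; last first.
  rewrite (_ : [set t | _] = f @^-1` `]-oo, c[); last first.
    by apply/seteqP; split=> t /=; rewrite in_itv.
  by rewrite -[X in measurable X]setTI; apply: mf.
move=> mT; apply: (measurability _ (RGenCInfty.measurableE R)) => //.
move=> _ [_ [x ->]] <-; rewrite setTI.
rewrite (_ : f @^-1` _ = ~` [set t | f t < x]); first exact: measurableC.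
by apply/seteqP; split=> t /=; rewrite in_itv /= andbT leNgt => /negP.
Qed.

(** A half-space is not a box, but it is the union of boxes whose sides grow to infinity except for
    the upper bound [c] on the [j]-th coordinate. *)
Lemma measurable_coord d (j : 'I_d) :
  measurable_fun setT (fun v : cvT d => v j 0 : R).
Proof.
apply/measurable_fun_gtr_sets => c.
pose a n : 'cV[R]_d := const_mx (- n%:R).
pose b n : 'cV[R]_d := \col_k (if k == j then c else n%:R).
rewrite (_ : [set t | _] = \bigcup_n
   ([set v | forall k, a n k 0 < v k 0 < b n k 0] : set (cvT d))).
  by apply: bigcupT_measurable => n; exact: box_measurable.
apply/seteqP; split=> v /=; last first.
  by case=> n _ /(_ j); rewrite !mxE eqxx => /andP[].
move=> vc; pose n := (\max_k (Num.bound (v k 0%R)))%N; exists n => //= k.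
have nk : `|v k 0| < n%:R.
  apply: (lt_le_trans (archi_boundP (normr_ge0 _))).
  rewrite ler_nat /n.
  rewrite (_ : Num.bound `|v k 0| = Num.bound (v k 0)); first exact: leq_bigmax.
  by rewrite /Num.bound /= normr_id.
rewrite !mxE; move: nk; rewrite ltr_norml => /andP[-> nk2] /=.
by case: eqP => [->|_].
Qed.

Lemma measurable_fun_cV dd (T : measurableType dd) d (f : T -> cvT d) :
  (forall j, measurable_fun setT (fun t => f t j 0)) -> measurable_fun setT f.
Proof.
move=> mf mT; apply: (@measurability _ _ _ _ setT f (@boxes R d) erefl) => //.
move=> _ [_ [a [b ->]]] <-; rewrite setTI.
rewrite (_ : _ @^-1` _ = \bigcap_(j in [set: 'I_d])
   ([set t | a j 0 < f t j 0] `&` [set t | f t j 0 < b j 0])); last first.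
  apply/seteqP; split=> [t /= H j _ /=|t H /= j].
    by have /andP[] := H j.
  by have [/= -> ->] := H j I.
apply: fin_bigcap_measurable => [|j _]; first exact: finite_finset.
apply: measurableI.
  rewrite (_ : [set t | _] = (fun t => f t j 0) @^-1` `]a j 0, +oo[).
    by rewrite -[X in measurable X]setTI; apply: mf.
  by apply/seteqP; split=> t /=; rewrite in_itv /= andbT.
by have /measurable_fun_gtr_sets := mf j; apply.
Qed.

(** The first coordinate is split off exactly as in [iint], so that a measure transported along
    [colf] integrates as [iint] does. *)
Definition colf d (p : measurableTypeR R * cvT d) : cvT d.+1 :=
  col_mx (const_mx p.1 : 'cV[R]_1) p.2.
Definition uncolf d (v : cvT d.+1) : measurableTypeR R * cvT d :=
  (v ord0 0, dsubmx (v : 'cV_(1 + d))).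

Lemma colfK d : cancel (@colf d) (@uncolf d).
Proof.
case=> x v; rewrite /uncolf /colf /= col_mxKd; congr pair.
rewrite (_ : ord0 = lshift d (ord0 : 'I_1)); last exact: val_inj.
by apply: etrans (col_mxEu _ _ _ _) _; rewrite mxE.
Qed.

Lemma uncolfK d : cancel (@uncolf d) (@colf d).
Proof.
move=> v; rewrite /colf /=.
have -> : const_mx (v ord0 0) = usubmx (v : 'cV_(1 + d)) :> 'cV[R]_1.
  by apply/matrixP=> i j; rewrite !ord1 !mxE; congr (v _ _); exact: val_inj.
exact: (@vsubmxK _ 1 d 1 v).
Qed.

Lemma colf0 d x (v : cvT d) : colf (x, v) ord0 0 = x.
Proof. by have := colfK (x, v); rewrite /uncolf; case. Qed.

Lemma colfS d x (v : cvT d) i : colf (x, v) (lift ord0 i) 0 = v i 0.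
Proof.
rewrite (_ : lift ord0 i = rshift 1 i); last exact: val_inj.
exact: (etrans (col_mxEd _ _ _ _)).
Qed.

Lemma measurable_colf d : measurable_fun setT (@colf d).
Proof.
apply: measurable_fun_cV => j; case: (unliftP ord0 j) => [k ->|->].
  rewrite (_ : (fun _ => _) = (fun v : cvT d => v k 0) \o snd); last first.
    by apply/funext => -[x v] /=; rewrite colfS.
  by apply: measurableT_comp; [exact: measurable_coord|exact: measurable_snd].
rewrite (_ : (fun _ => _) = fst); first exact: measurable_fst.
by apply/funext => -[x v] /=; rewrite colf0.
Qed.

Lemma measurable_uncolf d : measurable_fun setT (@uncolf d).
Proof.
apply/measurable_fun_pairP; split; first exact: measurable_coord.
apply: measurable_fun_cV => j.
rewrite (_ : (fun _ => _) = (fun v : cvT d.+1 => v (lift ord0 j) 0)).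
  exact: measurable_coord.
by apply/funext => v /=; rewrite mxE; congr (v _ _); exact: val_inj.
Qed.

Section Push.
Variable d : nat.
Variable m2 : {sigma_finite_measure set (cvT d) -> \bar R}.
Let m : {measure set (measurableTypeR R * cvT d)%type -> \bar R} := (@lebesgue_measure R \x m2)%E.

Definition push_colf : set (cvT d.+1) -> \bar R := fun A => m (@colf d @^-1` A).

Let push0 : push_colf set0 = 0%E.
Proof. by rewrite /push_colf preimage_set0; exact: (measure0 (@lebesgue_measure R \x m2)%E). Qed.
Let push_ge0 A : (0 <= push_colf A)%E.
Proof. exact: measure_ge0. Qed.
Let push_sigma_additive : semi_sigma_additive push_colf.
Proof.
have mpre B : measurable B -> measurable (@colf d @^-1` B).
  by move=> mB; rewrite -[X in measurable X]setTI; exact: measurable_colf.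
move=> F mF tF mUF; rewrite /push_colf preimage_bigcup.
apply: measure_semi_sigma_additive => [n||]; first exact: mpre.
  apply/trivIsetP => i j _ _ ij; rewrite -preimage_setI.
  by move/trivIsetP : tF => -> //; rewrite preimage_set0.
by rewrite -preimage_bigcup; exact: mpre.
Qed.
HB.instance Definition _ := isMeasure.Build _ _ _ push_colf
  push0 push_ge0 push_sigma_additive.
Let push_sigma_finite : sigma_finite setT push_colf.
Proof.
have /sigma_finiteP[F [TF ndF Foo]] := sigma_finiteT (@lebesgue_measure R).
have /sigma_finiteP[G [TG ndG Goo]] := sigma_finiteT m2.
exists (fun n => @uncolf d @^-1` (F n `*` G n)) => [|n].
  apply/esym/seteqP; split=> // v _.
  have [n _ Fn] : (\bigcup_n F n) (uncolf v).1 by rewrite -TF.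
  have [k _ Gk] : (\bigcup_n G n) (uncolf v).2 by rewrite -TG.
  exists (maxn n k) => //; split.
    by have /subsetPset := ndF _ _ (leq_maxl n k); apply.
  by have /subsetPset := ndG _ _ (leq_maxr n k); apply.
have [mF Fy] := Foo n; have [mG Gy] := Goo n; split.
  rewrite -[X in measurable X]setTI; apply: measurable_uncolf => //.
  exact: measurableX.
rewrite /push_colf -comp_preimage (_ : _ \o _ = id) ?preimage_id; last first.
  by apply/funext => p /=; rewrite colfK.
by rewrite /m /= product_measure1E// lte_mul_pinfty// ge0_fin_numE.
Qed.
HB.instance Definition _ := Measure_isSigmaFinite.Build _ _ _ push_colf
  push_sigma_finite.
End Push.

(** Lebesgue measure on column vectors, following the recursion of [iint]: a point mass in dimension
    0, then the image of a product. Sigma-finiteness is part of the recursion because the next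
    product and Tonelli's theorem require it. *)
Fixpoint muT (d : nat) : {sigma_finite_measure set (cvT d) -> \bar R} :=
  match d with
  | 0 => \d_(0 : cvT 0)
  | n.+1 => push_colf (muT n)
  end.


Lemma measurable_fun_slice d dd (T : measurableType dd) (F : cvT d.+1 -> T) x :
  measurable_fun setT F -> measurable_fun setT (fun v : cvT d => F (colf (x, v))).
Proof.
move=> mF; apply: measurableT_comp => //.
by apply: measurableT_comp; [exact: measurable_colf|exact: measurable_pair1].
Qed.

Local Open Scope ereal_scope.

Lemma integral_muTS d (F : cvT d.+1 -> \bar R) :
  measurable_fun setT F -> (forall v, 0 <= F v) ->
  \int[muT d.+1]_v F v =
  \int[@lebesgue_measure R]_x \int[muT d]_v F (colf (x, v)).
Proof.
move=> mF F0; set m := (@lebesgue_measure R \x muT d).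
rewrite -(@fubini_tonelli1 _ _ _ _ _ _ _ (fun p => F (colf p)))//; last first.
  by apply: measurableT_comp => //; exact: measurable_colf.
exact: (@ge0_integral_pushforward _ _ _ _ _ _ (@measurable_colf d) m setT F).
Qed.

(** [iint] is defined for arbitrary functions; on nonnegative measurable ones Tonelli's theorem
    identifies it with an integral for [muT]. The norms and inner products of the statement are
    reached through this identity. *)
Lemma iintE d (F : cvT d -> \bar R) :
  measurable_fun setT F -> (forall v, 0 <= F v) ->
  iint F = \int[muT d]_v F v.
Proof.
elim: d F => [|d IH] F mF F0 /=.
  by rewrite integral_dirac// diracT mul1e.
rewrite integral_muTS//; apply: eq_integral => x _.
by rewrite -IH//; exact: measurable_fun_slice.
Qed.

End EuclideanMeasurable.
Arguments muT {R}.

(** * Linear changes of variables *)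

Section ChangeOfVariables.
Variable R : realType.
Local Open Scope ereal_scope.
Local Notation leb := (@lebesgue_measure R).

Lemma measurable_affine (a b : R) :
  measurable_fun setT ((fun x => a * x + b)%R : measurableTypeR R -> measurableTypeR R).
Proof.
apply: continuous_measurable_fun => x; apply: cvgD; last exact: cvg_cst.
by apply: cvgM; [exact: cvg_cst|exact: cvg_id].
Qed.

(** The image of Lebesgue measure under the affine map, scaled by [|a|], agrees with Lebesgue
    measure on half-open intervals, hence everywhere by uniqueness. *)
Lemma ge0_integral_affine (a b : R) (F : R -> \bar R) : (a != 0)%R ->
  measurable_fun setT F -> (forall x, 0 <= F x) ->
  `|a|%:E * \int[leb]_x F (a * x + b)%R = \int[leb]_x F x.
Proof.
move=> a0 mF F0.
pose aff := (fun x => a * x + b)%R : measurableTypeR R -> measurableTypeR R.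
pose pm : {measure set _ -> \bar R} :=
  measure_function_pushforward__canonical__measure_function_Measure leb
    (measurable_affine a b).
pose nu : {measure set _ -> \bar R} := mscale (NngNum (normr_ge0 a)) pm.
transitivity (\int[nu]_x F x); last first.
  apply: eq_measure_integral => A mA _; apply/esym/lebesgue_measure_unique => //.
  move=> _ [[c e] _ <-] /=; rewrite /mscale /pm /= /pushforward /=.
  have [ap|an] := ltP 0%R a.
    rewrite (_ : aff @^-1` _ = `](c - b) / a, (e - b) / a]%classic)%R; last first.
      apply/seteqP; split=> x /=; rewrite /aff !in_itv /=;
      by rewrite ltr_pdivrMr// ler_pdivlMr// ltrBlDr lerBrDr mulrC.
    rewrite !lebesgue_measure_itv /= !lte_fin gtr0_norm//.
    rewrite ltr_pM2r ?invr_gt0// ltrD2r; case: ifP => _; last by rewrite mule0.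
    by rewrite -!EFinB -EFinM; congr EFin; field.
  have {}an : (a < 0)%R by rewrite lt_neqAle a0.
  (* A negative slope exchanges the open and the closed end of the interval; the length is
     unaffected. *)
  rewrite (_ : aff @^-1` _ = `[(e - b) / a, (c - b) / a[%classic)%R; last first.
    apply/seteqP; split=> x /=; rewrite /aff !in_itv /= andbC;
    by rewrite ltr_ndivlMr// ler_ndivrMr// ltrBlDr lerBrDr mulrC.
  rewrite !lebesgue_measure_itv /= !lte_fin ltr0_norm//.
  rewrite ltr_nM2r ?invr_lt0// ltrD2r; case: ifP => _; last by rewrite mule0.
  by rewrite -!EFinB -EFinM; congr EFin; field.
rewrite ge0_integral_mscale//=; congr (_ * _).
exact/esym/(@ge0_integral_pushforward _ _ _ _ _ _ (measurable_affine a b) leb setT F).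
Qed.

Lemma measurable_mulmx d (M : 'M[R]_d) :
  measurable_fun setT (fun v : cvT R d => (M *m v)%R : cvT R d).
Proof.
apply: measurable_fun_cV => j.
rewrite (_ : (fun _ => _) = (fun v : cvT R d => \sum_k M j k * v k 0)%R); last first.
  by apply/funext => v; rewrite mxE.
apply: measurable_sum => k; apply: measurable_funM => //; exact: measurable_coord.
Qed.

Lemma measurable_translate d (b : 'cV[R]_d) :
  measurable_fun setT (fun v : cvT R d => (v + b)%R : cvT R d).
Proof.
apply: measurable_fun_cV => j.
rewrite (_ : (fun _ => _) = (fun v : cvT R d => v j 0 + b j 0)%R); last first.
  by apply/funext => v; rewrite mxE.
by apply: measurable_funD => //; exact: measurable_coord.
Qed.

Lemma colfD d (x y : R) (v w : cvT R d) :
  (colf (x, v) + colf (y, w) = colf (x + y, (v : 'cV_d) + w))%R.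
Proof.
apply/matrixP => i j; rewrite !ord1 [LHS]mxE.
by case: (unliftP ord0 i) => [k ->|->]; rewrite ?colfS ?colf0 // mxE.
Qed.

Lemma ge0_integral_translate d (b : 'cV[R]_d) (F : cvT R d -> \bar R) :
  measurable_fun setT F -> (forall v, 0 <= F v) ->
  \int[muT d]_v F (v + b)%R = \int[muT d]_v F v.
Proof.
elim: d b F => [|d IH] b F mF F0.
  by apply: eq_integral => v _; congr F; apply/matrixP => -[].
have mFb : measurable_fun setT (fun v : cvT R d.+1 => F (v + b)%R).
  by apply: (@measurableT_comp _ _ _ _ _ _ F) => //; exact: measurable_translate.
rewrite !integral_muTS//.
pose H x := \int[muT d]_v F (colf (x, v)).
have mH : measurable_fun setT H.
  apply: (@measurable_fun_fubini_tonelli_F _ _ _ _ _ (muT d) (fun p => F (colf p))) => //.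
  by apply: measurableT_comp => //; exact: measurable_colf.
have H0 x : 0 <= H x by apply: integral_ge0 => v _.
rewrite -[RHS](@ge0_integral_affine 1 (b ord0 0)%R H)// ?oner_eq0// normr1 mul1e.
apply: eq_integral => x _; rewrite mul1r.
rewrite -[RHS](IH (uncolf (b : cvT R d.+1)).2)//; last exact: measurable_fun_slice.
apply: eq_integral => v _; rewrite -colfD; congr (F (_ + _))%R.
by rewrite -[LHS](@uncolfK R d b).
Qed.

(** Stated as a predicate on matrices because it is multiplicative ([cov_mul]): it is enough to
    check it on the factors of an elimination. *)
Definition cov_prop d (M : 'M[R]_d) := forall F : cvT R d -> \bar R,
  measurable_fun setT F -> (forall v, 0 <= F v) ->
  `|\det M|%:E * \int[muT d]_v F (M *m v)%R = \int[muT d]_v F v.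

Lemma cov_mul d (M N : 'M[R]_d) : cov_prop M -> cov_prop N -> cov_prop (M *m N)%R.
Proof.
move=> cM cN F mF F0; rewrite det_mulmx normrM EFinM -muleA.
under eq_integral do rewrite -mulmxA.
rewrite (cN (fun v => F (M *m v)%R))//; first exact: cM.
by apply: (@measurableT_comp _ _ _ _ _ _ F) => //; exact: measurable_mulmx.
Qed.

Lemma block_colf d (a : R) (r : 'rV[R]_d) (c : 'cV[R]_d) (N : 'M[R]_d) x (v : cvT R d) :
  ((block_mx a%:M r c N : 'M[R]_(1 + d)) *m (colf (x, v) : 'cV_(1 + d)) =
  colf (a * x + (r *m v) 0 0, (x *: c : 'cV_d) + N *m v))%R.
Proof.
rewrite /colf /=; apply: etrans (mul_block_col _ _ _ _ _ _) _.
congr (col_mx _ _).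
  by apply/matrixP => i j; rewrite !ord1 mul_scalar_mx !mxE.
congr (_ + _)%R; apply/matrixP => i j.
by rewrite !ord1 mxE big_ord1 !mxE mulrC.
Qed.

(** For a fixed first coordinate [x] the shear is the translation by [x *: c] of the other
    coordinates. *)
Lemma cov_lower d (c : 'cV[R]_d) :
  @cov_prop d.+1 (block_mx 1%:M 0 c 1%:M : 'M[R]_(1 + d)).
Proof.
move=> F mF F0; rewrite (@det_lblock _ 1 d) !det1 mulr1 normr1 mul1e.
have mFb : measurable_fun setT
    (fun v : cvT R d.+1 => F ((block_mx 1%:M 0 c 1%:M : 'M[R]_(1 + d)) *m v)%R).
  by apply: (@measurableT_comp _ _ _ _ _ _ F) => //; exact: (@measurable_mulmx d.+1).
rewrite !integral_muTS//; apply: eq_integral => x _.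
rewrite -[RHS](ge0_integral_translate (x *: c))//; last exact: measurable_fun_slice.
by apply: eq_integral => v _; rewrite block_colf mul1r mul0mx mxE addr0 mul1mx addrC.
Qed.

Lemma cov_diag d (N : 'M[R]_d) : cov_prop N ->
  @cov_prop d.+1 (block_mx 1%:M 0 0 N : 'M[R]_(1 + d)).
Proof.
move=> cN F mF F0; rewrite (@det_lblock _ 1 d) det1 mul1r.
have mFb : measurable_fun setT
    (fun v : cvT R d.+1 => F ((block_mx 1%:M 0 0 N : 'M[R]_(1 + d)) *m v)%R).
  by apply: (@measurableT_comp _ _ _ _ _ _ F) => //; exact: (@measurable_mulmx d.+1).
rewrite !integral_muTS//.
rewrite -ge0_integralZl//; last 2 first.
- apply: (@measurable_fun_fubini_tonelli_F _ _ _ _ _ (muT d)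
    (fun p => F ((block_mx 1%:M 0 0 N : 'M[R]_(1 + d)) *m colf p)%R)) => //.
  by apply: (@measurableT_comp _ _ _ _ _ _ _ setT) mFb _; exact: measurable_colf.
- by move=> x _; apply: integral_ge0.
apply: eq_integral => x _.
rewrite -[RHS]cN//; last exact: measurable_fun_slice.
congr (_ * _); apply: eq_integral => v _.
by rewrite block_colf mul1r mul0mx mxE addr0 scaler0 add0r.
Qed.

(** Here the first coordinate must be integrated first, whence the two uses of Tonelli's theorem;
    for fixed [v] the map is affine of slope [a]. *)
Lemma cov_upper d (a : R) (r : 'rV[R]_d) : (a != 0)%R ->
  @cov_prop d.+1 (block_mx a%:M r 0 1%:M : 'M[R]_(1 + d)).
Proof.
move=> a0 F mF F0; rewrite (@det_ublock _ 1 d) det1 mulr1 det_scalar expr1.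
have mFb : measurable_fun setT
    (fun v : cvT R d.+1 => F ((block_mx a%:M r 0 1%:M : 'M[R]_(1 + d)) *m v)%R).
  by apply: (@measurableT_comp _ _ _ _ _ _ F) => //; exact: (@measurable_mulmx d.+1).
have mc (G : cvT R d.+1 -> \bar R) : measurable_fun setT G ->
    measurable_fun setT (fun p => G (colf p)).
  by move=> mG; apply: measurableT_comp => //; exact: measurable_colf.
rewrite !integral_muTS//.
rewrite (@fubini_tonelli _ _ _ _ _ leb (muT d)
  (fun p => F ((block_mx a%:M r 0 1%:M : 'M[R]_(1 + d)) *m colf p)%R))//; last exact: mc mFb.
rewrite (@fubini_tonelli _ _ _ _ _ leb (muT d) (fun p => F (colf p)))//; last exact: mc.
rewrite -ge0_integralZl//; last 2 first.
- apply: (@measurable_fun_fubini_tonelli_G _ _ _ _ _ leb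
    (fun p => F ((block_mx a%:M r 0 1%:M : 'M[R]_(1 + d)) *m colf p)%R)) => //.
  exact: mc mFb.
- by move=> x _; apply: integral_ge0.
apply: eq_integral => v _ /=.
rewrite -[RHS](@ge0_integral_affine a ((r *m v) 0 0)%R)//; last first.
  apply: (@measurableT_comp _ _ _ _ _ _ (fun p => F (colf p))); first exact: mc.
  exact: measurable_pair2.
by congr (_ * _); apply: eq_integral => x _; rewrite block_colf scaler0 add0r mul1mx.
Qed.

(** A nonzero pivot [a] allows block elimination: a lower shear, the Schur complement [N] acting on
    the last [d] coordinates, and an upper factor. [N] has smaller size, so induction applies to
    it. *)
Lemma cov_block d (a : R) (r : 'rV[R]_d) (c : 'cV[R]_d) (M : 'M[R]_d) :
  (a != 0)%R -> (forall N : 'M[R]_d, \det N != 0 -> cov_prop N)%R ->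
  \det (block_mx a%:M r c M : 'M[R]_(1 + d)) != 0%R ->
  @cov_prop d.+1 (block_mx a%:M r c M : 'M[R]_(1 + d)).
Proof.
move=> a0 IH; pose N := (M - a^-1 *: (c *m r))%R.
have E : (block_mx a%:M r c M : 'M[R]_(1 + d)) = ((block_mx 1%:M 0 (a^-1 *: c) 1%:M
  : 'M[R]_(1 + d)) *m ((block_mx 1%:M 0 0 N : 'M[R]_(1 + d)) *m
   (block_mx a%:M r 0 1%:M : 'M[R]_(1 + d))))%R.
  rewrite !mulmx_block !mul1mx !mul0mx !mulmx0 !mulmx1 !addr0 !add0r.
  rewrite mul_mx_scalar scalerA mulfV// scale1r /N -scalemxAl.
  by rewrite addrC subrK.
rewrite E !det_mulmx (@det_lblock _ 1 d) (@det_lblock _ 1 d) (@det_ublock _ 1 d).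
rewrite !det1 det_scalar expr1 !mul1r mulr1 mulf_eq0 negb_or => /andP[N0 _].
apply: (@cov_mul d.+1); first exact: cov_lower.
by apply: (@cov_mul d.+1); [apply: cov_diag; exact: IH|exact: cov_upper].
Qed.

Lemma cov_unit d (M : 'M[R]_d) : (\det M != 0)%R -> cov_prop M.
Proof.
elim: d M => [|d IH] M dM.
  move=> F mF F0; rewrite det_mx00 normr1 mul1e.
  by apply: eq_integral => v _; congr F; apply/matrixP => -[].
pose a := (M : 'M[R]_(1 + d)) ord0 ord0.
have ME : (M : 'M[R]_(1 + d)) = (block_mx a%:M (ursubmx (M : 'M[R]_(1 + d)))
    (dlsubmx (M : 'M[R]_(1 + d))) (drsubmx (M : 'M[R]_(1 + d))))%R.
  rewrite -[LHS](@submxK _ 1 d 1 d); congr (block_mx _ _ _ _).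
  rewrite [LHS]mx11_scalar; congr (_%:M)%R; rewrite !mxE /a; congr (M _ _); exact: val_inj.
have [a0|a0] := eqVneq a 0%R; last by move: dM; rewrite ME; exact: cov_block.
have [i ci] : exists i, dlsubmx (M : 'M[R]_(1 + d)) i ord0 != 0%R.
  apply/not_existsP => H; move/eqP: dM; apply.
  rewrite (expand_det_col _ ord0) big1// => i _.
  case: (unliftP ord0 i) => [k ->|->].
    have /negP := H k; rewrite negbK !mxE => /eqP E.
    rewrite (_ : M _ _ = 0%R) ?mul0r// -[RHS]E; congr (M _ _); exact: val_inj.
  by rewrite (_ : M ord0 ord0 = a)// a0 mul0r.
(* The pivot is zero but some other entry of the first column is not, since the determinant is
   nonzero. Left multiplication by [E1] adds the corresponding row to the first one, which produces
   a nonzero pivot; [E2] undoes this. *)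
pose s : 'rV[R]_d := delta_mx ord0 i.
pose E1 : 'M[R]_(1 + d) := block_mx 1%:M s 0%R 1%:M.
pose E2 : 'M[R]_(1 + d) := block_mx 1%:M (- s)%R 0%R 1%:M.
have E21 : (E2 *m E1 = 1%:M)%R.
  by rewrite mulmx_block !mul1mx !mulmx0 !mul0mx !mulmx1 !addr0 add0r subrr -scalar_mx_block.
have -> : M = (E2 *m (E1 *m M))%R by rewrite mulmxA E21 mul1mx.
apply: (@cov_mul d.+1); first by apply: cov_upper; exact: oner_neq0.
have E1M : (E1 *m M = block_mx (dlsubmx (M : 'M[R]_(1 + d)) i ord0)%:M
   (ursubmx (M : 'M[R]_(1 + d)) + s *m drsubmx (M : 'M[R]_(1 + d)))
   (dlsubmx (M : 'M[R]_(1 + d))) (drsubmx (M : 'M[R]_(1 + d))))%R.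
  apply: etrans (congr1 (mulmx E1) ME) _; rewrite /E1.
  apply: etrans (mulmx_block _ _ _ _ _ _ _ _) _.
  rewrite !mul1mx !mul0mx !add0r; congr (block_mx _ _ _ _).
  rewrite a0 raddf0 add0r [LHS]mx11_scalar; congr (_%:M)%R.
  by rewrite /s -rowE mxE; congr (_ _ _); apply: val_inj.
have dE : (\det (E1 *m M) != 0)%R.
  by rewrite det_mulmx (@det_ublock _ 1 d) !det1 !mul1r.
by move: dE; rewrite E1M; apply: cov_block.
Qed.

End ChangeOfVariables.

(** * Complex-valued square-integrable functions *)

Section ComplexNumbers.
Variable R : realType.
Local Notation C := (R[i]).
Implicit Types x y z : C.

Lemma cReD x y : complex.Re (x + y) = complex.Re x + complex.Re y.
Proof. by case: x y => [? ?] [? ?]. Qed.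
Lemma cImD x y : complex.Im (x + y) = complex.Im x + complex.Im y.
Proof. by case: x y => [? ?] [? ?]. Qed.
Lemma cReN x : complex.Re (- x) = - complex.Re x.
Proof. by case: x. Qed.
Lemma cImN x : complex.Im (- x) = - complex.Im x.
Proof. by case: x. Qed.
Lemma cReM x y : complex.Re (x * y) =
  complex.Re x * complex.Re y - complex.Im x * complex.Im y.
Proof. by case: x y => [? ?] [? ?]. Qed.
Lemma cImM x y : complex.Im (x * y) =
  complex.Re x * complex.Im y + complex.Im x * complex.Re y.
Proof. by case: x y => [? ?] [? ?]. Qed.
Lemma cReJ x : complex.Re (x^*) = complex.Re x.
Proof. by case: x. Qed.
Lemma cImJ x : complex.Im (x^*) = - complex.Im x.
Proof. by case: x. Qed.
Lemma cRe_sum I (s : seq I) (P : pred I) (F : I -> C) :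
  complex.Re (\sum_(i <- s | P i) F i) = \sum_(i <- s | P i) complex.Re (F i).
Proof. by apply: (big_morph (@complex.Re R) cReD). Qed.
Lemma c_ext x y : complex.Re x = complex.Re y -> complex.Im x = complex.Im y -> x = y.
Proof. by case: x y => [a b] [c d] /= -> ->. Qed.

Lemma cabs2_ge0 x : 0 <= cabs2 x.
Proof. by rewrite addr_ge0 // sqr_ge0. Qed.
Lemma cabs2M x y : cabs2 (x * y) = cabs2 x * cabs2 y.
Proof. by rewrite /cabs2 cReM cImM; ring. Qed.
Lemma cabs2J x : cabs2 (x^*) = cabs2 x.
Proof. by rewrite /cabs2 cReJ cImJ sqrrN. Qed.
Lemma cabs2N x : cabs2 (- x) = cabs2 x.
Proof. by rewrite /cabs2 cReN cImN !sqrrN. Qed.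
Lemma cabs20 : cabs2 (0 : C) = 0.
Proof. by rewrite /cabs2 /= expr0n /= addr0. Qed.
Lemma cabs21 : cabs2 (1 : C) = 1.
Proof. by rewrite /cabs2 /= expr0n expr1n /= addr0. Qed.
Lemma cabs2_eq0 x : cabs2 x = 0 -> x = 0.
Proof.
move/eqP; rewrite paddr_eq0 ?sqr_ge0 // !sqrf_eq0 => /andP[/eqP a /eqP b].
exact: c_ext.
Qed.
Lemma cabs2_parallelogram x y :
  cabs2 (x + y) + cabs2 (x - y) = 2 * cabs2 x + 2 * cabs2 y.
Proof. by rewrite /cabs2 !cReD !cImD !cReN !cImN; ring. Qed.
Lemma cabs2D_le x y : cabs2 (x + y) <= 2 * cabs2 x + 2 * cabs2 y.
Proof. by rewrite -cabs2_parallelogram lerDl cabs2_ge0. Qed.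
(** The difference of the two sides is the squared modulus of [e x - y], divided by [e]. *)
Lemma cabs2D_young (e : R) x y : 0 < e ->
  cabs2 (x + y) <= (1 + e) * cabs2 x + (1 + e^-1) * cabs2 y.
Proof.
move=> e0; rewrite -subr_ge0.
have -> : (1 + e) * cabs2 x + (1 + e^-1) * cabs2 y - cabs2 (x + y) =
  e^-1 * ((e * complex.Re x - complex.Re y) ^+ 2 +
          (e * complex.Im x - complex.Im y) ^+ 2).
  by rewrite /cabs2 cReD cImD; field; rewrite gt_eqF.
by rewrite mulr_ge0 ?addr_ge0 ?sqr_ge0 // invr_ge0 ltW.
Qed.
Lemma cJM x y : (x * y)^* = x^* * y^*.
Proof. by rewrite rmorphM. Qed.
Lemma cJ_real (a : R) : (Complex a 0)^* = Complex a 0.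
Proof. by apply: c_ext; rewrite ?cReJ ?cImJ /= ?oppr0. Qed.
Lemma mulcJ x : x * x^* = Complex (cabs2 x) 0.
Proof. by apply: c_ext; rewrite ?cReM ?cImM cReJ cImJ /cabs2 /=; ring. Qed.
Lemma cabs2_real (a : R) : cabs2 (Complex a 0) = a ^+ 2.
Proof. by rewrite /cabs2 /= expr0n addr0. Qed.
Lemma cReZ (a : R) x : complex.Re (Complex a 0 * x) = a * complex.Re x.
Proof. by rewrite cReM /= mul0r subr0. Qed.
Lemma cImZ (a : R) x : complex.Im (Complex a 0 * x) = a * complex.Im x.
Proof. by rewrite cImM /= mul0r addr0. Qed.
Lemma normRe_le x (M : R) : cabs2 x <= M ^+ 2 -> 0 <= M -> `|complex.Re x| <= M.
Proof.
move=> h M0; rewrite -(ler_pXn2r (ltn0Sn 1)) ?nnegrE // real_normK ?num_real //.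
by apply: le_trans h; rewrite lerDl sqr_ge0.
Qed.
Lemma normIm_le x (M : R) : cabs2 x <= M ^+ 2 -> 0 <= M -> `|complex.Im x| <= M.
Proof.
move=> h M0; rewrite -(ler_pXn2r (ltn0Sn 1)) ?nnegrE // real_normK ?num_real //.
by apply: le_trans h; rewrite lerDr sqr_ge0.
Qed.
Lemma cexpiD (a b : R) : cexpi (a + b) = cexpi a * cexpi b.
Proof. by apply: c_ext; rewrite ?cReM ?cImM /= ?cosD ?sinD //; ring. Qed.
Lemma cexpi0 : cexpi (0 : R) = 1.
Proof. by rewrite /cexpi cos0 sin0. Qed.
Lemma cexpiN (a : R) : cexpi (- a) = (cexpi a)^*.
Proof. by apply: c_ext; rewrite ?cReJ ?cImJ /= ?cosN ?sinN. Qed.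
Lemma cabs2_cexpi (a : R) : cabs2 (cexpi a) = 1.
Proof. by rewrite /cabs2 /= cos2Dsin2. Qed.
End ComplexNumbers.

Section ComplexL2.
Context dd (T : measurableType dd) (R : realType) (mu : {measure set T -> \bar R}).
Local Notation C := (R[i]).
Implicit Types f g h : T -> C.

Definition cmeas f := measurable_fun setT (fun x => complex.Re (f x)) /\
  measurable_fun setT (fun x => complex.Im (f x)).

Lemma cmeas_cst (c : C) : cmeas (fun=> c).
Proof. by split; exact: measurable_cst. Qed.
Lemma cmeasD f g : cmeas f -> cmeas g -> cmeas (fun x => f x + g x).
Proof.
move=> [f1 f2] [g1 g2]; split.
  by under eq_fun do rewrite cReD; exact: measurable_funD.
by under eq_fun do rewrite cImD; exact: measurable_funD.
Qed.
Lemma cmeasN f : cmeas f -> cmeas (fun x => - f x).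
Proof.
move=> [f1 f2]; split.
  by under eq_fun do rewrite cReN; exact: measurable_funN.
by under eq_fun do rewrite cImN; exact: measurable_funN.
Qed.
Lemma cmeasB f g : cmeas f -> cmeas g -> cmeas (fun x => f x - g x).
Proof. by move=> ? ?; apply: cmeasD => //; exact: cmeasN. Qed.
Lemma cmeasM f g : cmeas f -> cmeas g -> cmeas (fun x => f x * g x).
Proof.
move=> [f1 f2] [g1 g2]; split.
  by under eq_fun do rewrite cReM; apply: measurable_funB; exact: measurable_funM.
by under eq_fun do rewrite cImM; apply: measurable_funD; exact: measurable_funM.
Qed.
Lemma cmeasZ (c : C) f : cmeas f -> cmeas (fun x => c * f x).
Proof. by move=> ?; apply: cmeasM => //; exact: cmeas_cst. Qed.
Lemma cmeasJ f : cmeas f -> cmeas (fun x => (f x)^*).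
Proof.
move=> [f1 f2]; split.
  by under eq_fun do rewrite cReJ.
by under eq_fun do rewrite cImJ; exact: measurable_funN.
Qed.
Lemma cmeas_sum I (s : seq I) (F : I -> T -> C) :
  (forall i, cmeas (F i)) -> cmeas (fun x => \sum_(i <- s) F i x).
Proof.
move=> mF; elim: s => [|i s IH].
  by under eq_fun do rewrite big_nil; exact: cmeas_cst.
by under eq_fun do rewrite big_cons; exact: cmeasD.
Qed.
Lemma cmeas_prod I (s : seq I) (F : I -> T -> C) :
  (forall i, cmeas (F i)) -> cmeas (fun x => \prod_(i <- s) F i x).
Proof.
move=> mF; elim: s => [|i s IH].
  by under eq_fun do rewrite big_nil; exact: cmeas_cst.
by under eq_fun do rewrite big_cons; exact: cmeasM.
Qed.
Lemma cmeas_cexpi (F : T -> R) : measurable_fun setT F -> cmeas (fun x => cexpi (F x)).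
Proof.
move=> mF; split => /=.
  by apply: measurableT_comp mF; apply: continuous_measurable_fun; exact: continuous_cos.
by apply: measurableT_comp mF; apply: continuous_measurable_fun; exact: continuous_sin.
Qed.
Lemma cmeas_cabs2 f : cmeas f -> measurable_fun setT (fun x => cabs2 (f x)).
Proof. by move=> [f1 f2]; apply: measurable_funD; exact: measurable_funX. Qed.
Lemma cmeas_ecabs2 f : cmeas f -> measurable_fun setT (fun x => (cabs2 (f x))%:E).
Proof. by move=> mf; apply/measurable_EFinP; exact: cmeas_cabs2. Qed.

Definition cintble f := mu.-integrable setT (fun x => (complex.Re (f x))%:E) /\
  mu.-integrable setT (fun x => (complex.Im (f x))%:E).

Lemma cintble_le f (G : T -> R) : cmeas f -> mu.-integrable setT (fun x => (G x)%:E) ->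
  (forall x, `|complex.Re (f x)| <= G x) -> (forall x, `|complex.Im (f x)| <= G x) ->
  cintble f.
Proof.
move=> [f1 f2] iG h1 h2; split; apply: le_integrable iG => //.
- exact/measurable_EFinP.
- by move=> x _ /=; rewrite lee_fin; exact: le_trans (h1 x) (ler_norm _).
- exact/measurable_EFinP.
- by move=> x _ /=; rewrite lee_fin; exact: le_trans (h2 x) (ler_norm _).
Qed.

Definition cI f : C := Complex (\int[mu]_x (complex.Re (f x))) (\int[mu]_x (complex.Im (f x))).

Lemma eq_cI f g : (forall x, f x = g x) -> cI f = cI g.
Proof. by move=> fg; congr cI; apply/funext. Qed.

Lemma cintbleD f g : cintble f -> cintble g -> cintble (fun x => f x + g x).
Proof.
move=> [f1 f2] [g1 g2]; split.
  by under eq_fun do rewrite cReD EFinD; exact: integrableD.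
by under eq_fun do rewrite cImD EFinD; exact: integrableD.
Qed.
Lemma cID f g : cintble f -> cintble g -> cI (fun x => f x + g x) = cI f + cI g.
Proof.
move=> [f1 f2] [g1 g2]; apply: c_ext; rewrite ?cReD ?cImD /=.
  by under eq_Rintegral do rewrite cReD; rewrite RintegralD.
by under eq_Rintegral do rewrite cImD; rewrite RintegralD.
Qed.
Lemma cintbleZ (c : C) f : cintble f -> cintble (fun x => c * f x).
Proof.
have H (a : R) (F : T -> R) : mu.-integrable setT (fun x => (F x)%:E) ->
    mu.-integrable setT (fun x => (a * F x)%:E).
  by move=> iF; under eq_fun do rewrite EFinM; exact: integrableZl.
move=> [f1 f2]; split.
  by under eq_fun do rewrite cReM EFinB; apply: integrableB => //; exact: H.
by under eq_fun do rewrite cImM EFinD; apply: integrableD => //; exact: H.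
Qed.
Lemma cIZ (c : C) f : cintble f -> cI (fun x => c * f x) = c * cI f.
Proof.
have H (a : R) (F : T -> R) : mu.-integrable setT (fun x => (F x)%:E) ->
    mu.-integrable setT (fun x => (a * F x)%:E).
  by move=> iF; under eq_fun do rewrite EFinM; exact: integrableZl.
move=> [f1 f2]; apply: c_ext; rewrite ?cReM ?cImM /=.
  under eq_Rintegral do rewrite cReM.
  by rewrite RintegralB ?RintegralZl //; exact: H.
under eq_Rintegral do rewrite cImM.
by rewrite RintegralD ?RintegralZl //; exact: H.
Qed.
Lemma cIJ f : cintble f -> cI (fun x => (f x)^*) = (cI f)^*.
Proof.
move=> [f1 f2]; apply: c_ext; rewrite ?cReJ ?cImJ /=.
  by apply: eq_Rintegral => x _; rewrite cReJ.
under eq_Rintegral do rewrite cImJ -mulN1r.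
by rewrite RintegralZl // mulN1r.
Qed.
Lemma cintbleJ f : cintble f -> cintble (fun x => (f x)^*).
Proof.
move=> [f1 f2]; split; first by under eq_fun do rewrite cReJ.
by under eq_fun do rewrite cImJ EFinN; exact: integrableN.
Qed.
Lemma cintble0 : cintble (fun=> 0).
Proof. by split; exact: integrable0. Qed.
Lemma cI0 : cI (fun=> 0) = 0.
Proof. by apply: c_ext => /=; rewrite /Rintegral integral0. Qed.
Lemma cintble_sum I (s : seq I) (F : I -> T -> C) :
  (forall i, cintble (F i)) -> cintble (fun x => \sum_(i <- s) F i x).
Proof.
move=> iF; elim: s => [|i s IH].
  by under eq_fun do rewrite big_nil; exact: cintble0.
by under eq_fun do rewrite big_cons; exact: cintbleD.
Qed.
Lemma cI_sum I (s : seq I) (F : I -> T -> C) : (forall i, cintble (F i)) ->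
  cI (fun x => \sum_(i <- s) F i x) = \sum_(i <- s) cI (F i).
Proof.
move=> iF; elim: s => [|i s IH].
  by rewrite big_nil -[RHS]cI0; apply: eq_cI => x; rewrite big_nil.
rewrite big_cons -IH -cID //; last exact: cintble_sum.
by apply: eq_cI => x; rewrite big_cons.
Qed.

(** [n2] and [Nm] are both squared norms: [n2] is extended-valued and can be handled before
    integrability is known, while [Nm] is its finite part and serves real arithmetic on [L2]. *)
Definition n2 f : \bar R := \int[mu]_x (cabs2 (f x))%:E.
Definition L2 f := cmeas f /\ (n2 f < +oo)%E.
Definition Nm f : R := fine (n2 f).
Definition ip f g : C := cI (fun x => f x * (g x)^*).

Lemma n2_ge0 f : (0 <= n2 f)%E.
Proof. by apply: integral_ge0 => x _; rewrite lee_fin cabs2_ge0. Qed.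
Lemma Nm_ge0 f : 0 <= Nm f.
Proof. by apply: fine_ge0; exact: n2_ge0. Qed.
Lemma NmE f : L2 f -> (Nm f)%:E = n2 f.
Proof. by move=> [_ h]; rewrite fineK // ge0_fin_numE // n2_ge0. Qed.
Lemma eq_n2 f g : (forall x, f x = g x) -> n2 f = n2 g.
Proof. by move=> fg; congr n2; apply/funext. Qed.

(** Only nonnegative integrals occur, so no finiteness is assumed; the closure of [L2] under sums is
    deduced from it. *)
Lemma n2_parallelogram f g : cmeas f -> cmeas g ->
  (n2 (fun x => f x + g x)%R + n2 (fun x => f x - g x)%R = 2%:E * n2 f + 2%:E * n2 g)%E.
Proof.
move=> mf mg; have ge (k : T -> C) x : setT x -> (0 <= (cabs2 (k x))%:E)%E.
  by rewrite lee_fin cabs2_ge0.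
rewrite /n2 -!ge0_integralZl //; do ?[exact: cmeas_ecabs2|exact: ge].
have m2 (k : T -> C) : cmeas k -> measurable_fun setT (fun x => 2%:E * (cabs2 (k x))%:E)%E.
  by move=> mk; apply: measurable_funeM; exact: cmeas_ecabs2.
have ge2 (k : T -> C) x : setT x -> (0 <= 2%:E * (cabs2 (k x))%:E)%E.
  by move=> _; rewrite mule_ge0 // lee_fin cabs2_ge0.
rewrite -ge0_integralD //; [|exact: (ge (fun x => f x + g x))|
  by apply: cmeas_ecabs2; exact: cmeasD|exact: (ge (fun x => f x - g x))|
  by apply: cmeas_ecabs2; exact: cmeasB].
rewrite -ge0_integralD //; [|exact: ge2|exact: m2|exact: ge2|exact: m2].
by apply: eq_integral => x _; rewrite -EFinD cabs2_parallelogram.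
Qed.

Lemma L2Z (c : C) f : L2 f -> L2 (fun x => c * f x).
Proof.
move=> [mf ff]; split; first exact: cmeasZ.
rewrite /n2; under eq_integral do rewrite cabs2M EFinM.
rewrite ge0_integralZl // ?lee_fin ?cabs2_ge0 //; last 2 first.
- exact: cmeas_ecabs2.
- by move=> x _; rewrite lee_fin cabs2_ge0.
by rewrite lte_mul_pinfty // lee_fin cabs2_ge0.
Qed.
Lemma n2Z (c : C) f : cmeas f -> n2 (fun x => c * f x) = ((cabs2 c)%:E * n2 f)%E.
Proof.
move=> mf; rewrite /n2; under eq_integral do rewrite cabs2M EFinM.
rewrite ge0_integralZl // ?lee_fin ?cabs2_ge0 //; first exact: cmeas_ecabs2.
by move=> x _; rewrite lee_fin cabs2_ge0.
Qed.
Lemma NmZ (c : C) f : L2 f -> Nm (fun x => c * f x) = cabs2 c * Nm f.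
Proof.
move=> lf; have [mf _] := lf.
by rewrite /Nm n2Z // -(NmE lf) -EFinM.
Qed.
Lemma n2D_le f g : cmeas f -> cmeas g ->
  (n2 (fun x => f x + g x)%R <= 2%:E * n2 f + 2%:E * n2 g)%E.
Proof. by move=> mf mg; rewrite -n2_parallelogram // leeDl // n2_ge0. Qed.
Lemma L2D f g : L2 f -> L2 g -> L2 (fun x => f x + g x).
Proof.
move=> [mf ff] [mg gg]; split; first exact: cmeasD.
by apply: (le_lt_trans (n2D_le mf mg)); rewrite lte_add_pinfty // lte_mul_pinfty.
Qed.
Lemma L2N f : L2 f -> L2 (fun x => - f x).
Proof.
by move=> /(L2Z (-1)) h; rewrite (_ : (fun _ => _) = (fun x => -1 * f x)) //;
  apply/funext => x; rewrite mulN1r.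
Qed.
Lemma L2B f g : L2 f -> L2 g -> L2 (fun x => f x - g x).
Proof. by move=> lf lg; apply: L2D => //; exact: L2N. Qed.
Lemma n20 : n2 (fun=> 0) = 0%E.
Proof. by rewrite /n2 integral0_eq // => x _; rewrite cabs20. Qed.
Lemma L20 : L2 (fun=> 0).
Proof. by split; [exact: cmeas_cst|rewrite n20 ltry]. Qed.
Lemma L2_sum I (s : seq I) (F : I -> T -> C) :
  (forall i, L2 (F i)) -> L2 (fun x => \sum_(i <- s) F i x).
Proof.
move=> iF; elim: s => [|i s IH].
  by under eq_fun do rewrite big_nil; exact: L20.
by under eq_fun do rewrite big_cons; exact: L2D.
Qed.

Lemma L2_integrable f : L2 f -> mu.-integrable setT (fun x => (cabs2 (f x))%:E).
Proof.
move=> [mf ff]; apply/integrableP; split; first exact: cmeas_ecabs2.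
apply: le_lt_trans ff; rewrite le_eqVlt; apply/orP; left; apply/eqP.
by apply: eq_integral => x _; rewrite gee0_abs // lee_fin cabs2_ge0.
Qed.

Lemma ip_cintble f g : L2 f -> L2 g -> cintble (fun x => f x * (g x)^*).
Proof.
move=> lf lg; have [[mf _] [mg _]] := (lf, lg).
apply: (@cintble_le _ (fun x => cabs2 (f x) + cabs2 (g x))).
- by apply: cmeasM => //; exact: cmeasJ.
- under eq_fun do rewrite EFinD.
  by apply: integrableD => //; exact: L2_integrable.
- move=> x; rewrite cReM cReJ cImJ mulrN opprK /cabs2; case: (f x) (g x) => [a b] [c e] /=.
  have := (sqr_ge0 (a - c), sqr_ge0 (a + c), sqr_ge0 (b - e), sqr_ge0 (b + e)).
  have := (sqr_ge0 a, sqr_ge0 b, sqr_ge0 c, sqr_ge0 e).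
  by rewrite ler_norml => -[[[? ?] ?] ?] -[[[? ?] ?] ?]; apply/andP; split; nra.
- move=> x; rewrite cImM cReJ cImJ /cabs2; case: (f x) (g x) => [a b] [c e] /=.
  have := (sqr_ge0 (a - e), sqr_ge0 (a + e), sqr_ge0 (b - c), sqr_ge0 (b + c)).
  have := (sqr_ge0 a, sqr_ge0 b, sqr_ge0 c, sqr_ge0 e).
  by rewrite ler_norml => -[[[? ?] ?] ?] -[[[? ?] ?] ?]; apply/andP; split; nra.
Qed.

Lemma ipDl f g h : L2 f -> L2 g -> L2 h ->
  ip (fun x => f x + g x) h = ip f h + ip g h.
Proof.
move=> lf lg lh; rewrite /ip -cID; do ?exact: ip_cintble.
by apply: eq_cI => x; rewrite mulrDl.
Qed.
Lemma ipZl (c : C) f h : L2 f -> L2 h -> ip (fun x => c * f x) h = c * ip f h.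
Proof.
move=> lf lh; rewrite /ip -cIZ; last exact: ip_cintble.
by apply: eq_cI => x; rewrite mulrA.
Qed.
Lemma ipC f g : L2 f -> L2 g -> ip g f = (ip f g)^*.
Proof.
move=> lf lg; rewrite /ip -cIJ; last exact: ip_cintble.
by apply: eq_cI => x; rewrite rmorphM /= conjCK mulrC.
Qed.
Lemma ipNl f h : L2 f -> L2 h -> ip (fun x => - f x) h = - ip f h.
Proof.
move=> lf lh; rewrite -mulN1r -ipZl //; congr ip; apply/funext => x.
by rewrite mulN1r.
Qed.
Lemma ipBl f g h : L2 f -> L2 g -> L2 h ->
  ip (fun x => f x - g x) h = ip f h - ip g h.
Proof. by move=> lf lg lh; rewrite ipDl ?ipNl //; exact: L2N. Qed.
Lemma ipDr f g h : L2 f -> L2 g -> L2 h ->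
  ip h (fun x => f x + g x) = ip h f + ip h g.
Proof.
move=> lf lg lh; rewrite ipC ?ipDl //; last exact: L2D.
by rewrite rmorphD /= -!ipC.
Qed.
Lemma ipZr (c : C) f h : L2 f -> L2 h -> ip h (fun x => c * f x) = c^* * ip h f.
Proof.
move=> lf lh; rewrite ipC ?ipZl //; last exact: L2Z.
by rewrite rmorphM /= -ipC.
Qed.
Lemma ipNr f h : L2 f -> L2 h -> ip h (fun x => - f x) = - ip h f.
Proof.
move=> lf lh; rewrite ipC ?ipNl //; last exact: L2N.
by rewrite rmorphN /= -ipC.
Qed.
Lemma ipBr f g h : L2 f -> L2 g -> L2 h ->
  ip h (fun x => f x - g x) = ip h f - ip h g.
Proof. by move=> lf lg lh; rewrite ipDr ?ipNr //; exact: L2N. Qed.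
Lemma ip_suml I (s : seq I) (F : I -> T -> C) h : (forall i, L2 (F i)) -> L2 h ->
  ip (fun x => \sum_(i <- s) F i x) h = \sum_(i <- s) ip (F i) h.
Proof.
move=> lF lh; rewrite /ip -cI_sum => [|i]; last exact: ip_cintble.
by apply: eq_cI => x; rewrite mulr_suml.
Qed.
Lemma ip_sumr I (s : seq I) (F : I -> T -> C) h : (forall i, L2 (F i)) -> L2 h ->
  ip h (fun x => \sum_(i <- s) F i x) = \sum_(i <- s) ip h (F i).
Proof.
move=> lF lh; rewrite ipC //; last exact: L2_sum.
rewrite ip_suml // rmorph_sum /=; apply: eq_bigr => i _; exact/esym/ipC.
Qed.
Lemma ip_ff f : L2 f -> ip f f = Complex (Nm f) 0.
Proof.
move=> lf; apply: c_ext; rewrite /ip /=.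
  by apply: eq_Rintegral => x _; rewrite mulcJ.
rewrite -[RHS](_ : fine (\int[mu]_x (0%:E)) = 0); last by rewrite integral0.
by apply: eq_Rintegral => x _; rewrite mulcJ.
Qed.

Lemma NmD f g : L2 f -> L2 g ->
  Nm (fun x => f x + g x) = Nm f + Nm g + 2 * complex.Re (ip f g).
Proof.
move=> lf lg; have := ip_ff (L2D lf lg).
rewrite ipDl ?ipDr //; do ?exact: L2D.
rewrite (@ipC f g) // !ip_ff // => /(congr1 (@complex.Re R)).
by rewrite !cReD cReJ /= => <-; ring.
Qed.
Lemma NmB f g : L2 f -> L2 g ->
  Nm (fun x => f x - g x) = Nm f + Nm g - 2 * complex.Re (ip f g).
Proof.
move=> lf lg; rewrite NmD //; last exact: L2N.
rewrite ipNr // cReN mulrN; congr (_ + _ - _).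
by rewrite /Nm /n2; congr fine; apply: eq_integral => x _; rewrite cabs2N.
Qed.
Lemma NmD_le f g : L2 f -> L2 g -> Nm (fun x => f x + g x) <= 2 * Nm f + 2 * Nm g.
Proof.
move=> lf lg; rewrite -lee_fin EFinD !EFinM !NmE //; last exact: L2D.
by apply: n2D_le; [case: lf|case: lg].
Qed.

(** Positivity of the squared norm of [f - t z g] for real [t]: the factor [z] makes the cross term
    real, and the best choice is [t = 1 / b]. *)
Lemma cauchy_schwarz f g : L2 f -> L2 g -> cabs2 (ip f g) <= Nm f * Nm g.
Proof.
move=> lf lg; set z := ip f g; set a := Nm f; set b := Nm g.
have H (t : R) : 0 <= a - 2 * t * cabs2 z + t ^+ 2 * cabs2 z * b.
  have := Nm_ge0 (fun x => f x - (Complex t 0 * z) * g x).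
  rewrite NmB //; last exact: L2Z.
  rewrite NmZ // ipZr // -/z -/a -/b cabs2M cabs2_real.
  rewrite cJM cJ_real -(mulrA (Complex t 0)) cReZ (mulrC z^* ) mulcJ /= => h.
  by apply: le_trans h _; rewrite le_eqVlt; apply/orP; left; apply/eqP; ring.
have a0 : 0 <= a by exact: Nm_ge0.
have b0 : 0 <= b by exact: Nm_ge0.
have z0 := cabs2_ge0 z.
have [bE|bN] := eqVneq b 0.
  rewrite bE mulr0; have [//|zp] := leP (cabs2 z) 0.
  (* For [b = 0] the polynomial in [t] is affine, and this value of [t] makes it equal to -1. *)
  have := H ((a + 1) / (2 * cabs2 z)); rewrite bE mulr0 addr0.
  rewrite (_ : a - _ = -1); first by rewrite oppr_ge0 ler10.
  by field; rewrite gt_eqF.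
have bp : 0 < b by rewrite lt_neqAle eq_sym bN.
have := H b^-1.
rewrite (_ : a - _ + _ = a - cabs2 z / b); last by field; rewrite gt_eqF.
by rewrite subr_ge0 ler_pdivrMr.
Qed.

Lemma ip_null f g : L2 f -> L2 g -> n2 g = 0%E -> ip f g = 0.
Proof.
move=> lf lg g0; apply: cabs2_eq0; apply/eqP; rewrite eq_le cabs2_ge0 andbT.
by apply: (le_trans (cauchy_schwarz lf lg)); rewrite /Nm g0 mulr0.
Qed.
(** Inner products do not see null modifications; this is how an equation valid almost everywhere is
    used on coefficients. *)
Lemma ip_dist0 f g h : L2 f -> L2 g -> L2 h -> n2 (fun x => f x - g x) = 0%E ->
  ip h f = ip h g.
Proof.
move=> lf lg lh fg; apply/eqP; rewrite -subr_eq0 -ipBr //; apply/eqP.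
by apply: ip_null => //; exact: L2B.
Qed.

End ComplexL2.

(** * Bessel families *)

Section EsumTools.
Variable R : realType.
Local Open Scope ereal_scope.

Lemma finsum_le_esum (I : choiceType) (a : I -> \bar R) (s : seq I) :
  (forall i, 0 <= a i) -> uniq s -> \sum_(i <- s) a i <= \esum_(i in [set: I]) a i.
Proof.
move=> a0 us; apply: esum_ge; exists [set` s].
  by split; [exact: finite_seq|].
by rewrite fsbig_seq.
Qed.

Lemma esum_le_finsum (I : choiceType) (a : I -> \bar R) (b : \bar R) :
  (forall s : seq I, uniq s -> \sum_(i <- s) a i <= b) -> \esum_(i in [set: I]) a i <= b.
Proof.
move=> H; apply: ge_ereal_sup => _ [X [finX _]] <-.
by rewrite fsbig_finite //; apply: H; exact: finmap.fset_uniq.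
Qed.

(** Turns a sum over a countable type into a series, to which monotone convergence applies; integers
    that encode no index contribute 0. *)
Lemma esum_countE (I : countType) (a : I -> \bar R) : (forall i, 0 <= a i) ->
  \esum_(i in [set: I]) a i = \sum_(n <oo) oapp a 0 (@pickle_inv I n).
Proof.
move=> a0; rewrite nneseries_esumT => [|n]; last by case: pickle_inv => /=.
transitivity (\esum_(j in pickle @` [set: I]) oapp a 0 (@pickle_inv I j)).
  rewrite esum_image; first by apply: eq_esum => i _; rewrite pickleK_inv.
  by move=> i j _ _; exact: (pcan_inj pickleK).
rewrite esum_mkcond; apply: eq_esum => j _; case: ifPn => // jn.
case E : (@pickle_inv I j) => [i|//] /=; move: jn; rewrite notin_setE /= => -[].
exists i => //; have := @pickle_invK I j; rewrite /ocancel E /=; exact.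
Qed.

Lemma integral_esum dd (T : measurableType dd) (mu : {measure set T -> \bar R})
    (I : countType) (F : I -> T -> \bar R) :
  (forall i, measurable_fun setT (F i)) -> (forall i x, 0 <= F i x) ->
  \int[mu]_x (\esum_(i in [set: I]) F i x) = \esum_(i in [set: I]) \int[mu]_x F i x.
Proof.
move=> mF F0; rewrite esum_countE => [|i]; last by apply: integral_ge0.
under eq_integral do rewrite esum_countE //.
rewrite integral_nneseries //.
- by apply: eq_eseriesr => n _; case: pickle_inv => //=; rewrite integral0.
- by move=> n; case: pickle_inv => //=.
- by move=> n x _; case: pickle_inv => /=.
Qed.

Lemma measurable_esum dd (T : measurableType dd)
    (I : countType) (F : I -> T -> \bar R) :
  (forall i, measurable_fun setT (F i)) -> (forall i x, 0 <= F i x) ->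
  measurable_fun setT (fun x => \esum_(i in [set: I]) F i x).
Proof.
move=> mF F0; under eq_fun do rewrite esum_countE //.
apply: ge0_emeasurable_sum.
- by move=> n x _ _; case: pickle_inv => /=.
- by move=> n _; case: pickle_inv => //=.
Qed.

End EsumTools.

Section Frames.
Context dd (T : measurableType dd) (R : realType) (mu : {measure set T -> \bar R}).
Local Notation C := (R[i]).
Local Notation L2 := (L2 mu).
Local Notation ip := (ip mu).
Local Notation n2 := (n2 mu).
Local Notation Nm := (Nm mu).
Implicit Types f g h : T -> C.

Lemma NmD_young (e : R) f g : 0 < e -> L2 f -> L2 g ->
  Nm (fun x => f x + g x) <= (1 + e) * Nm f + (1 + e^-1) * Nm g.
Proof.
move=> e0 lf lg; rewrite NmD //.
have := Nm_ge0 mu (fun x => Complex e 0 * f x - g x).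
rewrite NmB ?NmZ ?ipZl ?cReZ ?cabs2_real //; last exact: L2Z.
set a := Nm f; set b := Nm g; set r := complex.Re _ => h.
have {}h : 0 <= e^-1 * (e ^+ 2 * a + b - 2 * (e * r)).
  by rewrite mulr_ge0 // invr_ge0 ltW.
rewrite -subr_ge0; apply: le_trans h _; rewrite le_eqVlt; apply/orP; left; apply/eqP.
by field; rewrite gt_eqF.
Qed.

Lemma Nm_parallelogram f g : L2 f -> L2 g ->
  Nm (fun x => f x + g x) + Nm (fun x => f x - g x) = 2 * Nm f + 2 * Nm g.
Proof. by move=> lf lg; rewrite NmD // NmB //; ring. Qed.

Context (I : choiceType) (e : I -> T -> C).
Hypothesis le : forall i, L2 (e i).

(** The energy of [f] seen by the family [e], extended-valued so that it makes sense before any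
    bound is known; [sq] is its finite part. In [bessel] the constant is always 1. *)
Definition SQ f : \bar R := \esum_(i in [set: I]) (cabs2 (ip f (e i)))%:E.
Definition sq f : R := fine (SQ f).
Definition bessel := forall f, L2 f -> (SQ f <= n2 f)%E.

Lemma SQ_ge0 f : (0 <= SQ f)%E.
Proof. by apply: esum_ge0 => i _; rewrite lee_fin cabs2_ge0. Qed.

Lemma SQ_parallelogram f g : L2 f -> L2 g ->
  (SQ (fun x => f x + g x)%R + SQ (fun x => f x - g x)%R = (SQ f + SQ f) + (SQ g + SQ g))%E.
Proof.
move=> lf lg; have ge (k : T -> C) i : setT i -> (0 <= (cabs2 (ip k (e i)))%:E)%E.
  by rewrite lee_fin cabs2_ge0.
rewrite /SQ -!esumD //; do ?exact: ge; last 2 first.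
- by move=> i _; rewrite adde_ge0 // ge.
- by move=> i _; rewrite adde_ge0 // ge.
apply: eq_esum => i _; rewrite ipDl // ipBl // -!EFinD cabs2_parallelogram.
by congr EFin; ring.
Qed.

Lemma finsum_le_SQ f (s : seq I) : uniq s ->
  ((\sum_(i <- s) cabs2 (ip f (e i)))%:E <= SQ f)%E.
Proof.
move=> us; rewrite -sumEFin; apply: finsum_le_esum => // i.
by rewrite lee_fin cabs2_ge0.
Qed.

(** A finite sum of squared coefficients depends continuously on [f], by Cauchy-Schwarz with the
    constant [K]. So the inequality passes from a dense set to all of [L2] for each finite sum, and
    then to the supremum. *)
Lemma bessel_dense :
  (forall f, L2 f -> forall eps : R, 0 < eps -> exists f',
     [/\ L2 f', (SQ f' <= n2 f')%E & Nm (fun x => f x - f' x) < eps]) -> bessel.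
Proof.
move=> H f lf; apply: esum_le_finsum => s us; rewrite sumEFin -NmE // lee_fin.
apply/ler_addgt0Pr => ep ep0.
set K := \sum_(i <- s) Nm (e i); set N := Nm f.
have K0 : 0 <= K by apply: sumr_ge0 => i _; exact: Nm_ge0.
have N0 : 0 <= N by exact: Nm_ge0.
(* Two applications of Young's inequality give a factor [(1 + eta)^2], which costs at most [3 eta N]
   as [eta <= 1]; the remaining terms add up to [q * Nm h], kept below [eta]. The total excess is at
   most [eta (3 N + 1) <= ep]. *)
pose eta := ep / (3 * N + 1 + ep).
have den : 0 < 3 * N + 1 + ep by lra.
have eta0 : 0 < eta by rewrite divr_gt0.
have eta1 : eta <= 1 by rewrite ler_pdivrMr // mul1r; lra.
have etae : eta * (3 * N + 1) <= ep.
  by rewrite /eta mulrAC ler_pdivrMr //; nra.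
pose w := 1 + eta^-1.
have ei0 : 0 < eta^-1 by rewrite invr_gt0.
have w0 : 0 < w by rewrite /w; lra.
pose q := w * (1 + eta + K).
have q0 : 0 < q by rewrite mulr_gt0 //; lra.
have [f' [lf' sf' hf']] := H f lf (eta / q) (divr_gt0 eta0 q0).
set h := (fun x => f x - f' x) in hf'.
have lh : L2 h by exact: L2B.
have step1 : \sum_(i <- s) cabs2 (ip f (e i)) <=
    (1 + eta) * \sum_(i <- s) cabs2 (ip f' (e i)) + w * (K * Nm h).
  rewrite mulr_sumr mulr_suml mulr_sumr -big_split /=; apply: ler_sum => i _.
  have -> : ip f (e i) = ip f' (e i) + ip h (e i).
    by rewrite ipBl // addrC subrK.
  apply: le_trans (cabs2D_young _ _ eta0) _; rewrite lerD2l ler_wpM2l ?(ltW w0) //.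
  by rewrite mulrC; exact: cauchy_schwarz.
have step2 : \sum_(i <- s) cabs2 (ip f' (e i)) <= Nm f'.
  rewrite -lee_fin NmE //; exact: le_trans (finsum_le_SQ _ us) sf'.
have step3 : Nm f' <= (1 + eta) * N + w * Nm h.
  have -> : f' = (fun x => f x + - h x).
    by apply/funext => x; rewrite /h opprB addrC subrK.
  apply: le_trans (NmD_young eta0 lf (L2N lh)) _.
  rewrite le_eqVlt; apply/orP; left; apply/eqP; congr (_ + _ * _).
  by rewrite /Nm /n2; congr fine; apply: eq_integral => x _; rewrite cabs2N.
have step4 : q * Nm h <= eta by rewrite mulrC -ler_pdivlMr // ltW.
have eta2 : eta ^+ 2 <= eta by rewrite expr2 ger_pMl.
have : (1 + eta) * \sum_(i <- s) cabs2 (ip f' (e i)) <= (1 + eta) * ((1 + eta) * N + w * Nm h).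
  by rewrite ler_wpM2l ?addr_ge0 ?(ltW eta0) //; exact: le_trans step2 step3.
have h1 : eta ^+ 2 * N <= eta * N by rewrite ler_wpM2r.
move: step1 step4 etae h1; rewrite /q -/N; set A := \sum_(i <- s) _; set B := \sum_(i <- s) _.
set n := Nm h; move: (w) (n) (A) (B) => w' n' A' B'; clear => *; nra.
Qed.

Hypothesis be : bessel.

Lemma sqE f : L2 f -> (sq f)%:E = SQ f.
Proof.
move=> lf; rewrite fineK // ge0_fin_numE ?SQ_ge0 //.
by apply: le_lt_trans (be lf) _; case: lf.
Qed.

Lemma sq_le_Nm f : L2 f -> sq f <= Nm f.
Proof. by move=> lf; rewrite -lee_fin sqE // NmE //; exact: be. Qed.

Lemma sq_ge0 f : 0 <= sq f.
Proof. by apply: fine_ge0; exact: SQ_ge0. Qed.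

Lemma sq_parallelogram f g : L2 f -> L2 g ->
  sq (fun x => f x + g x) + sq (fun x => f x - g x) = 2 * sq f + 2 * sq g.
Proof.
move=> lf lg; have := SQ_parallelogram lf lg.
rewrite -!sqE //; do ?[exact: L2D|exact: L2B]; rewrite -!EFinD => -[->]; ring.
Qed.

(** The defect [Nm - sq] is a quadratic form, nonnegative by Bessel. Its parallelogram law at [f']
    and [h = f - f'] gives the bound after discarding the defect of [f' - h] and bounding that of
    [h] by its norm. *)
Lemma defect_le f f' : L2 f -> L2 f' ->
  Nm f - sq f <= 2 * (Nm f' - sq f') + 2 * Nm (fun x => f x - f' x).
Proof.
move=> lf lf'; pose h x := f x - f' x; have lh : L2 h by exact: L2B.
have -> : f = (fun x => f' x + h x) by apply/funext => x; rewrite /h addrC subrK.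
have := sq_parallelogram lf' lh; have := Nm_parallelogram lf' lh.
have := sq_le_Nm (L2B lf' lh); have := sq_ge0 h.
rewrite (_ : (fun x => _ - f' x) = h); last first.
  by apply/funext => x; rewrite addrC addKr.
by move=> *; lra.
Qed.

Lemma sq_le f f' : L2 f -> L2 f' ->
  sq f <= 2 * sq f' + 2 * Nm (fun x => f x - f' x).
Proof.
move=> lf lf'; pose h x := f x - f' x; have lh : L2 h by exact: L2B.
have -> : f = (fun x => f' x + h x) by apply/funext => x; rewrite /h addrC subrK.
have := sq_parallelogram lf' lh; have := sq_ge0 (fun x => f' x - h x).
have := sq_le_Nm lh.
rewrite (_ : (fun x => _ - f' x) = h); last first.
  by apply/funext => x; rewrite addrC addKr.
by move=> *; lra.
Qed.

Lemma SQ_closed f : L2 f ->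
  (forall eps : R, 0 < eps -> exists f',
     [/\ L2 f', SQ f' = n2 f' & Nm (fun x => f x - f' x) < eps]) -> SQ f = n2 f.
Proof.
move=> lf H; rewrite -sqE // -NmE //; congr EFin; apply/eqP; rewrite eq_le sq_le_Nm //=.
apply/ler_addgt0Pr => ep ep0; have ep2 : 0 < ep / 2 by rewrite divr_gt0.
have [f' [lf' sf' hf']] := H (ep / 2) ep2.
have := defect_le lf lf'; rewrite /sq sf' -/(Nm f') subrr mulr0 add0r -/(sq f) => h.
by rewrite -lerBlDl; apply: le_trans h _; rewrite mulrC -ler_pdivlMr // ltW.
Qed.

(** Replaces orthogonal projection for a family that is only Bessel. With [g] the partial synthesis,
    the real part of [ip f g] is the captured energy [sg]. Moreover [Nm g] is a sum of products of
    the coefficients of [f] and of [g], so [2 Nm g <= sg + Nm g] by Bessel for [g], that is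
    [Nm g <= sg]. *)
Lemma synthesis_error f (s : seq I) : L2 f -> uniq s ->
  Nm (fun x => f x - \sum_(i <- s) ip f (e i) * e i x) <=
  Nm f - \sum_(i <- s) cabs2 (ip f (e i)).
Proof.
move=> lf us; pose g x := \sum_(i <- s) ip f (e i) * e i x.
set sg := \sum_(i <- s) _.
have lci i : L2 (fun x => ip f (e i) * e i x) by exact: L2Z.
have lg : L2 g by exact: L2_sum.
have fg : complex.Re (ip f g) = sg.
  rewrite ip_sumr // cRe_sum; apply: eq_bigr => i _.
  by rewrite ipZr // mulrC mulcJ.
have gs : 2 * Nm g <= sg + Nm g.
  have -> : Nm g = \sum_(i <- s) complex.Re (ip f (e i) * (ip g (e i))^* ).
    rewrite -(_ : complex.Re (ip g g) = Nm g); last by rewrite ip_ff.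
    rewrite {1}/g ip_suml // cRe_sum; apply: eq_bigr => i _.
    by rewrite ipZl // (@ipC _ _ _ _ g (e i)).
  have h : \sum_(i <- s) cabs2 (ip g (e i)) <= Nm g.
    by rewrite -lee_fin NmE //; exact: le_trans (finsum_le_SQ _ us) (be lg).
  apply: (@le_trans _ _ (sg + \sum_(i <- s) cabs2 (ip g (e i)))); last first.
    rewrite lerD2l (_ : \sum_(i <- s) complex.Re _ = Nm g) //.
    rewrite -[RHS](_ : complex.Re (ip g g) = Nm g); last by rewrite ip_ff.
    rewrite {3}/g ip_suml // cRe_sum; apply: eq_bigr => i _.
    by rewrite ipZl // (@ipC _ _ _ _ g (e i)).
  rewrite mulr_sumr -big_split; apply: ler_sum => i _.
  move: (ip f (e i)) (ip g (e i)) => [a b] [c d]; rewrite /cabs2 /=.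
  by rewrite -subr_ge0; have := (sqr_ge0 (a - c), sqr_ge0 (b - d)) => -[? ?]; nra.
by rewrite NmB // fg; lra.
Qed.

End Frames.

(** * Fubini's theorem and bounded functions of bounded support *)

Section ProductIntegrals.
Context d1 d2 (T1 : measurableType d1) (T2 : measurableType d2) (R : realType).
Variable m1 : {sigma_finite_measure set T1 -> \bar R}.
Variable m2 : {sigma_finite_measure set T2 -> \bar R}.
Local Notation C := (R[i]).

Lemma measurable_Rintegral_param (F : T1 * T2 -> R) : measurable_fun setT F ->
  measurable_fun setT (fun x => \int[m2]_y F (x, y)).
Proof.
move=> mF; have mE : measurable_fun setT (EFin \o F) by exact/measurable_EFinP.
apply: (@measurableT_comp _ _ _ _ _ _ fine); first exact: fine_measurable.
under eq_fun do rewrite integralE.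
apply: emeasurable_funB.
  rewrite (_ : (fun _ => _) = fubini_F m2 (EFin \o F)^\+%E).
    by apply: measurable_fun_fubini_tonelli_F => //; exact: measurable_funepos.
  by apply/funext => x; apply: eq_integral => y _; rewrite !funeposE.
rewrite (_ : (fun _ => _) = fubini_F m2 (EFin \o F)^\-%E).
  by apply: measurable_fun_fubini_tonelli_F => //; exact: measurable_funeneg.
by apply/funext => x; apply: eq_integral => y _; rewrite !funenegE.
Qed.

Lemma cmeas_cI_param (F : T1 * T2 -> C) : cmeas F ->
  cmeas (fun x => cI m2 (fun y => F (x, y))).
Proof.
by move=> [h1 h2]; split; rewrite /cI /=;
  [exact: (measurable_Rintegral_param h1)|exact: (measurable_Rintegral_param h2)].
Qed.

Lemma Rintegral_Fubini (F : T1 * T2 -> R) :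
  (m1 \x m2)%E.-integrable setT (EFin \o F) ->
  (forall x, m2.-integrable setT (fun y => (F (x, y))%:E)) ->
  (forall y, m1.-integrable setT (fun x => (F (x, y))%:E)) ->
  \int[m1]_x \int[m2]_y F (x, y) = \int[m2]_y \int[m1]_x F (x, y).
Proof.
move=> iF i2 i1; rewrite /Rintegral.
under eq_integral do rewrite fineK ?integrable_fin_num //.
rewrite (Fubini iF); congr fine; apply: eq_integral => y _.
by rewrite fineK // integrable_fin_num.
Qed.

End ProductIntegrals.

Section NiceFunctions.
Context dd (T : measurableType dd) (R : realType) (mu : {measure set T -> \bar R}).
Local Notation C := (R[i]).

(** The working class for Fourier integrals: such functions are integrable and square integrable,
    and multiplication by a character preserves [M] and [B]. *)
Definition bdd_supp (f : T -> C) (M : R) (B : set T) :=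
  [/\ cmeas f, 0 <= M, measurable B, (mu B < +oo)%E &
   (forall x, cabs2 (f x) <= M ^+ 2) /\ (forall x, ~ B x -> f x = 0)].

Lemma integrable_indicT (B : set T) : measurable B -> (mu B < +oo)%E ->
  mu.-integrable setT (fun x => (\1_B x : R)%:E).
Proof.
move=> mB fB; apply/integrableP; split; first exact/measurable_EFinP.
under eq_integral do rewrite gee0_abs ?lee_fin //.
by rewrite integral_indic // setIT.
Qed.

Lemma integrable_indic_scale (M : R) (B : set T) : measurable B -> (mu B < +oo)%E ->
  mu.-integrable setT (fun x => (M * \1_B x)%:E).
Proof.
move=> mB fB; under eq_fun do rewrite EFinM.
by apply: integrableZl => //; exact: integrable_indicT.
Qed.

Lemma bdd_supp_cintble f M B : bdd_supp f M B -> cintble mu f.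
Proof.
move=> [mf M0 mB fB [hM hB]].
apply: (@cintble_le _ _ _ _ _ (fun x => M * \1_B x)) => //.
- exact: integrable_indic_scale.
- move=> x; rewrite indicE; case: (boolP (x \in B)) => [_|]; rewrite ?mulr1 ?mulr0.
    exact: normRe_le.
  by rewrite notin_setE => /hB ->; rewrite normr0.
- move=> x; rewrite indicE; case: (boolP (x \in B)) => [_|]; rewrite ?mulr1 ?mulr0.
    exact: normIm_le.
  by rewrite notin_setE => /hB ->; rewrite normr0.
Qed.

Lemma bdd_supp_L2 f M B : bdd_supp f M B -> L2 mu f.
Proof.
move=> [mf M0 mB fB [hM hB]]; split => //.
apply: (@le_lt_trans _ _ (\int[mu]_x (M ^+ 2 * \1_B x)%:E)%E).
  apply: ge0_le_integral => //.
  - by move=> x _; rewrite lee_fin cabs2_ge0.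
  - exact: cmeas_ecabs2.
  - by apply/measurable_EFinP; apply: measurable_funM.
  - move=> x _; rewrite lee_fin indicE; case: (boolP (x \in B)) => [_|].
      by rewrite mulr1.
    by rewrite notin_setE => /hB ->; rewrite cabs20 mulr0.
under eq_integral do rewrite EFinM.
rewrite ge0_integralZl // ?lee_fin ?sqr_ge0 //; last exact/measurable_EFinP.
by rewrite integral_indic // setIT lte_mul_pinfty // lee_fin sqr_ge0.
Qed.

Lemma bdd_suppM f g M B K : bdd_supp f M B -> cmeas g -> 0 <= K ->
  (forall x, cabs2 (g x) <= K ^+ 2) -> bdd_supp (fun x => g x * f x) (K * M) B.
Proof.
move=> [mf M0 mB fB [hM hB]] mg K0 hg; split => //; first exact: cmeasM.
  exact: mulr_ge0.
split=> x; last by move=> /hB ->; rewrite mulr0.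
by rewrite cabs2M exprMn ler_pM // cabs2_ge0.
Qed.

(** The real and imaginary parts are each bounded by [M] times the measure of [B]; the factor 2 is a
    rounding of the resulting square root of 2. *)
Lemma cabs2_cI_le f M B : bdd_supp f M B ->
  cabs2 (cI mu f) <= (2 * M * fine (mu B)) ^+ 2.
Proof.
move=> bf; have [i1 i2] := bdd_supp_cintble bf; case: bf => mf M0 mB fB [hM hB].
have iG := integrable_indic_scale M mB fB.
have key (F : T -> R) : mu.-integrable setT (fun x => (F x)%:E) ->
    (forall x, `|F x| <= M * \1_B x) -> `|\int[mu]_x F x| <= M * fine (mu B).
  move=> iF hF; apply: le_trans (le_normr_Rintegral _ iF) _ => //.
  apply: (@le_trans _ _ (\int[mu]_x (M * \1_B x))).
    by apply: le_Rintegral => //; exact: (integrable_norm iF).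
  rewrite RintegralZl //; last exact: integrable_indicT.
  by rewrite /Rintegral integral_indic // setIT.
have A0 : 0 <= fine (mu B) by exact: fine_ge0.
have h1 : `|\int[mu]_x complex.Re (f x)| <= M * fine (mu B).
  apply: key => // x; rewrite indicE; case: (boolP (x \in B)) => [_|].
    by rewrite mulr1; exact: normRe_le.
  by rewrite notin_setE => /hB ->; rewrite normr0 mulr0.
have h2 : `|\int[mu]_x complex.Im (f x)| <= M * fine (mu B).
  apply: key => // x; rewrite indicE; case: (boolP (x \in B)) => [_|].
    by rewrite mulr1; exact: normIm_le.
  by rewrite notin_setE => /hB ->; rewrite normr0 mulr0.
rewrite /cabs2 /=.
have sqle (a b : R) : `|a| <= b -> a ^+ 2 <= b ^+ 2.
  move=> ab; rewrite -(real_normK (num_real a)) ler_pXn2r // ?nnegrE //.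
  exact: le_trans ab.
apply: le_trans (lerD (sqle _ _ h1) (sqle _ _ h2)) _.
by rewrite -[2 * M * _]mulrA; have := sqr_ge0 (M * fine (mu B)); nra.
Qed.

End NiceFunctions.

Section NiceFubini.
Context d1 d2 (T1 : measurableType d1) (T2 : measurableType d2) (R : realType).
Variable m1 : {sigma_finite_measure set T1 -> \bar R}.
Variable m2 : {sigma_finite_measure set T2 -> \bar R}.
Local Notation C := (R[i]).

Lemma cI_Fubini (F : T1 * T2 -> C) (M : R) (B1 : set T1) (B2 : set T2) :
  cmeas F -> 0 <= M -> measurable B1 -> (m1 B1 < +oo)%E ->
  measurable B2 -> (m2 B2 < +oo)%E ->
  (forall p, cabs2 (F p) <= M ^+ 2) ->
  (forall x y, ~ B1 x \/ ~ B2 y -> F (x, y) = 0) ->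
  cI m1 (fun x => cI m2 (fun y => F (x, y))) =
  cI m2 (fun y => cI m1 (fun x => F (x, y))).
Proof.
move=> mF M0 mB1 fB1 mB2 fB2 hM hB.
have [p1 p2] : cintble (m1 \x m2)%E F.
  apply: (@bdd_supp_cintble _ _ _ (m1 \x m2)%E F M (B1 `*` B2)); split => //.
  - exact: measurableX.
  - rewrite /= product_measure1E // lte_mul_pinfty // ge0_fin_numE //.
  split => // -[x y] /= /not_andP; exact: hB.
have q1 x : cintble m2 (fun y => F (x, y)).
  apply: (@bdd_supp_cintble _ _ _ m2 _ M B2); split => //.
    case: mF => a b; split;
    [apply: measurableT_comp a _ | apply: measurableT_comp b _]; exact: measurable_pair1.
  by split=> // y By; apply: hB; right.
have q2 y : cintble m1 (fun x => F (x, y)).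
  apply: (@bdd_supp_cintble _ _ _ m1 _ M B1); split => //.
    case: mF => a b; split;
    [apply: measurableT_comp a _ | apply: measurableT_comp b _]; exact: measurable_pair2.
  by split=> // x Bx; apply: hB; left.
rewrite /cI /=; congr Complex.
  apply: (Rintegral_Fubini (F := fun p => complex.Re (F p))) => //.
    by move=> x; case: (q1 x).
  by move=> y; case: (q2 y).
apply: (Rintegral_Fubini (F := fun p => complex.Im (F p))) => //.
  by move=> x; case: (q1 x).
by move=> y; case: (q2 y).
Qed.

End NiceFubini.

(** * Fourier series *)

Lemma esumZl (R : realType) (I : countType) (a : I -> \bar R) (r : R) :
  (forall i, 0 <= a i)%E -> (0 <= r) ->
  (\esum_(i in [set: I]) (r%:E * a i) = r%:E * \esum_(i in [set: I]) a i)%E.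
Proof.
move=> a0 r0; rewrite !esum_countE //; last by move=> i; rewrite mule_ge0 // lee_fin.
rewrite -nneseriesZl; last by move=> i _; case: pickle_inv.
by apply: eq_eseriesr => n _; case: pickle_inv => //=; rewrite mule0.
Qed.

Section OrthonormalFrames.
Context dd (T : measurableType dd) (R : realType) (mu : {measure set T -> \bar R}).
Local Notation C := (R[i]).
Context (I : countType) (e : I -> T -> C).
Hypothesis le : forall i, L2 mu (e i).

Lemma orthonormal_bessel :
  (forall i j, ip mu (e i) (e j) = (i == j)%:R) -> bessel mu e.
Proof.
move=> on f lf; apply: esum_le_finsum => s us; rewrite sumEFin -NmE // lee_fin.
pose g x := \sum_(i <- s) ip mu f (e i) * e i x.
have lci i : L2 mu (fun x => ip mu f (e i) * e i x) by exact: L2Z.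
have lg : L2 mu g by exact: L2_sum.
set sg := \sum_(i <- s) _.
have fg : complex.Re (ip mu f g) = sg.
  rewrite ip_sumr // cRe_sum; apply: eq_bigr => i _.
  by rewrite ipZr // mulrC mulcJ.
have gg : Nm mu g = sg.
  rewrite -(_ : complex.Re (ip mu g g) = Nm mu g); last by rewrite ip_ff.
  rewrite {1}/g ip_suml // cRe_sum /sg !big_seq; apply: eq_bigr => i si.
  rewrite ipZl // (_ : ip mu (e i) g = (ip mu f (e i))^* ) ?mulcJ //.
  rewrite ip_sumr // (bigD1_seq i) //= ipZr // on eqxx mulr1 big1 ?addr0 // => j ji.
  by rewrite ipZr // on eq_sym (negPf ji) mulr0.
have := Nm_ge0 mu (fun x => f x - g x); rewrite NmB // fg gg; lra.
Qed.

Hypothesis be : bessel mu e.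

(** The vectors with equality in Bessel's inequality. They form a closed subspace, so completeness
    of [e] may be tested on indicators of intervals. *)
Definition tight f := L2 mu f /\ SQ mu e f = n2 mu f.

Lemma tight_sq f : tight f -> sq mu e f = Nm mu f.
Proof. by case=> lf h; rewrite /sq h. Qed.

Lemma tightP f : L2 mu f -> sq mu e f = Nm mu f -> tight f.
Proof. by move=> lf h; split=> //; rewrite -(sqE be lf) -NmE // h. Qed.

(** Sum and difference are treated together: the parallelogram laws make the two defects add up to
    zero, and Bessel makes each of them nonnegative. *)
Lemma tightD f g : tight f -> tight g ->
  tight (fun x => f x + g x) /\ tight (fun x => f x - g x).
Proof.
move=> tf tg; have [[lf _] [lg _]] := (tf, tg).
have := sq_parallelogram le be lf lg; have := Nm_parallelogram lf lg.
rewrite (tight_sq tf) (tight_sq tg).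
have := sq_le_Nm be (L2D lf lg); have := sq_le_Nm be (L2B lf lg).
by move=> *; split; apply: tightP; do ?[exact: L2D|exact: L2B]; lra.
Qed.

Lemma tightZ (c : C) f : tight f -> tight (fun x => c * f x).
Proof.
move=> [lf tf]; split; first exact: L2Z.
rewrite n2Z; last by case: lf.
rewrite -tf /SQ -esumZl ?cabs2_ge0 // => [|i]; last by rewrite lee_fin cabs2_ge0.
by apply: eq_esum => i _; rewrite ipZl // cabs2M EFinM.
Qed.

Lemma tight0 : tight (fun=> 0).
Proof.
split; first exact: L20.
rewrite n20; apply: esum1 => i _.
by rewrite (_ : ip mu _ _ = 0) ?cabs20 // -[RHS](cI0 mu); apply: eq_cI => x; rewrite mul0r.
Qed.

Lemma tight_sum J (s : seq J) (F : J -> T -> C) :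
  (forall j, tight (F j)) -> tight (fun x => \sum_(j <- s) F j x).
Proof.
move=> tF; elim: s => [|i s IH].
  by under eq_fun do rewrite big_nil; exact: tight0.
by under eq_fun do rewrite big_cons; have [] := tightD (tF i) IH.
Qed.

Lemma tight_closed f : L2 mu f ->
  (forall eps : R, 0 < eps -> exists f', tight f' /\ Nm mu (fun x => f x - f' x) < eps) ->
  tight f.
Proof.
move=> lf H; split=> //; apply: (SQ_closed le be) => // eps ep0.
by have [f' [[lf' tf'] h]] := H eps ep0; exists f'.
Qed.

End OrthonormalFrames.

Section FourierSeries.
Variable R : realType.
Local Notation C := (R[i]).
Local Notation leb := (@lebesgue_measure R).
Local Notation RT := (measurableTypeR R).

Lemma Rintegral_FTC (f F : R -> R) (a b : R) : a < b -> continuous f ->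
  (forall x : R, is_derive x (1 : R) F (f x)) -> \int[leb]_(x in `]a, b]) f x = F b - F a.
Proof.
move=> ab cf dF.
have cF x : {for x, continuous F}.
  by apply/differentiable_continuous/derivable1_diffP; have [] := dF x.
rewrite /Rintegral integral_itv_obnd_cbnd; last first.
  apply: measurable_funTS; apply/measurable_EFinP; exact: continuous_measurable_fun.
rewrite (@continuous_FTC2 R f F) //.
- by apply: continuous_subspaceT.
- split; first by move=> x _; have [] := dF x.
  + by apply: cvg_at_right_filter; exact: cF.
  + by apply: cvg_at_left_filter; exact: cF.
- by move=> x _; rewrite derive1E; have [_ ->] := dF x.
Qed.

Lemma Rintegral_indicM (D : set RT) (f : R -> R) :
  \int[leb]_x (\1_D x * f x) = \int[leb]_(x in D) f x.
Proof.
rewrite [in RHS]Rintegral_mkcond; apply: eq_Rintegral => x _.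
by rewrite patchE indicE; case: ifP => _; rewrite ?mul1r ?mul0r.
Qed.

Lemma is_derive_sinM (w x : R) : is_derive x 1 (fun u => sin (w * u)) (w * cos (w * x)).
Proof.
have h : is_derive x 1 (fun u : R => w * u) w.
  by apply: (is_derive_eq (is_deriveZ w (is_derive_id x 1))); rewrite /GRing.scale /= mulr1.
by apply: (is_derive_eq (is_derive1_comp (is_derive_sin _) h)); rewrite mulrC.
Qed.
Lemma is_derive_cosM (w x : R) : is_derive x 1 (fun u => cos (w * u)) (- (w * sin (w * x))).
Proof.
have h : is_derive x 1 (fun u : R => w * u) w.
  by apply: (is_derive_eq (is_deriveZ w (is_derive_id x 1))); rewrite /GRing.scale /= mulr1.
by apply: (is_derive_eq (is_derive1_comp (is_derive_cos _) h)); rewrite mulNr mulrC.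
Qed.
Lemma continuous_cosM (w : R) : continuous (fun u => cos (w * u)).
Proof.
move=> x; apply: (@continuous_comp _ _ _ (fun u => w * u) cos); last exact: continuous_cos.
exact: mulrl_continuous.
Qed.
Lemma continuous_sinM (w : R) : continuous (fun u => sin (w * u)).
Proof.
move=> x; apply: (@continuous_comp _ _ _ (fun u => w * u) sin); last exact: continuous_sin.
exact: mulrl_continuous.
Qed.

Lemma integral_cosM (w a b : R) : a < b -> w != 0 ->
  \int[leb]_(x in `]a, b]) cos (w * x) = (sin (w * b) - sin (w * a)) / w.
Proof.
move=> ab w0.
have dF (x : R) : is_derive x (1 : R) (fun u => w^-1 * sin (w * u)) (cos (w * x)).
  apply: (is_derive_eq (is_deriveZ w^-1 (is_derive_sinM w x))).
  by rewrite /GRing.scale /= mulKf.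
by rewrite (Rintegral_FTC ab (@continuous_cosM w) dF); field.
Qed.
Lemma integral_sinM (w a b : R) : a < b -> w != 0 ->
  \int[leb]_(x in `]a, b]) sin (w * x) = (cos (w * a) - cos (w * b)) / w.
Proof.
move=> ab w0.
have dF (x : R) : is_derive x (1 : R) (fun u => - w^-1 * cos (w * u)) (sin (w * x)).
  apply: (is_derive_eq (is_deriveZ (- w^-1) (is_derive_cosM w x))).
  by rewrite /GRing.scale /= mulrNN mulKf.
by rewrite (Rintegral_FTC ab (@continuous_sinM w) dF); field.
Qed.
Lemma integral_rampM (s t w a b : R) : a < b -> w != 0 ->
  \int[leb]_(x in `]a, b]) ((t + s * x) * cos (w * x)) =
  (t + s * b) * sin (w * b) / w + s * cos (w * b) / w ^+ 2
  - ((t + s * a) * sin (w * a) / w + s * cos (w * a) / w ^+ 2).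
Proof.
move=> ab w0.
pose A (u : R) := t + s * u; pose S (u : R) := sin (w * u).
pose K (u : R) := cos (w * u).
have dA (x : R) : is_derive x (1 : R) A s.
  have := is_deriveD (is_derive_cst t x 1) (is_deriveZ s (is_derive_id x 1)).
  by move=> h; apply: (is_derive_eq h); rewrite add0r /GRing.scale /= mulr1.
have cA : continuous A.
  by move=> x; apply: cvgD; [exact: cvg_cst|exact: mulrl_continuous].
have cAK : continuous (fun x => A x * K x).
  by move=> x; apply: cvgM; [exact: cA|exact: continuous_cosM].
pose G (u : R) : R := w^-1 * (A u * S u) + s / w ^+ 2 * K u.
have dF (x : R) : is_derive x (1 : R) G (A x * K x).
  have h := is_deriveD (is_deriveZ w^-1 (is_deriveM (dA x) (is_derive_sinM w x)))
    (is_deriveZ (s / w ^+ 2) (is_derive_cosM w x)).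
  by apply: (is_derive_eq h); rewrite /A /S /K /GRing.scale /=; field.
by rewrite (Rintegral_FTC ab cAK dF) /G /A /S /K; field.
Qed.
Lemma integral_ramp (s t a b : R) : a < b ->
  \int[leb]_(x in `]a, b]) (t + s * x) =
  t * b + s * b ^+ 2 / 2 - (t * a + s * a ^+ 2 / 2).
Proof.
move=> ab.
have cA : continuous (fun x : R => t + s * x).
  by move=> x; apply: cvgD; [exact: cvg_cst|exact: mulrl_continuous].
pose G (u : R) : R := t * u + s / 2 * (u * u).
have dF (x : R) : is_derive x (1 : R) G (t + s * x).
  have h := is_deriveD (is_deriveZ t (is_derive_id x 1))
    (is_deriveZ (s / 2) (is_deriveM (is_derive_id x 1) (is_derive_id x 1))).
  by apply: (is_derive_eq h); rewrite /GRing.scale /=; field.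
by rewrite (Rintegral_FTC ab cA dF) /G; field.
Qed.

End FourierSeries.

Section FourierCoefficients.
Variable R : realType.
Local Notation C := (R[i]).
Local Notation leb := (@lebesgue_measure R).
Local Notation RT := (measurableTypeR R).

Definition piI : set RT := `]- pi, pi]%classic.
Definition fhat (F : R -> C) (l : int) : C := cI leb (fun x : RT => F x * cexpi (l%:~R * x)).
Definition knorm : R := (Num.sqrt (2 * pi))^-1.
(** Normalized exponentials restricted to one period. The minus sign turns into a plus under the
    conjugation in [ip], which matches [fhat] and the phase produced by a translation by [- l]. *)
Definition fexp (l : int) (x : RT) : C :=
  Complex (knorm * \1_piI x) 0 * cexpi (- (l%:~R * x)).

Lemma twopi_gt0 : 0 < 2 * pi :> R.
Proof. by rewrite mulr_gt0 // pi_gt0. Qed.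
Lemma knorm2 : knorm ^+ 2 = (2 * pi)^-1.
Proof. by rewrite /knorm exprVn sqr_sqrtr // ltW // twopi_gt0. Qed.
Lemma knorm_ge0 : 0 <= knorm.
Proof. by rewrite invr_ge0 sqrtr_ge0. Qed.

Lemma leb_oc (a b : R) : a <= b -> leb `]a, b]%classic = (b - a)%:E.
Proof.
rewrite le_eqVlt => /predU1P[->|ab]; first by rewrite set_itvoc0 measure0 subrr.
by rewrite lebesgue_measure_itv /= lte_fin ab.
Qed.

Lemma cmeas_cexpiM (w : R) : cmeas (fun x : RT => cexpi (w * x)).
Proof. by apply: cmeas_cexpi; apply: continuous_measurable_fun; exact: mulrl_continuous. Qed.

Lemma cmeas_indic (D : set RT) (c : R) : measurable D ->
  cmeas (fun x : RT => Complex (c * \1_D x) 0).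
Proof. by move=> mD; split => /=; [apply: measurable_funM|exact: measurable_cst]. Qed.

Lemma bdd_indic (D : set RT) (c : R) : measurable D -> (leb D < +oo)%E -> 0 <= c ->
  bdd_supp leb (fun x : RT => Complex (c * \1_D x) 0) c D.
Proof.
move=> mD fD c0; split=> //; first exact: cmeas_indic.
split=> x; rewrite indicE.
  rewrite cabs2_real; case: (x \in D); rewrite ?mulr1 ?mulr0 // expr0n /=.
  exact: sqr_ge0.
by move=> nD; rewrite memNset // mulr0.
Qed.

Lemma leb_piI : (leb piI < +oo)%E.
Proof. by rewrite leb_oc ?ltry // -subr_ge0 opprK addr_ge0 // pi_ge0. Qed.

Lemma bdd_cexpiM F (M : R) B (w : R) : bdd_supp leb F M B ->
  bdd_supp leb (fun x : RT => F x * cexpi (w * x)) M B.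
Proof.
move=> bF; have := bdd_suppM (K := 1) bF (cmeas_cexpiM w) ler01.
rewrite mul1r (_ : (fun x => _ * F x) = (fun x : RT => F x * cexpi (w * x))).
  by apply=> x; rewrite cabs2_cexpi expr1n.
by apply/funext => x; rewrite mulrC.
Qed.

Lemma bdd_fexp l : bdd_supp leb (fexp l) knorm piI.
Proof.
have := bdd_cexpiM (- l%:~R) (bdd_indic (measurable_itv _) leb_piI knorm_ge0).
by rewrite /fexp; under [X in _ -> bdd_supp _ X _ _]eq_fun do rewrite -mulNr.
Qed.
Lemma L2_fexp l : L2 leb (fexp l).
Proof. exact: bdd_supp_L2 (bdd_fexp l). Qed.

Lemma ip_fexp F M l : bdd_supp leb F M piI -> ip leb F (fexp l) = Complex knorm 0 * fhat F l.
Proof.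
move=> bF; rewrite /fhat -cIZ; last exact: bdd_supp_cintble (bdd_cexpiM _ bF).
apply: eq_cI => x; rewrite /fexp cJM cJ_real cexpiN conjCK.
case: (bF) => _ _ _ _ [_ z]; rewrite indicE.
case: (boolP (x \in piI)) => [_|]; first by rewrite mulr1; ring.
by rewrite notin_setE => /z ->; rewrite !mul0r mulr0.
Qed.

Lemma fhat_mask (D : set RT) (a : R -> R) l : measurable D ->
  fhat (fun x => Complex (\1_D x * a x) 0) l =
  Complex (\int[leb]_(x in D) (a x * cos (l%:~R * x)))
          (\int[leb]_(x in D) (a x * sin (l%:~R * x))).
Proof.
move=> mD; apply: c_ext; rewrite /= -[RHS]Rintegral_indicM.
  by apply: eq_Rintegral => x _; rewrite mul0r subr0 mulrA.
by apply: eq_Rintegral => x _; rewrite mul0r addr0 mulrA.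
Qed.

Lemma fhat_itv (a b : R) l : a < b -> l != 0 ->
  fhat (fun x => Complex (\1_(`]a, b]%classic : set RT) x) 0) l =
  Complex ((sin (l%:~R * b) - sin (l%:~R * a)) / l%:~R)
          ((cos (l%:~R * a) - cos (l%:~R * b)) / l%:~R).
Proof.
move=> ab l0; have l0' : l%:~R != 0 :> R by rewrite intr_eq0.
have -> : (fun x => Complex (\1_(`]a, b]%classic : set RT) x) 0) =
    (fun x : R => Complex (\1_(`]a, b]%classic : set RT) x * 1) 0 : C).
  by apply/funext => x; rewrite mulr1.
rewrite fhat_mask //; congr Complex.
  by under eq_Rintegral do rewrite mul1r; rewrite integral_cosM.
by under eq_Rintegral do rewrite mul1r; rewrite integral_sinM.
Qed.

Lemma fhat_itv0 (a b : R) : a < b ->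
  fhat (fun x => Complex (\1_(`]a, b]%classic : set RT) x) 0) 0 = Complex (b - a) 0.
Proof.
move=> ab.
have -> : (fun x => Complex (\1_(`]a, b]%classic : set RT) x) 0) =
    (fun x : R => Complex (\1_(`]a, b]%classic : set RT) x * 1) 0 : C).
  by apply/funext => x; rewrite mulr1.
rewrite fhat_mask //; congr Complex.
  under eq_Rintegral do rewrite mul0r cos0 mulr1.
  have := @integral_ramp R 0 1 a b ab.
  by under eq_Rintegral do rewrite mul0r addr0; move=> ->; ring.
under eq_Rintegral do rewrite mul0r sin0 mulr0.
by rewrite /Rintegral integral0.
Qed.

Lemma sin_intpi (l : int) : sin (l%:~R * pi) = 0 :> R.
Proof.
have H n : sin (n%:R * pi) = 0 :> R.
  elim: n => [|n IH]; first by rewrite mul0r sin0.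
  by rewrite -natr1 mulrDl mul1r sinD IH sinpi mulr0 mul0r addr0.
case: l => n; first exact: H.
by rewrite NegzE mulrNz mulNr sinN H oppr0.
Qed.

Lemma fhat_piI l :
  fhat (fun x => Complex (\1_piI x) 0) l = if l == 0 then Complex (2 * pi) 0 else 0.
Proof.
have pp : - pi < pi :> R by have := pi_gt0 R; lra.
case: eqP => [->|/eqP l0]; first by rewrite fhat_itv0 //; congr Complex; ring.
rewrite fhat_itv // mulrN sinN cosN subrr mul0r sin_intpi oppr0 subrr mul0r.
exact: c_ext.
Qed.

Lemma fexp_orthonormal i j : ip leb (fexp i) (fexp j) = (i == j)%:R.
Proof.
rewrite (ip_fexp j (bdd_fexp i)).
have -> : fhat (fexp i) j = Complex knorm 0 * fhat (fun x => Complex (\1_piI x) 0) (j - i).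
  rewrite /fhat -cIZ; last first.
    apply: (bdd_supp_cintble (M := 1) (B := piI)); apply: bdd_cexpiM.
    have := bdd_indic (measurable_itv _) leb_piI ler01.
    by under [X in bdd_supp _ X _ _ -> _]eq_fun do rewrite mul1r.
  apply: eq_cI => x; rewrite /fexp intrB mulrBl cexpiD -mulrA [in RHS]mulrA.
  congr (_ * _); last by rewrite mulrC.
  by apply: c_ext; rewrite ?cReM ?cImM /=; ring.
rewrite fhat_piI subr_eq0 eq_sym mulrA; case: (i == j); last by rewrite mulr0.
apply: c_ext; rewrite ?cReM ?cImM /=; last by ring.
by rewrite !mulr0 ?mul0r !subr0 -expr2 knorm2 mulVf // gt_eqF // twopi_gt0.
Qed.

Lemma fexp_bessel : bessel leb fexp.
Proof. exact: orthonormal_bessel L2_fexp fexp_orthonormal. Qed.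

Lemma fhat_bessel F M (s : seq int) : bdd_supp leb F M piI -> uniq s ->
  \sum_(l <- s) cabs2 (fhat F l) <= 2 * pi * Nm leb F.
Proof.
move=> bF us; have lF := bdd_supp_L2 bF.
have : \sum_(l <- s) cabs2 (ip leb F (fexp l)) <= Nm leb F.
  rewrite -lee_fin NmE //; apply: le_trans (fexp_bessel lF); exact: finsum_le_SQ.
under eq_bigr do rewrite (ip_fexp _ bF) cabs2M cabs2_real knorm2.
by rewrite -mulr_sumr mulrC ler_pdivrMr ?twopi_gt0 // mulrC.
Qed.

(** The Riemann-Lebesgue lemma, from Bessel: otherwise arbitrarily long lists of distinct indices
    would have coefficients of squared modulus at least [eps]. *)
Lemma fhat_small F M (eps : R) : bdd_supp leb F M piI -> 0 < eps ->
  exists n : nat, forall l : int, (n < `|l|)%N -> cabs2 (fhat F l) < eps.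
Proof.
move=> bF ep0; apply: contrapT => /forallNP H.
have Hs k : exists s : seq int,
    [/\ uniq s, size s = k & forall l, l \in s -> eps <= cabs2 (fhat F l)].
  elim: k => [|k [s [us sk hs]]]; first by exists [::].
  have /existsNP[l /not_implyP[ln /negP le]] := H (\max_(m <- s) `|m|%N).
  exists (l :: s); split; rewrite /= ?sk ?us ?andbT //.
    apply/negP => ls; move: ln; rewrite ltnNge => /negP; apply.
    by rewrite (big_rem l ls) /= leq_maxl.
  by move=> m; rewrite inE => /predU1P[->|/hs //]; rewrite leNgt.
(* By Bessel at most [K] coefficients can have squared modulus at least [eps]. *)
pose K := 2 * pi * Nm leb F / eps.
have [s [us sk hs]] := Hs (Num.bound K).
have := fhat_bessel bF us; apply/negP; rewrite -ltNge.
have K0 : 0 <= K by rewrite divr_ge0 // ?(ltW ep0) // mulr_ge0 ?Nm_ge0 // ltW // twopi_gt0.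
apply: (@lt_le_trans _ _ (\sum_(l <- s) eps)).
  rewrite big_const_seq count_predT sk iter_addr addr0 -[X in _ < X]mulr_natl -ltr_pdivrMr //.
  by have := archi_boundP K0.
by rewrite !big_seq; apply: ler_sum => l /hs.
Qed.

End FourierCoefficients.

(** * Completeness of the exponentials on a period *)

Section TruncatedAbsoluteValue.
Variable R : realType.
Local Notation C := (R[i]).
Local Notation leb := (@lebesgue_measure R).
Local Notation RT := (measurableTypeR R).
Local Notation piI := (@piI R).

Lemma cos_decr (x y : R) : 0 <= x -> x <= y -> y <= pi -> cos y <= cos x.
Proof.
move=> x0 xy yp; have [->//|ne] := eqVneq x y.
have xy' : x < y by rewrite lt_neqAle ne.
have xi : x \in `[0, pi] by rewrite in_itv /= x0 (le_trans xy).
have yi : y \in `[0, pi] by rewrite in_itv /= yp (le_trans x0).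
by apply: ltW; have := ltr_cos xi yi => /= ->.
Qed.

Lemma cos_abs (u : R) : cos `|u| = cos u.
Proof. by case: (ger0P u) => _ //; rewrite cosN. Qed.

(** [2 - 2 cos u] is the squared distance from 1 to [cexpi u]. For [|u| <= 1] it is at least
    [c^2 u^2], by the mean value theorem for the sine on [[0, |u| / 2]]; on the rest of the period
    it is at least [q]. The constant under the root adds those of the two cases. *)
Lemma chord_lower_bound : exists2 M : R, 0 <= M & forall u t : R,
  piI u -> 0 <= t <= pi -> (Num.min t `|u|) ^+ 2 <= M ^+ 2 * (2 - 2 * cos u).
Proof.
have p2 := pi_ge2 R; have c1 := @cos1_gt0 R; set c := cos 1 in c1.
have c1' : c < 1.
  rewrite lt_neqAle cos_le1 andbT; apply/eqP => h.
  have : sin (1 : R) = 0 by apply: cos1sin0; rewrite -/c h normr1.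
  by apply/eqP; rewrite gt_eqF // sin_gt0_pi //; apply/andP; split; lra.
pose q := 2 - 2 * c; have q0 : 0 < q by rewrite /q; lra.
exists (Num.sqrt (c ^- 2 + pi ^+ 2 / q)); first exact: sqrtr_ge0.
have M0 : 0 <= c ^- 2 + pi ^+ 2 / q.
  by rewrite addr_ge0 ?divr_ge0 ?invr_ge0 ?sqr_ge0 // ltW.
move=> u t; rewrite /piI /= in_itv /= => /andP[u1 u2] /andP[t0 t1].
rewrite sqr_sqrtr // -cos_abs; set v := `|u|.
have v0 : 0 <= v by exact: normr_ge0.
have vp : v <= pi by rewrite ler_norml (ltW u1).
have m0 : 0 <= Num.min t v by rewrite le_min t0.
have mv : Num.min t v <= v by rewrite ge_min lexx orbT.
have mt : Num.min t v <= pi by rewrite ge_min t1.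
have w0 : 0 <= 2 - 2 * cos v by have := cos_le1 v; lra.
have [v1|v1] := leP v 1.
  have key : c ^+ 2 * v ^+ 2 <= 2 - 2 * cos v.
    have [->|vn] := eqVneq v 0; first by rewrite cos0 expr0n mulr0; lra.
    have v20 : 0 < v / 2 by rewrite divr_gt0 // lt_neqAle eq_sym vn.
    have [x x_in] : exists2 x : R, x \in `]0, v / 2[ & sin (v / 2) - sin 0 = cos x * (v / 2 - 0).
      apply: MVT => //; apply: continuous_subspaceT => x; exact: continuous_sin.
    rewrite sin0 !subr0 => sE; move: x_in; rewrite in_itv /= => /andP[x0 x1].
    have cx : c <= cos x by apply: cos_decr; lra.
    have -> : 2 - 2 * cos v = 4 * sin (v / 2) ^+ 2.
      have {1}-> : v = (v / 2) *+ 2 by rewrite -mulr_natr divfK.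
      by rewrite cos_mulr2n sin2cos2 mulr2n; ring.
    rewrite sE exprMn; have : c ^+ 2 <= cos x ^+ 2 by rewrite ler_pXn2r ?nnegrE //; lra.
    by have := sqr_ge0 v => ? ?; nra.
  apply: (@le_trans _ _ (v ^+ 2)); first by rewrite ler_pXn2r ?nnegrE.
  apply: (@le_trans _ _ (c ^- 2 * (2 - 2 * cos v))).
    by rewrite mulrC ler_pdivlMr ?exprn_gt0 // mulrC.
  by rewrite ler_wpM2r // lerDl divr_ge0 ?sqr_ge0 // ltW.
have cv : cos v <= c by apply: cos_decr => //; lra.
apply: (@le_trans _ _ (pi ^+ 2)); first by rewrite ler_pXn2r ?nnegrE // pi_ge0.
apply: (@le_trans _ _ (pi ^+ 2 / q * (2 - 2 * cos v))).
  by rewrite -mulrA ler_peMr ?sqr_ge0 // mulrC ler_pdivlMr // mul1r /q; lra.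
by rewrite ler_wpM2r // lerDr invr_ge0 sqr_ge0.
Qed.

Lemma fhatD F G (M N : R) l : bdd_supp leb F M piI -> bdd_supp leb G N piI ->
  fhat (fun x => F x + G x) l = fhat F l + fhat G l.
Proof.
move=> bF bG; rewrite /fhat -cID.
- by apply: eq_cI => x; rewrite mulrDl.
- exact: bdd_supp_cintble (bdd_cexpiM _ bF).
- exact: bdd_supp_cintble (bdd_cexpiM _ bG).
Qed.
Lemma fhatZ F (M : R) (c : C) l : bdd_supp leb F M piI ->
  fhat (fun x => c * F x) l = c * fhat F l.
Proof.
move=> bF; rewrite /fhat -cIZ; first by apply: eq_cI => x; rewrite mulrA.
exact: bdd_supp_cintble (bdd_cexpiM _ bF).
Qed.
Lemma fhat_shift F (M : R) l : bdd_supp leb F M piI ->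
  fhat (fun x => cexpi x * F x) l = fhat F (l + 1).
Proof.
move=> bF; apply: eq_cI => x; rewrite intrD mulrDl mul1r cexpiD; ring.
Qed.

(* Dividing by [1 - cexpi u] makes the partial sums of the Fourier coefficients
   of a function vanishing linearly at 0 telescope. *)
Lemma truncated_abs_factor (t : R) : 0 <= t <= pi ->
  exists H (M : R), bdd_supp leb H M piI /\
   forall u, Complex (- (\1_piI u * Num.min t `|u|)) 0 = H u - cexpi u * H u.
Proof.
move=> tp; have [M M0 hM] := chord_lower_bound.
pose w (u : R) := 2 - 2 * cos u.
have w0 u : 0 <= w u by have := cos_le1 u; rewrite /w; lra.
(* The quotient by [1 - cexpi u], written as its conjugate over its squared modulus [w u]. Where
   [w u = 0] the inverse is 0 by convention, and [hM] shows that the numerator vanishes too. *)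
pose H (u : RT) : C := Complex (- (\1_piI u * Num.min t `|u|) * (w u)^-1) 0 * (1 - cexpi u)^*.
have cw u : cabs2 (1 - cexpi u) = w u.
  rewrite /cabs2 /= /w (_ : _ + _ = 1 - 2 * cos u + (cos u ^+ 2 + sin u ^+ 2)).
    by rewrite cos2Dsin2; ring.
  by ring.
exists H, M; split; last first.
  move=> u.
  have -> : H u - cexpi u * H u = (1 - cexpi u) * H u by rewrite mulrBl mul1r.
  rewrite /H mulrCA mulcJ cw.
  have [z|nz] := eqVneq (w u) 0; last first.
    by apply: c_ext; rewrite ?cReM ?cImM /=; [field|ring].
  have -> : \1_piI u * Num.min t `|u| = 0.
    rewrite indicE; case: (boolP (u \in piI)); last by rewrite mul0r.
    rewrite inE => uI; have := hM u t uI tp; rewrite -/(w u) z mulr0 mul1r => h.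
    by apply/eqP; rewrite -sqrf_eq0 eq_le h sqr_ge0.
  by rewrite z; apply: c_ext; rewrite ?cReM ?cImM /= ?oppr0; ring.
split=> //.
- apply: cmeasM.
    split=> /=; last exact: measurable_cst.
    apply: measurable_funM.
      apply: measurable_funN; apply: measurable_funM; first by apply: measurable_indic; exact: measurable_itv.
      by apply: measurable_minr => //; exact: measurableT_comp.
    (* The measurability of the inverse, including its value at 0, is that of a real power. *)
    rewrite (_ : (fun x => _) = (fun x => powR (w x) (-1))).
      apply: (@measurableT_comp _ _ _ _ _ _ (@powR R ^~ (-1))); first exact: measurable_powR.
      apply: measurable_funB => //; apply: measurable_funM => //.
      by apply: continuous_measurable_fun; exact: continuous_cos.
    by apply/funext => x; rewrite powR_inv1.
  apply: cmeasJ; apply: cmeasB; first exact: cmeas_cst.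
  by have := cmeas_cexpiM (1 : R); under eq_fun do rewrite mul1r.
- exact: measurable_itv.
- exact: leb_piI.
split=> u; last by move=> nI; rewrite /H indicE memNset // mul0r oppr0 mul0r; apply: c_ext; rewrite ?cReM ?cImM /=; ring.
rewrite /H cabs2M cabs2J cw cabs2_real indicE.
case: (boolP (u \in piI)); last by rewrite mul0r oppr0 mul0r expr0n mul0r sqr_ge0.
rewrite inE mul1r => uI; have := hM u t uI tp; rewrite -/(w u) => h.
have [z|nz] := eqVneq (w u) 0; first by rewrite z mulr0 sqr_ge0.
have wp : 0 < w u by rewrite lt_neqAle eq_sym nz w0.
rewrite exprMn sqrrN exprVn expr2 invfM mulrA mulrAC mulfVK //.
by rewrite -expr2 ler_pdivrMr.
Qed.
End TruncatedAbsoluteValue.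

Section IndicatorParseval.
Variable R : realType.
Local Notation C := (R[i]).
Local Notation leb := (@lebesgue_measure R).
Local Notation RT := (measurableTypeR R).
Local Notation piI := (@piI R).
Local Notation ind := (fun (D : set RT) => (fun x : RT => Complex (\1_D x) 0 : C)).
Local Notation tight := (tight leb (@fexp R)).

Lemma bdd_suppD (f g : RT -> C) (M N : R) B : bdd_supp leb f M B -> bdd_supp leb g N B ->
  bdd_supp leb (fun x => f x + g x) (2 * M + 2 * N) B.
Proof.
move=> [mf M0 mB fB [hM hB]] [mg N0 _ _ [hN hB']]; split=> //; first exact: cmeasD.
  by rewrite addr_ge0 // mulr_ge0.
split=> x; last by move=> nB; rewrite hB // hB' // addr0.
apply: le_trans (cabs2D_le _ _) _; have := hM x; have := hN x.
by have := mulr_ge0 M0 N0; have := sqr_ge0 M; have := sqr_ge0 N; nra.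
Qed.

Lemma bdd_ind (D : set RT) : measurable D -> D `<=` piI -> bdd_supp leb (ind D) 1 piI.
Proof.
move=> mD DI; split=> //; first by split => /=; [exact: measurable_indic|exact: measurable_cst].
- exact: measurable_itv.
- exact: leb_piI.
split=> x; rewrite indicE.
  by rewrite cabs2_real; case: (x \in D); rewrite ?expr0n ?expr1n //= ler01.
by move=> nI; rewrite memNset // => /DI.
Qed.

Lemma n2_ind (D : set RT) : measurable D -> n2 leb (ind D) = leb D.
Proof.
move=> mD; transitivity (\int[leb]_x (\1_D x)%:E)%E; last by rewrite integral_indic // setIT.
apply: eq_integral => x _.
by rewrite cabs2_real indicE; case: (x \in D); rewrite ?expr0n ?expr1n.
Qed.

(** The squared modulus of a coefficient of an indicator is the coefficient of its autocorrelation,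
    the tent [max (t - |u|) 0] with [t = b - a]. Since [t <= pi], the tent fits in the period and
    equals [t - min t |u|] there; the constant [t] contributes at [l = 0] only, and [hH] turns the
    rest into a difference of consecutive coefficients. *)
Lemma cabs2_fhat_itv (a b : R) (H : RT -> C) (M : R) l :
  - pi <= a -> a < b -> b <= pi -> b - a <= pi -> bdd_supp leb H M piI ->
  (forall u, Complex (- (\1_piI u * Num.min (b - a) `|u|)) 0 = H u - cexpi u * H u) ->
  cabs2 (fhat (ind `]a, b]%classic) l) =
  complex.Re (fhat H l - fhat H (l + 1)) + (if l == 0 then (b - a) * (2 * pi) else 0).
Proof.
move=> a1 ab b1 tp bH hH; set t := b - a.
have t0 : 0 < t by rewrite /t subr_gt0.
have bH' : bdd_supp leb (fun x : RT => cexpi x * H x) M piI.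
  have := bdd_cexpiM 1 bH.
  by under [X in bdd_supp _ X _ _ -> _]eq_fun do rewrite mul1r mulrC.
have bHN : bdd_supp leb (fun x : RT => -1 * (cexpi x * H x)) (1 * M) piI.
  apply: (@bdd_suppM _ _ _ leb _ (fun=> -1) M piI 1 bH') => //; do ?exact: cmeas_cst.
  by move=> _; rewrite cabs2N cabs21 expr1n.
have mk (D : set RT) (s : R) : measurable D -> D `<=` piI ->
    bdd_supp leb (fun x : RT => Complex (\1_D x * (t + s * x)) 0) (t + `|s| * pi) piI.
  move=> mD DI; have M0 : 0 <= t + `|s| * pi.
    by rewrite addr_ge0 ?(ltW t0) // mulr_ge0 // pi_ge0.
  split=> //.
  - split=> /=; last exact: measurable_cst.
    apply: measurable_funM; first exact: measurable_indic.
    apply: measurable_funD => //; exact: measurable_funM.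
  - exact: measurable_itv.
  - exact: leb_piI.
  split=> x; rewrite indicE.
    rewrite cabs2_real; case: (boolP (x \in D)) => [|_]; last by rewrite mul0r expr0n sqr_ge0.
    rewrite inE mul1r => /DI; rewrite /piI /= in_itv /= => /andP[x1 x2].
    rewrite -[X in X <= _](real_normK (num_real _)) ler_pXn2r ?nnegrE //.
    apply: le_trans (ler_normD _ _) _; rewrite (gtr0_norm t0) lerD2l normrM ler_wpM2l //.
    by rewrite ler_norml (ltW x1).
  by move=> nI; rewrite memNset ?mul0r // => /DI.
pose D1 : set RT := `]- t, 0]%classic; pose D2 : set RT := `]0, t]%classic.
have p0 := pi_gt0 R; have tp' : t <= pi by [].
have D1I : D1 `<=` piI.
  move=> x; rewrite /D1 /piI /= !in_itv /= => /andP[x1 x2]; apply/andP; split; lra.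
have D2I : D2 `<=` piI.
  move=> x; rewrite /D2 /piI /= !in_itv /= => /andP[x1 x2]; apply/andP; split; lra.
(* The tent is cut into its two linear ramps, on [D1] and on [D2], whose coefficients are explicit
   integrals. *)
have E : fhat H l - fhat H (l + 1) =
  fhat (fun x : RT => Complex (\1_D1 x * (t + 1 * x)) 0) l +
  fhat (fun x : RT => Complex (\1_D2 x * (t + -1 * x)) 0) l +
  Complex (- t) 0 * fhat (ind piI) l.
  have bi : bdd_supp leb (ind piI) 1 piI by apply: bdd_ind => //; exact: measurable_itv.
  have bit : bdd_supp leb (fun x => Complex (- t) 0 * ind piI x) (t * 1) piI.
    apply: (@bdd_suppM _ _ _ leb _ (fun=> Complex (- t) 0) 1 piI t bi);
      [exact: cmeas_cst|exact: ltW|].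
    by move=> _; rewrite cabs2_real sqrrN.
  have E1 : - fhat (fun x : RT => cexpi x * H x) l = fhat (fun x : RT => -1 * (cexpi x * H x)) l.
    by rewrite (fhatZ _ _ bH') mulN1r.
  rewrite -(fhat_shift _ bH) E1 -(fhatD _ bH bHN).
  rewrite -(fhatZ _ _ bi) -(fhatD _ (mk D1 1 (measurable_itv _) D1I)
    (mk D2 (-1) (measurable_itv _) D2I)).
  rewrite -(fhatD _ (bdd_suppD (mk D1 1 (measurable_itv _) D1I)
    (mk D2 (-1) (measurable_itv _) D2I)) bit).
  congr (fhat _ _); apply/funext => u.
  rewrite mulN1r -hH; apply: c_ext; rewrite ?cReD ?cImD ?cReZ ?cImZ /=; last by ring.
  rewrite !indicE !mul1r !mulN1r /D1 /D2.
  case: (boolP (u \in piI)) => uI; last first.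
    rewrite !memNset ?mul0r ?mulr0 ?oppr0 ?addr0 //.
      by move=> /D2I; move/negP: uI; rewrite inE.
    by move=> /D1I; move/negP: uI; rewrite inE.
  move: uI; rewrite inE /piI /= in_itv /= => /andP[u1 u2].
  rewrite mul1r mulr1 -/t minEle.
  rewrite !mem_setE !in_itv /=.
  have [u0|u0] := leP u 0.
    rewrite (ler0_norm u0) andbT mul0r addr0.
    case: (leP t (- u)) => h.
      have -> : (- t < u) = false by apply/negbTE; rewrite -leNgt; lra.
      by rewrite mul0r add0r.
    have -> : - t < u by lra.
    by rewrite mul1r; ring.
  rewrite (gtr0_norm u0) andbF mul0r add0r /=.
  case: (leP t u) => h; last by rewrite (ltW h) mul1r; ring.
  have [->|ut] := eqVneq u t; first by rewrite lexx mul1r; ring.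
  have -> : (u <= t) = false by apply/negbTE; rewrite -ltNge lt_neqAle eq_sym ut h.
  by rewrite mul0r add0r.
rewrite E !cReD cReZ fhat_piI fhat_mask; last exact: measurable_itv.
rewrite fhat_mask; last exact: measurable_itv.
have t0' : - t < 0 by lra.
have [->|l0] := eqVneq l 0.
  rewrite fhat_itv0 // cabs2_real -/t /=.
  under eq_Rintegral do rewrite mul0r cos0 mulr1.
  under [X in _ + X + _ + _]eq_Rintegral do rewrite mul0r cos0 mulr1.
  by rewrite !integral_ramp //; field.
have l0' : l%:~R != 0 :> R by rewrite intr_eq0.
rewrite fhat_itv // !integral_rampM // /cabs2 /=.
rewrite (_ : l%:~R * - t = - (l%:~R * t)) ?mulrN // cosN sinN !mulr0 cos0 sin0.
have -> : cos (l%:~R * t) = cos (l%:~R * b) * cos (l%:~R * a) + sin (l%:~R * b) * sin (l%:~R * a).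
  by rewrite /t mulrBr cosB.
have := cos2Dsin2 (l%:~R * a); have := cos2Dsin2 (l%:~R * b).
move: (cos _) (sin _) (cos _) (sin _) => cb sb ca sa hb ha.
rewrite (_ : ((sa - sb) / l%:~R) ^+ 2 + ((cb - ca) / l%:~R) ^+ 2 =
  ((cb ^+ 2 + sb ^+ 2) + (ca ^+ 2 + sa ^+ 2) - 2 * (cb * ca + sb * sa)) / l%:~R ^+ 2); last by field.
by rewrite hb ha; field.
Qed.

(** Summed over a symmetric range, [cabs2_fhat_itv] telescopes to two coefficients of [H], which
    tend to 0, plus [2 pi (b - a)]. After normalization this is the full squared norm. *)
Lemma itv_short_tight (a b : R) : - pi <= a -> a < b -> b <= pi -> b - a <= pi ->
  tight (ind `]a, b]%classic).
Proof.
move=> a1 ab b1 tp; set t := b - a; have p0 := pi_gt0 R.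
have t0 : 0 < t by rewrite /t subr_gt0.
have JI : (`]a, b]%classic : set RT) `<=` piI.
  move=> x; rewrite /piI /= !in_itv /= => /andP[x1 x2]; apply/andP; split; lra.
have bJ : bdd_supp leb (ind `]a, b]%classic) 1 piI by exact: bdd_ind.
have lJ := bdd_supp_L2 bJ.
apply: (tightP (fexp_bessel (R := R))) => //.
apply/eqP; rewrite eq_le (sq_le_Nm (fexp_bessel (R := R))) //=.
have NJ : Nm leb (ind `]a, b]%classic) = t.
  by rewrite /Nm n2_ind // leb_oc ?(ltW ab).
rewrite NJ; apply/ler_addgt0Pr => ep ep0.
have [H [M [bH hH]]] : exists H (M : R), bdd_supp leb H M piI /\
   forall u, Complex (- (\1_piI u * Num.min t `|u|)) 0 = H u - cexpi u * H u.
  by apply: truncated_abs_factor; rewrite (ltW t0).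
have ep20 : 0 < ep ^+ 2 by rewrite exprn_gt0.
have [n0 hn0] := fhat_small bH ep20.
(* The indices run from [-n] to [n]; with [n > n0], the boundary coefficients at [-n] and at [n + 1]
   are both small. *)
pose n := n0.+1; pose s := [seq (k%:Z - n%:Z) | k <- iota 0 (n.*2.+1)].
have us : uniq s by rewrite map_inj_uniq ?iota_uniq // => i j /addIr [].
have key : \sum_(l <- s) cabs2 (fhat (ind `]a, b]%classic) l) =
    complex.Re (fhat H (- n%:Z)) - complex.Re (fhat H (n%:Z + 1)) + t * (2 * pi).
  transitivity (\sum_(l <- s) complex.Re (fhat H l - fhat H (l + 1)) +
     \sum_(l <- s) (if l == 0 then t * (2 * pi) else 0)).
    by rewrite -big_split; apply: eq_bigr => l _; rewrite (cabs2_fhat_itv l a1 ab b1 tp bH hH).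
  congr (_ + _).
    rewrite big_map (_ : iota 0 n.*2.+1 = index_iota 0 n.*2.+1); last by rewrite /index_iota subn0.
    pose q k : R := - complex.Re (fhat H (k%:Z - n%:Z)).
    under eq_bigr => k _.
      rewrite cReD cReN (_ : k%:Z - n%:Z + 1 = k.+1%:Z - n%:Z); last by rewrite -addn1 PoszD addrAC.
      rewrite (_ : _ - _ = q k.+1 - q k); last by rewrite /q opprK addrC.
      over.
    rewrite telescope_sumr // /q opprK sub0r addrC.
    congr (_ - complex.Re (fhat H _)).
    by rewrite -addn1 -addnn !PoszD; ring.
  have s0 : 0 \in s.
    apply/mapP; exists n; last by rewrite subrr.
    by rewrite mem_iota /= add0n ltnS -addnn leq_addr.
  by rewrite (bigD1_seq 0) //= big1 ?addr0 // => l /negPf ->.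
have Hs m : (n0 < `|m|)%N -> `|complex.Re (fhat H m)| <= ep.
  by move=> /hn0 h; apply: normRe_le; apply: ltW.
have h1 : `|complex.Re (fhat H (- n%:Z))| <= ep by apply: Hs; rewrite abszN.
have h2 : `|complex.Re (fhat H (n%:Z + 1))| <= ep.
  by apply: Hs; rewrite -PoszD /= addn1 ltnS leqnSn.
have : (\sum_(l <- s) cabs2 (ip leb (ind `]a, b]%classic) (fexp l))) <= sq leb (@fexp R) (ind `]a, b]%classic).
  rewrite -lee_fin (sqE (fexp_bessel (R := R))) //; exact: finsum_le_SQ.
under eq_bigr do rewrite (ip_fexp _ bJ) cabs2M cabs2_real knorm2.
rewrite -mulr_sumr key mulrC ler_pdivrMr ?twopi_gt0 //.
move: h1 h2; rewrite !ler_norml => /andP[h1 _] /andP[_ h2]; set z := sq _ _ _ => h.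
have p2 := pi_ge2 R.
have : t * (2 * pi) <= (z + ep) * (2 * pi) by nra.
by rewrite ler_pM2r ?twopi_gt0.
Qed.

Lemma indU (D E : set RT) : D `&` E = set0 -> forall x, ind (D `|` E) x = ind D x + ind E x.
Proof.
move=> DE x; apply: c_ext; rewrite ?cReD ?cImD /= ?addr0 // !indicE in_setU.
case: (boolP (x \in D)) => [xD|_]; last by rewrite add0r.
rewrite (_ : (x \in E) = false) ?addr0 //; apply/negP => xE.
by have : (D `&` E) x by [split; rewrite -in_setE]; rewrite DE.
Qed.

(** An interval longer than [pi] inside the period contains 0, and cutting it there leaves two
    pieces of length at most [pi]. *)
Lemma itv_tight (a b : R) : - pi <= a -> b <= pi -> tight (ind `]a, b]%classic).
Proof.
move=> a1 b1; have p0 := pi_gt0 R; have [ba|ab] := leP b a.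
  rewrite (_ : `]a, b]%classic = set0) ?set_itvoc0 //; last first.
    by rewrite set_itv_ge // bnd_simp -leNgt.
  rewrite (_ : (fun x => _) = (fun=> 0)); first exact: tight0.
  by apply/funext => x; rewrite indicE in_set0.
have [h|h] := leP (b - a) pi; first exact: itv_short_tight.
have a0 : a < 0 by lra.
have b0 : 0 < b by lra.
rewrite (_ : (fun x => _) = (fun x => ind `]a, 0]%classic x + ind `]0, b]%classic x)).
  by have [] := tightD (@L2_fexp R) (fexp_bessel (R := R))
     (itv_short_tight a1 a0 (ltW p0) ltac:(lra)) (itv_short_tight (a := 0) ltac:(lra) b0 b1 ltac:(lra)).
apply/funext => x; rewrite -(@indU `]a, 0]%classic `]0, b]%classic).
  congr (Complex (\1_ _ x) 0); rewrite (@itv_bndbnd_setU _ _ _ (BRight 0)) // bnd_simp; lra.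
apply/seteqP; split=> // y [] /=; rewrite !in_itv /= => /andP[_ h1] /andP[h2 _]; lra.
Qed.

(** The sets with this property form a lambda-system: differences by linearity, increasing unions
    because tight vectors are closed. It contains the half-open intervals, which are stable under
    intersection and generate the Borel sets. *)
Lemma set_tight (A : set RT) : measurable A -> tight (ind (A `&` piI)).
Proof.
pose H := [set A : set RT | measurable A /\ tight (ind (A `&` piI))].
have p0 := pi_gt0 R.
have be := fexp_bessel (R := R); have le := @L2_fexp R.
have mI : measurable piI by exact: measurable_itv.
suff : lambda_system setT H.
  move=> lH mA; have : H A; last by case.
  apply: (lambda_system_subset (@ocitvI R) lH) => //.
  move=> _ [[a b] _ <-] /=; split; first exact: measurable_itv.
  rewrite (_ : _ `&` _ = `]Num.max a (- pi), Num.min b pi]%classic); last first.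
    apply/seteqP; split=> x; rewrite /piI /= !in_itv /= gt_max le_min.
      by move=> [/andP[-> ->] /andP[-> ->]].
    by move=> /andP[/andP[-> ->] /andP[-> ->]].
  by apply: itv_tight; rewrite ?le_max ?ge_min lexx orbT.
clear A; split=> //.
- split; first exact: measurableT.
  by rewrite setTI; apply: itv_tight.
- move=> A B BA [mA tA] [mB tB]; split; first exact: measurableD.
  rewrite (_ : (fun x => _) = (fun x => ind (A `&` piI) x - ind (B `&` piI) x)).
    by have [] := tightD le be tA tB.
  apply/funext => x; rewrite (_ : A `&` piI = ((A `\` B) `&` piI) `|` (B `&` piI)).
    rewrite indU ?addrK //; apply/seteqP; split=> // y [] [[_ nB] _] [yB _]; exact: nB.
  apply/seteqP; split=> y.
    by move=> [yA yI]; have [yB|yB] := pselect (B y); [right|left].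
  by move=> [[[? _] ?]|[/BA ? ?]].
- move=> F ndF HF; have mF i : measurable (F i) by case: (HF i).
  set A := \bigcup_i F i; have mA : measurable A by exact: bigcupT_measurable.
  split=> //.
  have mAI : measurable (A `&` piI) by exact: measurableI.
  have lA : L2 leb (ind (A `&` piI)).
    by apply: (bdd_supp_L2 (bdd_ind mAI _)); exact: subIsetr.
  apply: (tight_closed le be lA) => eps ep0.
  pose G i := F i `&` piI.
  have mG i : measurable (G i) by exact: measurableI.
  have GE : \bigcup_i G i = A `&` piI by rewrite /G -setI_bigcupl.
  have ndG : {homo G : n m / (n <= m)%N >-> (n <= m)%O}.
    by move=> i j ij; apply/subsetPset; apply: setSI; apply/subsetPset; exact: ndF.
  have cv := nondecreasing_cvg_mu (mu := leb) mG (bigcupT_measurable _ mG) ndG.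
  have fA : (leb (A `&` piI) < +oo)%E.
    by apply: le_lt_trans (leb_piI R); apply: le_measure; rewrite ?inE //; exact: subIsetr.
  have fAn : leb (A `&` piI) \is a fin_num by rewrite ge0_fin_numE.
  have [i hi] : exists i, (leb (A `&` piI) - eps%:E < leb (G i))%E.
    have lt : fine (leb (A `&` piI)) - eps < fine (leb (A `&` piI)) by rewrite ltrBlDr ltrDl.
    have cv' : (fine \o (leb \o G)) n @[n --> \oo] --> fine (leb (A `&` piI)).
      by apply: fine_cvg; rewrite fineK // -GE.
    have [N _ hN] := cvgr_gt _ cv' _ lt.
    exists N; have /= := hN N (leqnn N); rewrite -lte_fin EFinB !fineK //.
    rewrite ge0_fin_numE //; apply: le_lt_trans fA; apply: le_measure; rewrite ?inE //.
    by rewrite -GE; exact: bigcup_sup.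
  exists (ind (G i)); split; first by case: (HF i).
  have GA : G i `<=` A `&` piI by rewrite -GE; exact: bigcup_sup.
  rewrite -lte_fin NmE; last first.
    apply: L2B => //; apply: (bdd_supp_L2 (bdd_ind (mG i) _)); exact: subIsetr.
  rewrite (@eq_n2 _ _ _ leb _ (ind ((A `&` piI) `\` G i))); last first.
    move=> x; have e : ind (A `&` piI) x = ind (G i) x + ind ((A `&` piI) `\` G i) x.
      by rewrite -indU ?setDUK ?setDIK.
    by rewrite e addrC addKr.
  rewrite n2_ind ?measurableD // ; last exact: measurableD.
  rewrite measureD // (setIidr GA).
  have fG : leb (G i) \is a fin_num.
    by rewrite ge0_fin_numE //; apply: le_lt_trans fA; apply: le_measure; rewrite ?inE.
  by rewrite lteBlDr // addeC -lteBlDr.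
Qed.

End IndicatorParseval.

Section BoundedParseval.
Variable R : realType.
Local Notation C := (R[i]).
Local Notation leb := (@lebesgue_measure R).
Local Notation RT := (measurableTypeR R).
Local Notation piI := (@piI R).
Local Notation tight := (tight leb (@fexp R)).

(** Rounding [u] down to multiples of [1 / n] gives a finite combination of indicators of level
    sets, with squared error at most [2 pi / n^2]. *)
Lemma real_bounded_tight (u : RT -> R) (M : R) : measurable_fun setT u ->
  (forall x, `|u x| <= M) -> (forall x, ~ piI x -> u x = 0) ->
  tight (fun x => Complex (u x) 0).
Proof.
move=> mu uM uI; have p0 := twopi_gt0 R.
have be := fexp_bessel (R := R); have le := @L2_fexp R.
have M0 : 0 <= M by apply: le_trans (normr_ge0 _) (uM 0).
have mI : measurable piI by exact: measurable_itv.
have cmu : cmeas (fun x : RT => Complex (u x) 0) by split => //=; exact: measurable_cst.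
have bu : bdd_supp leb (fun x : RT => Complex (u x) 0) M piI.
  split=> //; first exact: leb_piI.
  split=> x; last by move=> /uI ->.
  rewrite cabs2_real -[X in X <= _](real_normK (num_real _)) ler_pXn2r ?nnegrE //.
apply: (tight_closed le be (bdd_supp_L2 bu)) => eps ep0.
pose n := (Num.bound (2 * pi / eps : R)).+1.
have n0 : 0 < n%:R :> R by rewrite ltr0n.
have hn : 2 * pi < eps * n%:R ^+ 2.
  have h : 2 * pi / eps < n%:R.
    apply: (lt_le_trans (archi_boundP _)); first by rewrite divr_ge0 ?ltW.
    by rewrite ler_nat leqnSn.
  rewrite -ltr_pdivrMl // mulrC; apply: lt_le_trans h _.
  by rewrite expr2 ler_peMr ?(ltW n0) // ler1n.
(* The values of [floor (n u)] lie between [-m] and [m - 1], so [2 m] level sets are enough. *)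
pose m := (Num.bound (n%:R * M)).+1.
have hm x : - m%:R < n%:R * u x < m%:R.
  have h : n%:R * M < m%:R.
    apply: (lt_le_trans (archi_boundP _)); first by rewrite mulr_ge0 // ler0n.
    by rewrite ler_nat leqnSn.
  rewrite -ltr_norml; apply: le_lt_trans h.
  by rewrite normrM (gtr0_norm n0) ler_wpM2l // ltW.
pose A (k : nat) : set RT := [set x | Num.floor (n%:R * u x) = k%:Z - m%:Z].
have mA k : measurable (A k).
  have mnu : measurable_fun setT (fun x : RT => n%:R * u x) by exact: measurable_funM.
  rewrite (_ : A k = (fun x : RT => n%:R * u x) @^-1`
    `[(k%:Z - m%:Z)%:~R, (k%:Z - m%:Z + 1)%:~R[%classic).
    by rewrite -[X in measurable X]setTI; apply: mnu.
  apply/seteqP; split=> x; rewrite /A /= in_itv /= -floor_eq; first by move=> /eqP.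
  by move=> /eqP.
pose c (k : nat) : C := Complex ((k%:Z - m%:Z)%:~R / n%:R) 0.
pose f' (x : RT) : C := \sum_(k <- iota 0 (m.*2)) c k * Complex (\1_(A k `&` piI) x) 0.
have tf' : tight f'.
  apply: (tight_sum le be) => k; apply: (tightZ le); exact: set_tight.
exists f'; split=> //.
have fE x : piI x -> f' x = Complex ((Num.floor (n%:R * u x))%:~R / n%:R) 0.
  move=> xI; set fl := Num.floor _.
  have /andP[f1 f2] := floor_itv (n%:R * u x); have /andP[h1 h2] := hm x.
  rewrite -/fl in f1 f2.
  have flm : - m%:Z <= fl.
    by rewrite -ltzD1 -(ltr_int R) mulrNz -pmulrn; apply: lt_trans h1 f2.
  have flM : fl < m%:Z.
    by rewrite -(ltr_int R) -pmulrn; apply: le_lt_trans f1 h2.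
  have [k kE] : exists k : nat, fl + m%:Z = k%:Z.
    by exists (absz (fl + m%:Z)); rewrite gez0_abs // -lerBlDr sub0r.
  have kin : k \in iota 0 m.*2.
    by rewrite mem_iota /= add0n -ltz_nat -kE -addnn PoszD ltrD2r.
  rewrite /f' (bigD1_seq k) ?iota_uniq //= big1 ?addr0.
    rewrite /c -kE addrK indicE mem_set //=.
      by apply: c_ext; rewrite ?cReM ?cImM /=; ring.
    by split=> //; rewrite /A /= -/fl -kE addrK.
  move=> j jk; rewrite indicE memNset ?mulr0 //.
  move=> [+ _]; rewrite /A /= -/fl => fj.
  by move/eqP: jk; apply; apply/eqP; rewrite -eqz_nat -kE fj subrK.
have fE0 x : ~ piI x -> f' x = 0.
  move=> xI; rewrite /f' big1 // => k _; rewrite indicE memNset ?mulr0.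
    by apply: c_ext; rewrite ?cReM ?cImM /=; ring.
  by move=> [].
have lf' : L2 leb f' by case: tf'.
rewrite -lte_fin NmE; last by apply: L2B => //; exact: bdd_supp_L2 bu.
apply: (@le_lt_trans _ _ (\int[leb]_x ((n%:R ^- 2) * \1_piI x)%:E)%E).
  apply: ge0_le_integral => //.
  - by move=> x _; rewrite lee_fin cabs2_ge0.
  - by apply: cmeas_ecabs2; apply: cmeasB => //; case: lf'.
  - by apply/measurable_EFinP; apply: measurable_funM => //; exact: measurable_indic.
  move=> x _; rewrite lee_fin indicE; have [xI|xI] := pselect (piI x); last first.
    by rewrite fE0 // uI // memNset // mulr0 subrr cabs20.
  rewrite fE // mem_set // mulr1.
  have /andP[f1 f2] := floor_itv (n%:R * u x); set fl := Num.floor _ in f1 f2 *.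
  rewrite (_ : Complex (u x) 0 - _ = Complex (u x - fl%:~R / n%:R) 0); last first.
    by apply: c_ext; rewrite ?cReD ?cImD ?cReN ?cImN /= ?subr0.
  rewrite cabs2_real -exprVn.
  have h1 : 0 <= u x - fl%:~R / n%:R by rewrite subr_ge0 ler_pdivrMr // mulrC.
  have h2 : u x - fl%:~R / n%:R <= n%:R^-1.
    rewrite lerBlDr -[X in X + _]mul1r -mulrDl ler_pdivlMr // mulrC ltW //.
    by rewrite addrC; move: f2; rewrite intrD.
  by rewrite ler_pXn2r ?nnegrE // invr_ge0 ltW.
under eq_integral do rewrite EFinM.
rewrite ge0_integralZl // ?lee_fin ?invr_ge0 ?sqr_ge0 //; last first.
  by apply/measurable_EFinP; exact: measurable_indic.
have -> : (\int[leb]_x (\1_piI x)%:E = (2 * pi)%:E)%E.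
  rewrite integral_indic // setIT; apply: etrans (leb_oc _) _.
    by have := pi_ge0 R; lra.
  by congr EFin; ring.
by rewrite -EFinM lte_fin mulrC ltr_pdivrMr ?exprn_gt0.
Qed.

Theorem fourier_parseval1 (F : RT -> C) (M : R) : bdd_supp leb F M piI ->
  (\esum_(l in [set: int]) (cabs2 (fhat F l))%:E = (2 * pi)%:E * n2 leb F)%E.
Proof.
move=> bF; have p0 := twopi_gt0 R.
have [mF M0 mI fI [hM hI]] := bF.
have tF : tight F.
  have t1 : tight (fun x => Complex (complex.Re (F x)) 0).
    apply: (@real_bounded_tight _ M); first by case: mF.
      by move=> x; exact: normRe_le.
    by move=> x /hI ->.
  have t2 : tight (fun x => Complex (complex.Im (F x)) 0).
    apply: (@real_bounded_tight _ M); first by case: mF.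
      by move=> x; exact: normIm_le.
    by move=> x /hI ->.
  have [+ _] := tightD (@L2_fexp R) (fexp_bessel (R := R)) t1
    (tightZ (@L2_fexp R) (Complex 0 1) t2).
  rewrite (_ : (fun x => _) = F) //; apply/funext => x.
  by apply: c_ext; rewrite ?cReD ?cImD ?cReM ?cImM /=; ring.
case: tF => lF <-; rewrite /SQ -esumZl ?(ltW p0) // => [|i]; last by rewrite lee_fin cabs2_ge0.
apply: eq_esum => l _; rewrite (ip_fexp l bF) cabs2M cabs2_real knorm2 -EFinM.
by rewrite mulrA mulfV ?mul1r // gt_eqF.
Qed.

End BoundedParseval.

(** * The Plancherel theorem *)

Section Bridge.
Variable R : realType.
Variable d : nat.
Local Notation C := (R[i]).
Local Notation T := (cvT R d).
Local Notation mu := (@muT R d).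

Lemma measurable_cfunP (f : T -> C) : measurable_cfun f <-> cmeas f.
Proof.
by split=> -[h1 h2]; split; [apply/measurable_fun_gtr_sets|apply/measurable_fun_gtr_sets|
  move=> c; move/measurable_fun_gtr_sets: h1; exact|
  move=> c; move/measurable_fun_gtr_sets: h2; exact].
Qed.

Lemma L2norm2E (f : T -> C) : cmeas f -> L2norm2 f = n2 mu f.
Proof.
move=> mf; apply: iintE; first exact: cmeas_ecabs2.
by move=> v; rewrite lee_fin cabs2_ge0.
Qed.

Lemma inL2P (f : T -> C) : inL2 f <-> L2 mu f.
Proof.
split=> -[h1 h2].
  by have mf : cmeas f by [apply/measurable_cfunP]; split=> //; rewrite -L2norm2E.
by split; [apply/measurable_cfunP|rewrite L2norm2E].
Qed.

Lemma dist2E (f g : T -> C) : cmeas f -> cmeas g -> dist2 f g = n2 mu (fun v => f v - g v).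
Proof. by move=> mf mg; rewrite /dist2 L2norm2E //; exact: cmeasB. Qed.

Lemma RintE (F : T -> R) : mu.-integrable setT (fun v => (F v)%:E) ->
  Defs.Rint F = \int[mu]_v F v.
Proof.
move=> iF; have mF : measurable_fun setT F.
  by apply/measurable_EFinP; exact: measurable_int iF.
rewrite /Defs.Rint /Rintegral integralE.
have mp : measurable_fun setT (fun v : T => (Num.max (F v) 0)%:E).
  by apply/measurable_EFinP; exact: measurable_maxr.
have mn : measurable_fun setT (fun v : T => (Num.max (- F v) 0)%:E).
  by apply/measurable_EFinP; apply: measurable_maxr => //; exact: measurable_funN.
rewrite iintE //; last by move=> v; rewrite lee_fin le_max lexx orbT.
rewrite iintE //; last by move=> v; rewrite lee_fin le_max lexx orbT.
have e1 : (\int[mu]_v (Num.max (F v) 0)%:E = \int[mu]_v ((fun v => (F v)%:E)^\+ v))%E.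
  by apply: eq_integral => v _; rewrite funeposE EFin_max.
have e2 : (\int[mu]_v (Num.max (- F v) 0)%:E = \int[mu]_v ((fun v => (F v)%:E)^\- v))%E.
  by apply: eq_integral => v _; rewrite funenegE EFin_max EFinN.
rewrite e1 e2.
have fp : (\int[mu]_v ((fun v => (F v)%:E)^\+ v))%E \is a fin_num by exact: integrable_pos_fin_num.
have fn : (\int[mu]_v ((fun v => (F v)%:E)^\- v))%E \is a fin_num by exact: integrable_neg_fin_num.
by rewrite (fineB fp fn).
Qed.

Lemma cintE (f : T -> C) : cintble mu f -> cint f = cI mu f.
Proof. by move=> [h1 h2]; rewrite /cint /cI !RintE. Qed.

Lemma innerE (f g : T -> C) : L2 mu f -> L2 mu g -> inner f g = ip mu f g.
Proof. by move=> lf lg; rewrite /inner cintE //; exact: ip_cintble. Qed.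

End Bridge.

(** * Parseval's identity for Fourier series in several variables *)

Section Cubes.
Variable R : realType.
Local Notation C := (R[i]).

Definition cube (d : nat) (K : R) : set (cvT R d) := [set v | forall j, `|v j 0| <= K].
Arguments cube : clear implicits.

Lemma measurable_cube d K : measurable (cube d K).
Proof.
rewrite (_ : cube d K = \bigcap_(j in [set: 'I_d]) [set v : cvT R d | `|v j 0| <= K]).
  apply: fin_bigcap_measurable => [|j _]; first exact: finite_finset.
  rewrite (_ : [set v | _] = (fun v : cvT R d => v j 0) @^-1` `[- K, K]%classic).
    by rewrite -[X in measurable X]setTI; apply: measurable_coord.
  by apply/seteqP; split=> v /=; rewrite in_itv /= ler_norml.
by apply/seteqP; split=> v h j; [move=> _; exact: h|exact: (h j I)].
Qed.

Lemma cube_colf d K x (v : cvT R d) : cube d.+1 K (colf (x, v)) <-> `|x| <= K /\ cube d K v.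
Proof.
split=> [h|[h1 h2] j].
  by split=> [|j]; [have := h ord0; rewrite colf0|have := h (lift ord0 j); rewrite colfS].
by case: (unliftP ord0 j) => [k ->|->]; rewrite ?colfS ?colf0.
Qed.

Lemma muT_colf d (A : set (measurableTypeR R)) (B : set (cvT R d)) (D : set (cvT R d.+1)) :
  measurable A -> measurable B ->
  (forall x v, D (colf (x, v)) <-> A x /\ B v) ->
  muT d.+1 D = (@lebesgue_measure R A * muT d B)%E.
Proof.
move=> mA mB h; rewrite -product_measure1E //=; rewrite /push_colf; congr (_ _).
by apply/seteqP; split=> -[x v] /= /h.
Qed.

Lemma muT_cube d K : (muT d (cube d K) < +oo)%E.
Proof.
elim: d => [|d IH]; first by rewrite /= /dirac ltry.
rewrite (@muT_colf d (`[- K, K]%classic) (cube d K)) //; last 2 first.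
- exact: measurable_cube.
- by move=> x v; rewrite cube_colf /= in_itv /= ler_norml.
rewrite lte_mul_pinfty //.
- by rewrite lebesgue_measure_itv /=; case: ifP.
Qed.

Definition nice d (G : cvT R d -> C) (M K : R) := bdd_supp (muT d) G M (cube d K).

Lemma niceP d (G : cvT R d -> C) M K : cmeas G -> 0 <= M ->
  (forall v, cabs2 (G v) <= M ^+ 2) -> (forall v, ~ cube d K v -> G v = 0) -> nice G M K.
Proof.
by move=> mG M0 hM hK; split=> //; [exact: measurable_cube|exact: muT_cube].
Qed.

Lemma cmeas_comp dd1 dd2 (T1 : measurableType dd1) (T2 : measurableType dd2)
  (f : T2 -> C) (h : T1 -> T2) : cmeas f -> measurable_fun setT h -> cmeas (fun x => f (h x)).
Proof.
by move=> [f1 f2] mh; split; [exact: (measurableT_comp f1 mh)|exact: (measurableT_comp f2 mh)].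
Qed.

Lemma nice_slice d (G : cvT R d.+1 -> C) M K x : nice G M K ->
  nice (fun v : cvT R d => G (colf (x, v))) M K.
Proof.
move=> [mG M0 _ _ [hM hK]]; apply: niceP => //.
  apply: (cmeas_comp mG); apply: measurableT_comp; first exact: measurable_colf.
  exact: measurable_pair1.
by move=> v nv; apply: hK => /cube_colf[].
Qed.

Lemma measurable_dotR d (l : 'cV[R]_d) : measurable_fun setT (fun v : cvT R d => dotR l v).
Proof.
apply: measurable_sum => j; apply: measurable_funM => //; exact: measurable_coord.
Qed.

Lemma measurable_dotRl d (l : 'cV[R]_d) : measurable_fun setT (fun v : cvT R d => dotR v l).
Proof.
apply: measurable_sum => j; apply: measurable_funM => //; exact: measurable_coord.
Qed.

Lemma nice_cexpi d (G : cvT R d -> C) M K (F : cvT R d -> R) : nice G M K ->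
  measurable_fun setT F -> nice (fun v => cexpi (F v) * G v) M K.
Proof.
move=> nG mF; rewrite -[M]mul1r; apply: bdd_suppM => //.
  exact: cmeas_cexpi.
by move=> v; rewrite cabs2_cexpi expr1n.
Qed.

Lemma integrable_muTS d (F : cvT R d.+1 -> R) :
  (muT d.+1).-integrable setT (EFin \o F) ->
  (forall x, (muT d).-integrable setT (fun v => (F (colf (x, v)))%:E)) ->
  \int[muT d.+1]_v F v = \int[@lebesgue_measure R]_x \int[muT d]_v F (colf (x, v)).
Proof.
move=> iF isl; have mF : measurable_fun setT (EFin \o F) by exact: measurable_int iF.
have iFp : (@lebesgue_measure R \x muT d)%E.-integrable setT (fun p => (F (colf p))%:E).
  have mc : measurable_fun setT (fun p => (F (colf p))%:E).
    by apply: (@measurableT_comp _ _ _ _ _ _ (EFin \o F)) => //; exact: measurable_colf.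
  apply/integrableP; split=> //; have /integrableP[_] := iF.
  rewrite integral_muTS //; last by apply: measurableT_comp.
  rewrite -(@fubini_tonelli1 _ _ _ _ _ _ _ (fun p => `|(F (colf p))%:E|%E)) //.
  by apply: measurableT_comp.
rewrite /Rintegral.
under [in RHS]eq_integral do rewrite fineK ?integrable_fin_num //.
have -> : (\int[@lebesgue_measure R]_x \int[muT d]_v (F (colf (x, v)))%:E =
  \int[(@lebesgue_measure R \x muT d)]_p (F (colf p))%:E)%E.
  exact: (integral12_prod_meas1 iFp).
congr fine.
rewrite integralE [RHS]integralE.
have key (H : cvT R d.+1 -> \bar R) : measurable_fun setT H -> (forall v, 0 <= H v)%E ->
  (\int[muT d.+1]_v H v = \int[(@lebesgue_measure R \x muT d)]_p H (colf p))%E.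
  move=> mH H0; rewrite integral_muTS //.
  rewrite -(@fubini_tonelli1 _ _ _ _ _ _ _ (fun p => H (colf p))) //.
  by apply: measurableT_comp => //; exact: measurable_colf.
rewrite !key //; do ?[exact: measurable_funepos|exact: measurable_funeneg].
congr (_ - _)%E; apply: eq_integral => p _; first by rewrite !funeposE.
by rewrite !funenegE.
Qed.

Lemma cI_muTS d (G : cvT R d.+1 -> C) M K : nice G M K ->
  cI (muT d.+1) G = cI (@lebesgue_measure R) (fun x => cI (muT d) (fun v => G (colf (x, v)))).
Proof.
move=> nG; have [i1 i2] := bdd_supp_cintble nG.
rewrite /cI /=; congr Complex; apply: integrable_muTS => // x;
  by have [] := bdd_supp_cintble (nice_slice x nG).
Qed.

Definition dhat d (G : cvT R d -> C) (l : 'cV[int]_d) : C :=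
  cI (muT d) (fun v => cexpi (dotR (cvR R l) v) * G v).

Definition colZ d (p : 'cV[int]_d * int) : 'cV[int]_(d.+1) :=
  col_mx (const_mx p.2 : 'cV[int]_1) p.1.

Lemma colZ_bij d : set_bij ([set: 'cV[int]_d] `*`` (fun=> [set: int])) setT (@colZ d).
Proof.
split=> //.
- move=> [l a] [l' a'] _ _ /= /(@eq_col_mx _ 1 d 1) /= [] /matrixP /(_ 0 0).
  by rewrite !mxE => -> ->.
- move=> l _; exists (dsubmx (l : 'cV_(1 + d)), (l : 'cV_(1 + d)) (lshift d ord0) 0) => //=.
  rewrite /colZ /=.
  have -> : const_mx ((l : 'cV_(1 + d)) (lshift d (ord0 : 'I_1)) 0) = usubmx (l : 'cV_(1 + d)) :> 'cV[int]_1.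
    by apply/matrixP => i j; rewrite !ord1 !mxE.
  exact: (@vsubmxK _ 1 d 1 l).
Qed.

Lemma dotR_colZ d (l : 'cV[int]_d) a x (v : cvT R d) :
  dotR (cvR R (colZ (l, a))) (colf (x, v)) = a%:~R * x + dotR (cvR R l) v.
Proof.
rewrite /dotR big_ord_recl colf0; congr (_ * _ + _).
  rewrite mxE (_ : ord0 = lshift d (ord0 : 'I_1)); last exact: val_inj.
  by rewrite /colZ /=; congr (_%:~R); apply: etrans (col_mxEu _ _ _ _) _; rewrite mxE.
apply: eq_bigr => i _; rewrite colfS /cvR [X in X * _]mxE [X in _ = X * _]mxE; congr (_%:~R * _).
rewrite (_ : lift ord0 i = rshift 1 i); last exact: val_inj.
exact: (etrans (col_mxEd _ _ _ _)).
Qed.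

(** Induction on the dimension: for each [l] the transform [H l] in the last variables is a function
    of the first one, to which the one-dimensional identity applies; after exchanging sum and
    integral, the induction hypothesis applies to each slice. Half-side 1 places the support inside
    one period, as [pi > 1]. *)
Theorem fourier_parseval d (G : cvT R d -> C) (M : R) : nice G M 1 ->
  (\esum_(l in [set: 'cV[int]_d]) (cabs2 (dhat G l))%:E = ((2 * pi) ^+ d)%:E * n2 (muT d) G)%E.
Proof.
elim: d G M => [|d IH] G M nG.
  have e0 : [set: 'cV[int]_0] = [set 0].
    by apply/seteqP; split=> // l _ /=; apply/matrixP => -[].
  have [mG _ _ _ _] := nG.
  rewrite e0 esum_set1 ?lee_fin ?cabs2_ge0 // expr0 mul1e /n2 /=.
  rewrite integral_dirac //; last exact: cmeas_ecabs2.
  rewrite diracT mul1e /dhat /=; congr (cabs2 _)%:E.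
  have [[h1 _] [h2 _]] : (measurable_fun setT (fun v : cvT R 0 => complex.Re (G v)) /\ True) *
     (measurable_fun setT (fun v : cvT R 0 => complex.Im (G v)) /\ True) by case: mG.
  rewrite (_ : (fun v => _) = G); last first.
    by apply/funext => v; rewrite /dotR big_ord0 cexpi0 mul1r.
  apply: c_ext; rewrite /cI /Rintegral /=.
    by rewrite integral_dirac ?diracT ?mul1e //; exact/measurable_EFinP.
  by rewrite integral_dirac ?diracT ?mul1e //; exact/measurable_EFinP.
have p0 := twopi_gt0 R.
rewrite (@reindex_esum R _ _ _ _ (@colZ d) _ (@colZ_bij d)).
have := @esum_esum R _ _ [set: 'cV[int]_d] (fun=> [set: int])
  (fun l a => (cabs2 (dhat G (colZ (l, a))))%:E).
rewrite (eq_esum (b := fun k => (cabs2 (dhat G (colZ (k.1, k.2))))%:E)); last by case.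
move=> <- => [|l a _ _]; last by rewrite lee_fin cabs2_ge0.
pose H l (x : measurableTypeR R) : C :=
  cI (muT d) (fun v => cexpi (dotR (cvR R l) v) * G (colf (x, v))).
have mH l : cmeas (H l).
  have [mG _ _ _ _] := nG.
  apply: (@cmeas_cI_param _ _ _ _ _ (muT d)
    (fun p : measurableTypeR R * cvT R d => cexpi (dotR (cvR R l) p.2) * G (colf p))).
  apply: cmeasM; last by apply: (cmeas_comp mG); exact: measurable_colf.
  by apply: cmeas_cexpi; apply: (measurableT_comp (measurable_dotR _)); exact: measurable_snd.
have bH l : bdd_supp (@lebesgue_measure R) (H l) (2 * M * fine (muT d (cube d 1))) (@piI R).
  have [mG M0 _ _ [hM hK]] := nG.
  split=> //.
  - by rewrite !mulr_ge0 // fine_ge0.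
  - exact: measurable_itv.
  - exact: leb_piI.
  split=> x; first by apply: cabs2_cI_le; apply: nice_cexpi (measurable_dotR _); exact: nice_slice.
  move=> nx; rewrite /H -[RHS](cI0 (muT d)); apply: eq_cI => v.
  rewrite hK ?mulr0 // => /cube_colf[x1 _]; apply: nx; rewrite /piI /= in_itv /=.
  by have := pi_ge2 R; move: x1; rewrite ler_norml => /andP[? ?] ?; apply/andP; split; lra.
have E l a : dhat G (colZ (l, a)) = fhat (H l) a.
  rewrite /dhat (cI_muTS (nice_cexpi nG (measurable_dotR _))); apply: eq_cI => x.
  rewrite mulrC -cIZ.
    by apply: eq_cI => v; rewrite dotR_colZ cexpiD mulrA.
  exact: bdd_supp_cintble (nice_cexpi (nice_slice x nG) (measurable_dotR _)).
under eq_esum => l _.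
  under eq_esum do rewrite E.
  rewrite (fourier_parseval1 (bH l)); over.
rewrite esumZl ?(ltW p0) // => [|l]; last exact: n2_ge0.
rewrite exprS (EFinM (2 * pi)) -muleA; congr (_ * _)%E.
rewrite /n2 -integral_esum; last 2 first.
- by move=> l; exact: cmeas_ecabs2.
- by move=> l x; rewrite lee_fin cabs2_ge0.
rewrite [in RHS]integral_muTS; last 2 first.
- by apply: cmeas_ecabs2; case: nG.
- by move=> v; rewrite lee_fin cabs2_ge0.
rewrite -ge0_integralZl //; last 3 first.
- apply: (@measurable_fun_fubini_tonelli_F _ _ _ _ _ (muT d) (fun p => (cabs2 (G (colf p)))%:E)).
    apply: cmeas_ecabs2; case: nG => mG _ _ _ _; apply: (cmeas_comp mG); exact: measurable_colf.
  by move=> p; rewrite lee_fin cabs2_ge0.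
- by move=> x _; apply: integral_ge0 => v _; rewrite lee_fin cabs2_ge0.
- by rewrite lee_fin exprn_ge0 // ltW.
by apply: eq_integral => x _; rewrite -(IH _ _ (nice_slice x nG)).
Qed.

End Cubes.
Arguments cube {R} d K.

Section Plancherel.
Variables (R : realType) (d : nat).
Local Notation C := (R[i]).
Local Notation T := (cvT R d).
Local Notation mu := (@muT R d).

Lemma Rintegral_cov (M : 'M[R]_d) (F : T -> R) : \det M != 0 ->
  mu.-integrable setT (EFin \o F) ->
  `|\det M| * \int[mu]_v F (M *m v) = \int[mu]_v F v.
Proof.
move=> dM iF; have mF : measurable_fun setT (EFin \o F) by exact: measurable_int iF.
have mP := measurable_funepos mF; have mN := measurable_funeneg mF.
have cP := cov_unit dM mP (fun v => funepos_ge0 _ v).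
have cN := cov_unit dM mN (fun v => funeneg_ge0 _ v).
have fP : (\int[mu]_v (EFin \o F)^\+ v)%E \is a fin_num by exact: integrable_pos_fin_num.
have fN : (\int[mu]_v (EFin \o F)^\- v)%E \is a fin_num by exact: integrable_neg_fin_num.
have d0 : 0 < `|\det M| by rewrite normr_gt0.
have fin (x : \bar R) : (`|\det M|%:E * x)%E \is a fin_num -> x \is a fin_num.
  by case: x => //=; rewrite ?gt0_muley ?gt0_muleNy ?lte_fin.
have fP' : (\int[mu]_v (EFin \o F)^\+ (M *m v)%R)%E \is a fin_num by apply: fin; rewrite cP.
have fN' : (\int[mu]_v (EFin \o F)^\- (M *m v)%R)%E \is a fin_num by apply: fin; rewrite cN.
rewrite /Rintegral integralE [in RHS]integralE.
have -> : (\int[mu]_v ((fun v => (F (M *m v))%:E)^\+ v) = \int[mu]_v (EFin \o F)^\+ (M *m v)%R)%E.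
  by apply: eq_integral => v _; rewrite !funeposE.
have -> : (\int[mu]_v ((fun v => (F (M *m v))%:E)^\- v) = \int[mu]_v (EFin \o F)^\- (M *m v)%R)%E.
  by apply: eq_integral => v _; rewrite !funenegE.
rewrite (fineB fP' fN') mulrBr (fineB fP fN).
rewrite -{1}[`|\det M|]/(fine `|\det M|%:E) -{2}[`|\det M|]/(fine `|\det M|%:E).
by rewrite -!fineM // cP cN.
Qed.

Lemma cI_cov (M : 'M[R]_d) (f : T -> C) : \det M != 0 -> cintble mu f ->
  Complex `|\det M| 0 * cI mu (fun v => f (M *m v)) = cI mu f.
Proof.
move=> dM [i1 i2]; apply: c_ext; rewrite ?cReZ ?cImZ /=.
  by rewrite (@Rintegral_cov _ (fun v => complex.Re (f v))).
by rewrite (@Rintegral_cov _ (fun v => complex.Im (f v))).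
Qed.

Lemma n2_cov (M : 'M[R]_d) (f : T -> C) : \det M != 0 -> cmeas f ->
  (`|\det M|%:E * n2 mu (fun v => f (M *m v)) = n2 mu f)%E.
Proof.
move=> dM mf; apply: (cov_unit dM (F := fun v => (cabs2 (f v))%:E)).
  exact: cmeas_ecabs2.
by move=> v; rewrite lee_fin cabs2_ge0.
Qed.

Lemma n2_translate (b : 'cV[R]_d) (f : T -> C) : cmeas f ->
  n2 mu (fun v => f (v + b)) = n2 mu f.
Proof.
move=> mf; apply: (ge0_integral_translate b (F := fun v => (cabs2 (f v))%:E)).
  exact: cmeas_ecabs2.
by move=> v; rewrite lee_fin cabs2_ge0.
Qed.

Definition ucube : set T := [set v | forall j, 0 <= v j 0 < 1].

Lemma measurable_ucube : measurable ucube.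
Proof.
rewrite (_ : ucube = \bigcap_(j in [set: 'I_d]) [set v : T | 0 <= v j 0 < 1]).
  apply: fin_bigcap_measurable => [|j _]; first exact: finite_finset.
  rewrite (_ : [set v | _] = (fun v : T => v j 0) @^-1` `[0, 1[%classic).
    by rewrite -[X in measurable X]setTI; apply: measurable_coord.
  by apply/seteqP; split=> v /=; rewrite in_itv.
by apply/seteqP; split=> v h j; [move=> _; exact: h|exact: (h j I)].
Qed.

Definition floorv (v : T) : 'cV[int]_d := \col_j Num.floor (v j 0).

Lemma ucubeE (v : T) (l : 'cV[int]_d) : ucube (v - cvR R l) <-> l = floorv v.
Proof.
have E j : (v - cvR R l) j 0 = v j 0 - (l j 0)%:~R by rewrite !mxE.
split=> [h|->{E} j].
  apply/matrixP => i j; rewrite !ord1 mxE; apply/esym/floor_def.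
  by have := h i; rewrite E intrD => /andP[h1 h2]; apply/andP; split; lra.
rewrite !mxE; have := floor_itv (v j 0); rewrite intrD => /andP[h1 h2].
by apply/andP; split; lra.
Qed.

Lemma esum_ucube (v : T) (a : \bar R) : (0 <= a)%E ->
  (\esum_(l in [set: 'cV[int]_d]) ((\1_ucube ((v - cvR R l)%R : T))%:E * a) = a)%E.
Proof.
move=> a0; rewrite (esumID [set floorv v]) //; last first.
  by move=> l _; rewrite mule_ge0 // lee_fin.
rewrite setTI esum_set1; last by rewrite mule_ge0 // lee_fin.
rewrite indicE mem_set ?mul1e; last by apply/ucubeE.
rewrite esum1 ?adde0 // => l [_ nl]; rewrite indicE memNset ?mul0e //.
by move=> /ucubeE.
Qed.

(** Every point lies in exactly one integer translate of [ucube], the one given by the floors of its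
    coordinates. Each piece is translated back to [ucube]. *)
Lemma tiling (F : T -> \bar R) : measurable_fun setT F -> (forall v, 0 <= F v)%E ->
  (\int[mu]_v F v =
   \int[mu]_v ((\1_ucube v)%:E * \esum_(l in [set: 'cV[int]_d]) F (v + cvR R l)%R))%E.
Proof.
move=> mF F0.
have m1 : measurable_fun setT (fun v : T => (\1_ucube v : R)%:E).
  by apply/measurable_EFinP; apply: measurable_indic; exact: measurable_ucube.
have mFt l : measurable_fun setT (fun v : T => F (v + cvR R l)).
  by apply: (@measurableT_comp _ _ _ _ _ _ F) => //; exact: measurable_translate.
transitivity (\esum_(l in [set: 'cV[int]_d])
   \int[mu]_v ((\1_ucube v)%:E * F (v + cvR R l)%R))%E; last first.
  rewrite -integral_esum; last 2 first.
  - by move=> l; apply: emeasurable_funM.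
  - by move=> l v; rewrite mule_ge0 // lee_fin.
  apply: eq_integral => v _; rewrite indicE; case: (v \in ucube) => /=.
    by rewrite mul1e; apply: eq_esum => l _; rewrite mul1e.
  by rewrite mul0e esum1 // => l _; rewrite mul0e.
transitivity (\esum_(l in [set: 'cV[int]_d])
   \int[mu]_v ((\1_ucube ((v - cvR R l)%R : T))%:E * F v))%E.
  rewrite -integral_esum; last 2 first.
  - move=> l; apply: emeasurable_funM => //.
    apply: (@measurableT_comp _ _ _ _ _ _ (fun v : T => (\1_ucube v : R)%:E)) => //.
    exact: measurable_translate.
  - by move=> l v; rewrite mule_ge0 // lee_fin.
  by apply: eq_integral => v _; rewrite esum_ucube.
apply: eq_esum => l _.
rewrite -(ge0_integral_translate (cvR R l)
  (F := fun v => (\1_ucube ((v - cvR R l)%R : T))%:E * F v)%E) //.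
- by apply: eq_integral => v _; rewrite addrK.
- apply: emeasurable_funM => //.
  apply: (@measurableT_comp _ _ _ _ _ _ (fun v : T => (\1_ucube v : R)%:E)) => //.
  exact: measurable_translate.
- by move=> v; rewrite mule_ge0 // lee_fin.
Qed.

Definition invF (G : T -> C) (t : T) : C :=
  c2pi R d * cI mu (fun xi => cexpi (dotR xi t) * G xi).

Lemma cabs2_c2pi : cabs2 (c2pi R d) = ((2 * pi) ^+ d)^-1.
Proof.
rewrite cabs2_real -exprM mulnC exprM exprVn sqr_sqrtr ?exprVn //.
by rewrite ltW // twopi_gt0.
Qed.

Lemma nice_dot (G : T -> C) M K t : nice G M K -> nice (fun xi => cexpi (dotR xi t) * G xi) M K.
Proof. by move=> nG; apply: (nice_cexpi nG); exact: measurable_dotRl. Qed.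

Lemma invF_cintble (G : T -> C) M K t : nice G M K ->
  cintble mu (fun xi => cexpi (dotR xi t) * G xi).
Proof. by move=> nG; exact: bdd_supp_cintble (nice_dot t nG). Qed.

Lemma measurable_dot2 : measurable_fun setT (fun p : T * T => dotR p.1 p.2).
Proof.
apply: measurable_sum => j; apply: measurable_funM.
  by apply: (measurableT_comp (measurable_coord j)); exact: measurable_fst.
by apply: (measurableT_comp (measurable_coord j)); exact: measurable_snd.
Qed.

Lemma dotRC (x y : 'cV[R]_d) : dotR x y = dotR y x.
Proof. by apply: eq_bigr => j _; rewrite mulrC. Qed.

Lemma cmeas_invF (G : T -> C) : cmeas G -> cmeas (invF G).
Proof.
move=> mG; apply: cmeasZ.
apply: (@cmeas_cI_param _ _ _ _ _ mu (fun p : T * T => cexpi (dotR p.2 p.1) * G p.2)).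
apply: cmeasM; last by apply: (cmeas_comp mG); exact: measurable_snd.
apply: cmeas_cexpi; under eq_fun do rewrite dotRC; exact: measurable_dot2.
Qed.

Lemma dotRDr (x y z : 'cV[R]_d) : dotR x (y + z) = dotR x y + dotR x z.
Proof.
by rewrite /dotR -big_split; apply: eq_bigr => j _; rewrite mxE mulrDr.
Qed.

End Plancherel.

Lemma muT_ucube (R : realType) d : muT d (@ucube R d) = 1%E.
Proof.
elim: d => [|d IH]; first by rewrite /= diracE mem_set // => -[].
rewrite (@muT_colf R d (`[0, 1[%classic) (@ucube R d)).
- by rewrite IH lebesgue_measure_itv /= lte_fin ltr01 oppr0 adde0 mule1.
- exact: measurable_itv.
- exact: measurable_ucube.
- move=> x v; rewrite /= in_itv /=; split=> [h|[h1 h2] j].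
    by split=> [|j]; [have := h ord0; rewrite colf0|have := h (lift ord0 j); rewrite colfS].
  by case: (unliftP ord0 j) => [k ->|->]; rewrite ?colfS ?colf0.
Qed.

Section PlancherelTheorem.
Variables (R : realType) (d : nat).
Local Notation C := (R[i]).
Local Notation T := (cvT R d).
Local Notation mu := (@muT R d).
Implicit Types (f g G H : T -> C).

Lemma n2_cexpi (F : T -> R) G : n2 mu (fun v => cexpi (F v) * G v) = n2 mu G.
Proof. by apply: eq_integral => v _; rewrite cabs2M cabs2_cexpi mul1r. Qed.

(* The values of [invF G] on the coset [v + Z^d] are the Fourier coefficients of
   [xi |-> exp(i xi.v) G xi]; integrate Parseval's identity over [v] in the unit cube. *)
Lemma plancherel1 G M : nice G M 1 -> n2 mu (invF G) = n2 mu G.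
Proof.
move=> nG; have [mG M0 _ _ _] := nG; have p0 := twopi_gt0 R.
have pd0 : 0 < (2 * pi) ^+ d :> R by rewrite exprn_gt0.
rewrite {1}/n2 tiling; last 2 first.
- by apply: cmeas_ecabs2; exact: cmeas_invF.
- by move=> v; rewrite lee_fin cabs2_ge0.
transitivity (\int[mu]_v ((\1_(@ucube R d) v)%:E * n2 mu G))%E; last first.
  rewrite ge0_integralZr ?n2_ge0 //; last first.
    by apply/measurable_EFinP; apply: measurable_indic; exact: measurable_ucube.
  rewrite integral_indic ?setIT ?measurable_ucube //; last exact: measurable_ucube.
  by rewrite [X in (X * _)%E]muT_ucube mul1e.
apply: eq_integral => v _; congr (_ * _)%E.
have E l : invF G (v + cvR R l) = c2pi R d * dhat (fun xi => cexpi (dotR xi v) * G xi) l.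
  by congr (_ * _); apply: eq_cI => xi; rewrite dotRDr addrC cexpiD mulrA (dotRC (cvR R l)).
under eq_esum do rewrite E cabs2M cabs2_c2pi EFinM.
rewrite esumZl ?invr_ge0 ?(ltW pd0) // => [|l]; last by rewrite lee_fin cabs2_ge0.
rewrite (fourier_parseval (nice_dot v nG)) muleA -EFinM mulVf ?gt_eqF // mul1e.
exact: n2_cexpi.
Qed.

Lemma dotR_mulmx (B : 'M[R]_d) (x y : 'cV[R]_d) : dotR (B *m x) y = dotR x (B^T *m y).
Proof.
rewrite /dotR; under eq_bigr do rewrite mxE mulr_suml.
rewrite exchange_big /=; apply: eq_bigr => i _; rewrite mxE mulr_sumr.
by apply: eq_bigr => j _; rewrite mxE; ring.
Qed.

Lemma mulmx_cube (B : 'M[R]_d) (K : R) (v : T) : 0 <= K -> cube d K v ->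
  cube d ((\sum_j \sum_k `|B j k|) * K) (B *m v).
Proof.
move=> K0 hv j; rewrite mxE; apply: le_trans (ler_norm_sum _ _ _) _.
apply: (@le_trans _ _ ((\sum_k `|B j k|) * K)).
  rewrite mulr_suml; apply: ler_sum => k _; rewrite normrM ler_wpM2l //; exact: hv.
apply: ler_wpM2r => //; rewrite [X in _ <= X](bigD1 j) //= lerDl.
by apply: sumr_ge0 => i _; exact: sumr_ge0.
Qed.

Lemma nice_mul (B : 'M[R]_d) G M K : B \in unitmx -> nice G M K ->
  exists K', nice (fun v => G (B *m v)) M K'.
Proof.
move=> uB nG; have [mG M0 _ _ [hM hK]] := nG.
(* [nice] allows a negative [K], whereas [mulmx_cube] needs a nonnegative half-side. *)
exists ((\sum_j \sum_k `|invmx B j k|) * Num.max K 0); apply: niceP => //.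
  by apply: (cmeas_comp mG); exact: measurable_mulmx.
move=> v nv; apply: hK => hv; apply: nv.
rewrite -[v](mulKmx uB); apply: mulmx_cube; first by rewrite le_max lexx orbT.
by move=> j; rewrite le_max hv.
Qed.

Lemma invF_mul (B : 'M[R]_d) G M K (s : T) : B \in unitmx -> nice G M K ->
  Complex `|\det B| 0 * invF (fun v => G (B *m v)) (B^T *m s) = invF G s.
Proof.
move=> uB nG; rewrite /invF mulrCA; congr (_ * _).
rewrite -[RHS](@cI_cov R d B); last 2 first.
- by rewrite -unitfE.
- exact: invF_cintble nG.
by congr (_ * _); apply: eq_cI => xi; rewrite dotR_mulmx.
Qed.

(** A homothety of ratio [k = |K| + 1] brings the support into the cube of half-side 1, where
    [plancherel1] holds; the powers of the determinant cancel. *)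
Lemma plancherel G M K : nice G M K -> n2 mu (invF G) = n2 mu G.
Proof.
move=> nG; have [mG M0 _ _ [hM hK]] := nG.
pose k : R := `|K| + 1; have k0 : 0 < k by rewrite /k ltr_wpDl.
pose B : 'M[R]_d := k%:M.
have dB : \det B = k ^+ d by rewrite det_scalar.
have db0 : 0 < k ^+ d by rewrite exprn_gt0.
have dBn : \det B != 0 by rewrite dB gt_eqF.
have uB : B \in unitmx by rewrite unitmxE unitfE.
have nG' : nice (fun v => G (B *m v)) M 1.
  apply: niceP => //; first by apply: (cmeas_comp mG); exact: measurable_mulmx.
  move=> v nv; apply: hK => hv; apply: nv => j; have := hv j.
  rewrite mul_scalar_mx mxE normrM (gtr0_norm k0) => h.
  rewrite -(ler_pM2l k0) mulr1; apply: le_trans h _.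
  by rewrite /k; have := ler_norm K; lra.
have BT : B^T = B by rewrite tr_scalar_mx.
have mI : cmeas (invF (fun v => G (B *m v))).
  by apply: cmeas_invF; apply: (cmeas_comp mG); exact: measurable_mulmx.
rewrite (@eq_n2 _ _ _ mu (invF G)
   (fun s => Complex `|\det B| 0 * invF (fun v => G (B *m v)) (B *m s))); last first.
  by move=> s; rewrite -(invF_mul s uB nG) BT.
rewrite n2Z; last by apply: (cmeas_comp mI); exact: measurable_mulmx.
rewrite cabs2_real expr2 EFinM -muleA (n2_cov dBn mI) (plancherel1 nG').
exact: n2_cov.
Qed.

Definition Nice G := exists M K, nice G M K.

Lemma NiceD G H : Nice G -> Nice H -> Nice (fun v => G v + H v).
Proof.
move=> [M [K [mG M0 _ _ [hM hK]]]] [N [L [mH N0 _ _ [hN hL]]]].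
exists (2 * M + 2 * N), (Num.max K L); apply: niceP.
- exact: cmeasD.
- by rewrite addr_ge0 // mulr_ge0.
- move=> x; apply: le_trans (cabs2D_le _ _) _; have := hM x; have := hN x.
  by have := mulr_ge0 M0 N0; have := sqr_ge0 M; have := sqr_ge0 N; nra.
- move=> v nv; rewrite hK ?hL ?addr0 // => h; apply: nv => j; rewrite le_max h ?orbT //.
Qed.

Lemma NiceM (g G : T -> C) (K0 : R) : Nice G -> cmeas g -> (forall v, cabs2 (g v) <= K0 ^+ 2) ->
  0 <= K0 -> Nice (fun v => g v * G v).
Proof. by move=> [M [K nG]] mg hg K00; exists (K0 * M), K; apply: bdd_suppM. Qed.

Lemma NiceZ (c : C) G : Nice G -> Nice (fun v => c * G v).
Proof.
move=> nG; apply: (@NiceM (fun=> c) _ (1 + cabs2 c) nG); first exact: cmeas_cst.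
  by move=> _; have := cabs2_ge0 c; nra.
by rewrite addr_ge0 // cabs2_ge0.
Qed.

Lemma Nice_L2 G : Nice G -> L2 mu G.
Proof. by move=> [M [K nG]]; exact: bdd_supp_L2 nG. Qed.

Lemma Nice_cmeas G : Nice G -> cmeas G.
Proof. by move=> [M [K []]]. Qed.

Lemma NiceJ G : Nice G -> Nice (fun v => (G v)^*).
Proof.
move=> [M [K [mG M0 _ _ [hM hK]]]]; exists M, K; apply: niceP => //.
- exact: cmeasJ.
- by move=> v; rewrite cabs2J.
- by move=> v /hK ->; rewrite conjC0.
Qed.

Lemma L2_invF G : Nice G -> L2 mu (invF G).
Proof.
move=> nG; have [mG fG] := Nice_L2 nG; have [M [K nG']] := nG.
by split; [exact: cmeas_invF|rewrite (plancherel nG')].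
Qed.

Lemma Nm_invF G : Nice G -> Nm mu (invF G) = Nm mu G.
Proof. by move=> [M [K nG]]; rewrite /Nm (plancherel nG). Qed.

Lemma invFD G H v : Nice G -> Nice H -> invF (fun x => G x + H x) v = invF G v + invF H v.
Proof.
move=> [M [K nG]] [N [L nH]]; rewrite /invF -mulrDr -cID; last 2 first.
- exact: invF_cintble nG.
- exact: invF_cintble nH.
by congr (_ * _); apply: eq_cI => x; rewrite mulrDr.
Qed.

Lemma invFZ (c : C) G v : Nice G -> invF (fun x => c * G x) v = c * invF G v.
Proof.
move=> [M [K nG]]; rewrite /invF [RHS]mulrCA; congr (_ * _).
rewrite -cIZ; last exact: invF_cintble nG.
by apply: eq_cI => x; rewrite mulrCA.
Qed.

(** Polarization: real parts come from the norm of a sum, and imaginary parts from replacing [G] by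
    [-i G]. *)
Lemma plancherel_ip G H : Nice G -> Nice H -> ip mu (invF G) (invF H) = ip mu G H.
Proof.
have key G' H' : Nice G' -> Nice H' ->
    complex.Re (ip mu (invF G') (invF H')) = complex.Re (ip mu G' H').
  move=> nG nH; have := Nm_invF (NiceD nG nH).
  rewrite (_ : invF (fun x => _) = (fun v => invF G' v + invF H' v)); last first.
    by apply/funext => v; rewrite invFD.
  rewrite !NmD; do ?[exact: L2_invF|exact: Nice_L2].
  by rewrite !Nm_invF //; lra.
move=> nG nH; apply: c_ext; first exact: key.
have := key _ _ (NiceZ (Complex 0 (-1)) nG) nH.
rewrite (_ : invF (fun x => _) = (fun v => Complex 0 (-1) * invF G v)); last first.
  by apply/funext => v; rewrite invFZ.
rewrite (ipZl _ (L2_invF nG) (L2_invF nH)) (ipZl _ (Nice_L2 nG) (Nice_L2 nH)).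
by rewrite !cReM /=; lra.
Qed.

Lemma L2_trunc (B : nat -> set T) f : L2 mu f -> (forall n, measurable (B n)) ->
  (forall x, \forall n \near \oo, B n x) -> forall eps : R, 0 < eps ->
  exists N, forall n, (N <= n)%N ->
    Nm mu (fun x => f x - Complex (\1_(B n) x) 0 * f x) < eps.
Proof.
move=> lf mB hB eps ep0; have [mf ff] := lf.
pose h n (x : T) : \bar R := (cabs2 (f x - Complex (\1_(B n) x) 0 * f x))%:E.
have mi n : cmeas (fun x : T => Complex (\1_(B n) x) 0 : C).
  by split => /=; [exact: measurable_indic|exact: measurable_cst].
have mh n : measurable_fun setT (h n).
  by apply: cmeas_ecabs2; apply: cmeasB => //; apply: cmeasM.
have hE n x : h n x = if x \in B n then 0%E else (cabs2 (f x))%:E.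
  rewrite /h indicE; case: (x \in B n); last by rewrite mul0r subr0.
  by rewrite mul1r subrr cabs20.
have H1 : {ae mu, forall x, setT x -> h n x @[n --> \oo] --> 0%E}.
  apply: aeW => x _; apply: cvg_near_cst.
  by near=> n; rewrite hE mem_set //; near: n; exact: hB.
have H2 : {ae mu, forall x n, setT x -> (`|h n x| <= (cabs2 (f x))%:E)%E}.
  apply: aeW => x n _; rewrite hE; case: ifP => _; rewrite ?abse0 ?lee_fin ?cabs2_ge0 //.
  by rewrite ger0_norm // cabs2_ge0.
have [_ _] := @dominated_convergence _ _ _ mu setT measurableT h (fun=> 0%E)
  (fun x => (cabs2 (f x))%:E) mh (measurable_cst _) H1 (L2_integrable lf) H2.
rewrite integral0 => cv.
have {}cv : (fun n => fine (\int[mu]_x h n x)%E) @ \oo --> (0 : R) by exact: fine_cvg cv.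
have [N _ hN] := cvgr_lt _ cv _ ep0.
by exists N => n Nn; apply: hN.
Unshelve. all: by end_near. Qed.

Lemma cube_near (v : T) : \forall n \near \oo, cube d n%:R v.
Proof.
exists (\max_j Num.bound (v j 0%R))%N => // n /= hn j.
apply: ltW; apply: (lt_le_trans (archi_boundP (normr_ge0 _))).
rewrite ler_nat; apply: leq_trans hn.
rewrite (_ : Num.bound `|v j 0| = Num.bound (v j 0)); last by rewrite /Num.bound /= normr_id.
by rewrite (bigD1 j) //= leq_maxl.
Qed.

Lemma Nice_dense f : L2 mu f -> forall eps : R, 0 < eps ->
  exists G, Nice G /\ Nm mu (fun x => f x - G x) < eps.
Proof.
move=> lf eps ep0; have [mf ff] := lf.
pose B n : set T := cube d n%:R `&` [set x | cabs2 (f x) < n%:R ^+ 2].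
have mB n : measurable (B n).
  apply: measurableI; first exact: measurable_cube.
  by have /measurable_fun_gtr_sets := cmeas_cabs2 mf; apply.
have hB x : \forall n \near \oo, B n x.
  have h1 := cube_near x.
  have h2 : \forall n \near \oo, cabs2 (f x) < n%:R ^+ 2.
    exists (Num.bound (cabs2 (f x))).+1 => // n /= hn.
    have : cabs2 (f x) < n%:R.
      apply: (lt_le_trans (archi_boundP (cabs2_ge0 _))); rewrite ler_nat; exact: ltnW.
    by move/lt_le_trans; apply; rewrite expr2 ler_peMr // ler1n (leq_trans _ hn).
  by near=> n; split; near: n.
have [N hN] := L2_trunc lf mB hB ep0.
exists (fun x => Complex (\1_(B N) x) 0 * f x); split; last exact: hN.
exists N%:R, N%:R; apply: niceP => //.
- apply: cmeasM => //; split => /=; [exact: measurable_indic|exact: measurable_cst].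
- move=> v; rewrite cabs2M cabs2_real indicE; case: (boolP (v \in B N)).
    by rewrite inE => -[_ h]; rewrite expr1n mul1r ltW.
  by move=> _; rewrite expr0n mul0r sqr_ge0.
- by move=> v nv; rewrite indicE memNset ?mul0r // => -[].
Unshelve. all: by end_near. Qed.

(** The forward transform, expressed through [invF] and conjugations so that the results on [invF]
    carry over. *)
Definition FT f (xi : T) : C := (invF (fun t => (f t)^*) xi)^*.

Lemma ip_invF f G : Nice f -> Nice G -> ip mu f (invF G) = ip mu (FT f) G.
Proof.
move=> nf nG; have [M [K nf']] := nf; have [N [L nG']] := nG.
have [mf M0 mK fK [hM hK]] := nf'; have [mG N0 mL fL [hN hL]] := nG'.
have c0 : (c2pi R d)^* = c2pi R d by rewrite cJ_real.
have nfJ := NiceJ nf; have [MJ [KJ nfJ']] := nfJ.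
pose F (p : T * T) : C := c2pi R d * (cexpi (- dotR p.2 p.1) * f p.1 * (G p.2)^*).
transitivity (cI mu (fun t => cI mu (fun xi => F (t, xi)))).
  apply: eq_cI => t; rewrite /invF cJM c0 -cIJ; last exact: invF_cintble nG'.
  rewrite mulrCA -!cIZ.
  - by apply: eq_cI => xi; rewrite /F /= cJM cexpiN; ring.
  - apply: cintbleZ; apply: cintbleJ; exact: invF_cintble nG'.
  - apply: cintbleJ; exact: invF_cintble nG'.
(* The bound has to be a square: [cabs2 c <= (1 + cabs2 c)^2] avoids a square root. *)
rewrite (@cI_Fubini _ _ _ _ _ mu mu F ((1 + cabs2 (c2pi R d)) * (M * N)) (cube d K) (cube d L)) //.
- apply: eq_cI => xi; rewrite /FT /invF cJM c0 -cIJ; last exact: invF_cintble nfJ'.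
  rewrite mulrAC -cIZ; last by apply: cintbleJ; exact: invF_cintble nfJ'.
  by apply: eq_cI => t; rewrite /F /= (dotRC xi) cJM conjCK cexpiN; ring.
- apply: cmeasZ; apply: cmeasM; last by apply: cmeasJ; apply: (cmeas_comp mG); exact: measurable_snd.
  apply: cmeasM; last by apply: (cmeas_comp mf); exact: measurable_fst.
  apply: cmeas_cexpi; apply: measurable_funN; under eq_fun do rewrite dotRC; exact: measurable_dot2.
- by rewrite !mulr_ge0 // addr_ge0 // cabs2_ge0.
- move=> p; rewrite /F !cabs2M cabs2_cexpi mul1r cabs2J exprMn ler_pM //.
  + by rewrite cabs2_ge0.
  + by rewrite mulr_ge0 // cabs2_ge0.
  + by have := cabs2_ge0 (c2pi R d); nra.
  + by rewrite exprMn ler_pM // cabs2_ge0.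
- move=> x y h; rewrite /F /=.
  by case: h => [/hK ->|/hL ->]; rewrite ?conjC0 ?mulr0 ?mul0r ?mulr0.
Qed.

(** Surjectivity in Plancherel's theorem. After reduction to a nice [f1], take for [G] a truncation
    of [FT f1]. Duality gives [Nm G] as the real part of [ip f1 (invF G)], so the squared error is
    [Nm f1 - Nm G]. Since [FT] preserves the norm, this is the truncation error of the square
    integrable [FT f1]. *)
Lemma invF_dense f : L2 mu f -> forall eps : R, 0 < eps ->
  exists G, Nice G /\ Nm mu (fun x => f x - invF G x) < eps.
Proof.
move=> lf eps ep0; have ep4 : 0 < eps / 4 by rewrite divr_gt0.
have [f1 [nf1 h1]] := Nice_dense lf ep4.
have lf1 := Nice_L2 nf1.
have nfJ := NiceJ nf1; have [MJ [KJ nfJ']] := nfJ.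
have lFT : L2 mu (FT f1).
  have [mi fi] := L2_invF nfJ; split; first exact: cmeasJ.
  by rewrite (_ : n2 mu _ = n2 mu (invF (fun t => (f1 t)^*))) //; apply: eq_integral => x _; rewrite cabs2J.
have NFT : Nm mu (FT f1) = Nm mu f1.
  transitivity (Nm mu (invF (fun t => (f1 t)^*))).
    by rewrite /Nm /n2; congr fine; apply: eq_integral => x _; rewrite cabs2J.
  rewrite Nm_invF //; rewrite /Nm /n2; congr fine; apply: eq_integral => x _.
  by rewrite cabs2J.
have [N hN] := L2_trunc lFT (fun n => @measurable_cube R d n%:R) cube_near ep4.
pose G xi := Complex (\1_(cube d N%:R : set T) xi) 0 * FT f1 xi.
have mi : cmeas (fun xi : T => Complex (\1_(cube d N%:R : set T) xi) 0 : C).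
  by split => /=; [apply: measurable_indic; exact: measurable_cube|exact: measurable_cst].
have nG : Nice G.
  exists ((1 + cabs2 (c2pi R d)) * (2 * MJ * fine (mu (cube d KJ)))), N%:R.
  have [_ MJ0 _ _ _] := nfJ'.
  have b0 : 0 <= 2 * MJ * fine (mu (cube d KJ)) by rewrite !mulr_ge0 // fine_ge0.
  apply: niceP.
  - by apply: cmeasM => //; case: lFT.
  - by rewrite mulr_ge0 // addr_ge0 // cabs2_ge0.
  - move=> v; rewrite cabs2M cabs2_real /FT cabs2J /invF cabs2M.
    have h3 : cabs2 (cI mu (fun xi => cexpi (dotR xi v) * (f1 xi)^*)) <= (2 * MJ * fine (mu (cube d KJ))) ^+ 2.
      exact: cabs2_cI_le (nice_dot v nfJ').
    have h4 : cabs2 (c2pi R d) <= (1 + cabs2 (c2pi R d)) ^+ 2.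
      by have := cabs2_ge0 (c2pi R d); nra.
    apply: (@le_trans _ _ (1 * (cabs2 (c2pi R d) * cabs2 (cI mu (fun xi => cexpi (dotR xi v) * (f1 xi)^*))))).
      rewrite ler_wpM2r ?mulr_ge0 ?cabs2_ge0 // indicE; case: (v \in _) => /=; by rewrite ?expr1n ?expr0n.
    by rewrite mul1r exprMn ler_pM // cabs2_ge0.
  - by move=> v nv; rewrite /G indicE memNset // mul0r.
exists G; split=> //.
have lG := Nice_L2 nG; have lI := L2_invF nG.
have ipG : complex.Re (ip mu f1 (invF G)) = Nm mu G.
  rewrite ip_invF // -[RHS](_ : complex.Re (ip mu G G) = _); last by rewrite ip_ff.
  congr complex.Re; apply: eq_cI => xi; rewrite /G cJM cJ_real indicE.
  by case: (xi \in _); rewrite ?mul1r // !mul0r mulr0.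
have hG : Nm mu f1 - Nm mu G < eps / 4.
  have := hN N (leqnn N); rewrite -/G NmB // NFT.
  have -> : complex.Re (ip mu (FT f1) G) = Nm mu G by rewrite -ip_invF.
  by lra.
have h2 : Nm mu (fun x => f1 x - invF G x) < eps / 4.
  by rewrite NmB // ipG Nm_invF //; lra.
have -> : (fun x => f x - invF G x) = (fun x => (f x - f1 x) + (f1 x - invF G x)).
  by apply/funext => x; rewrite addrA subrK.
apply: le_lt_trans (NmD_le (L2B lf lf1) (L2B lf1 lI)) _; lra.
Qed.

Lemma invF_total f : L2 mu f -> (forall G, Nice G -> ip mu (invF G) f = 0) -> n2 mu f = 0%E.
Proof.
move=> lf h0; rewrite -NmE //; congr EFin; apply/eqP; rewrite eq_le Nm_ge0 andbT.
apply/ler_addgt0Pr => ep ep0; rewrite add0r.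
have [G [nG hG]] := invF_dense lf ep0.
have lI := L2_invF nG.
have E : ip mu (fun x => f x - invF G x) f = Complex (Nm mu f) 0.
  by rewrite ipBl // h0 // subr0 ip_ff.
have := cauchy_schwarz (L2B lf lI) lf; rewrite E cabs2_real => cs.
have [->|n0] := eqVneq (Nm mu f) 0; first exact: ltW.
have np : 0 < Nm mu f by rewrite lt_neqAle eq_sym n0 Nm_ge0.
move: cs; rewrite expr2 ler_pM2r // => h; apply: le_trans h _; exact: ltW.
Qed.

End PlancherelTheorem.

(** * Powers of an expansive matrix *)

Section Modulus.
Variable R : realType.
Local Notation C := (R[i]).

Definition cmod (z : C) : R := Num.sqrt (cabs2 z).

Lemma cmod_ge0 z : 0 <= cmod z.
Proof. exact: sqrtr_ge0. Qed.
Lemma cmodM x y : cmod (x * y) = cmod x * cmod y.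
Proof. by rewrite /cmod cabs2M sqrtrM // cabs2_ge0. Qed.
Lemma normc_cmod (z : C) : `|z| = Complex (cmod z) 0.
Proof. exact: normc_def. Qed.
Lemma cmodD x y : cmod (x + y) <= cmod x + cmod y.
Proof.
have := ler_normD x y; rewrite !normc_cmod.
by rewrite lecE /= => /andP[_].
Qed.
Lemma cmodN x : cmod (- x) = cmod x.
Proof. by rewrite /cmod cabs2N. Qed.
Lemma cmodB x y : cmod (x - y) <= cmod x + cmod y.
Proof. by rewrite -(cmodN y); exact: cmodD. Qed.
Lemma cmod0 : cmod 0 = 0.
Proof. by rewrite /cmod cabs20 sqrtr0. Qed.
Lemma cmod_real (a : R) : cmod (Complex a 0) = `|a|.
Proof. by rewrite /cmod cabs2_real sqrtr_sqr. Qed.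
Lemma cmod_sum I (s : seq I) (F : I -> C) : cmod (\sum_(i <- s) F i) <= \sum_(i <- s) cmod (F i).
Proof.
elim: s => [|i s IH]; first by rewrite !big_nil cmod0.
by rewrite !big_cons; apply: le_trans (cmodD _ _) _; rewrite lerD2l.
Qed.
Lemma cabs2_cmod z : cabs2 z = cmod z ^+ 2.
Proof. by rewrite /cmod sqr_sqrtr // cabs2_ge0. Qed.
End Modulus.

Section MatrixPowers.
Variable R : realType.
Local Notation C := (R[i]).
Variable d : nat.

Definition mnrm m (Y : 'M[C]_(d, m)) : R := \sum_i \sum_j cmod (Y i j).

Lemma mnrm_ge0 m (Y : 'M[C]_(d, m)) : 0 <= mnrm Y.
Proof. by apply: sumr_ge0 => i _; apply: sumr_ge0 => j _; exact: cmod_ge0. Qed.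
Lemma mnrmB m (Y Z : 'M[C]_(d, m)) : mnrm (Y - Z) <= mnrm Y + mnrm Z.
Proof.
rewrite /mnrm -big_split; apply: ler_sum => i _; rewrite -big_split; apply: ler_sum => j _.
by rewrite !mxE; exact: cmodB.
Qed.
Lemma mnrmZ m (c : C) (Y : 'M[C]_(d, m)) : mnrm (c *: Y) = cmod c * mnrm Y.
Proof.
rewrite /mnrm mulr_sumr; apply: eq_bigr => i _; rewrite mulr_sumr; apply: eq_bigr => j _.
by rewrite mxE cmodM.
Qed.
Lemma mnrm0 m : mnrm (0 : 'M[C]_(d, m)) = 0.
Proof. by rewrite /mnrm big1 // => i _; rewrite big1 // => j _; rewrite mxE cmod0. Qed.

Definition psummable m (M : 'M[C]_d) (X : 'M[C]_(d, m)) :=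
  exists B : R, forall N, \sum_(0 <= n < N) mnrm (iter n (mulmx M) X) <= B.

Lemma iter_mulmxB m (M : 'M[C]_d) (X Y : 'M[C]_(d, m)) n :
  iter n (mulmx M) (X - Y) = iter n (mulmx M) X - iter n (mulmx M) Y.
Proof. by elim: n => //= n ->; rewrite mulmxBr. Qed.

Lemma iter_mulmxZ m (M : 'M[C]_d) (c : C) (X : 'M[C]_(d, m)) n :
  iter n (mulmx M) (c *: X) = c *: iter n (mulmx M) X.
Proof. by elim: n => //= n ->; rewrite scalemxAr. Qed.

(* With [Y = A X - lam X] and [M = A^-1], [lam M^(n+1) X = M^n X - M^(n+1) Y]: each eigenvalue
   of modulus > 1 is removed by one geometric summation. *)
Lemma psummable_step m (M A : 'M[C]_d) (lam : C) (X : 'M[C]_(d, m)) :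
  M *m A = 1%:M -> 1 < cmod lam -> psummable M (A *m X - lam *: X) -> psummable M X.
Proof.
move=> MA l1 [B hB]; set Y := A *m X - lam *: X in hB.
pose a n := mnrm (iter n (mulmx M) X); pose b n := mnrm (iter n (mulmx M) Y).
have a0 n : 0 <= a n by exact: mnrm_ge0.
have b0 n : 0 <= b n by exact: mnrm_ge0.
have rec n : cmod lam * a n.+1 <= a n + b n.+1.
  rewrite /a -mnrmZ (_ : lam *: _ = iter n (mulmx M) X - iter n.+1 (mulmx M) Y).
    exact: mnrmB.
  rewrite /Y iter_mulmxB iter_mulmxZ [iter n.+1 _ (A *m X)]iterSr mulmxA MA mul1mx.
  by rewrite opprB addrC subrK.
set l := cmod lam in rec l1.
have l0 : 0 < l - 1 by rewrite subr_gt0.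
exists ((l * a 0 + B) / (l - 1)) => N.
have key : l * \sum_(0 <= n < N) a n <= l * a 0 + \sum_(0 <= n < N) a n + \sum_(0 <= n < N) b n.
  case: N => [|N]; first by rewrite !big_geq // mulr0 !addr0 mulr_ge0 // ltW // (lt_trans _ l1).
  rewrite [X in l * X]big_nat_recl // mulrDr -addrA lerD2l.
  apply: (@le_trans _ _ (\sum_(0 <= n < N) (a n + b n.+1))).
    by rewrite mulr_sumr; apply: ler_sum.
  rewrite big_split lerD //; first by rewrite big_nat_recr //= lerDl.
  by rewrite [X in _ <= X]big_nat_recl //= lerDr.
rewrite ler_pdivlMr // mulrBr mulr1 mulrC lerBlDr.
apply: le_trans key _; have := hB N; rewrite -/b; lra.
Qed.

End MatrixPowers.

(** By Cayley-Hamilton the product of all factors [A - z] over the eigenvalues is zero, for which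
    summability is trivial; [psummable_step] then strips the factors one by one until the identity
    matrix is left. *)
Lemma psummable_expansive (R : realType) d (M A : 'M[R[i]]_d) :
  M *m A = 1%:M -> (forall z : R[i], root (char_poly A) z -> 1 < `|z|) ->
  psummable M (1%:M : 'M[R[i]]_d).
Proof.
case: d M A => [|d] M A MA hz.
  exists 0 => N; rewrite big1 // => n _; rewrite /mnrm big1 // => -[] //.
have [s sE] := closed_field_poly_normal (char_poly A).
have mp := char_poly_monic A; rewrite (monicP mp) scale1r in sE.
have hs z : z \in s -> 1 < cmod z.
  move=> zs; have : root (char_poly A) z by rewrite sE root_prod_XsubC.
  by move/hz; rewrite normc_cmod ltcE /= => /andP[].
have CH : horner_mx A (\prod_(z <- s) ('X - z%:P)) = 0 by rewrite -sE Cayley_Hamilton.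
suff H (t : seq R[i]) : (forall z, z \in t -> 1 < cmod z) ->
    psummable M (horner_mx A (\prod_(z <- t) ('X - z%:P))) -> psummable M (1%:M : 'M[R[i]]_d.+1).
  apply: (H s hs); rewrite CH; exists 0 => N; rewrite big1 // => n _.
  by rewrite (_ : iter n _ 0 = 0) ?mnrm0 //; elim: n => //= n ->; rewrite mulmx0.
elim: t => [_|z t IH ht]; first by rewrite big_nil rmorph1.
rewrite big_cons rmorphM rmorphB /= horner_mx_X horner_mx_C => h.
apply: IH => [w wt|]; first by apply: ht; rewrite inE wt orbT.
apply: (psummable_step MA (ht z _)); first by rewrite inE eqxx.
by move: h; rewrite -mulmxE mulmxBl mul_scalar_mx.
Qed.

Section RealPowers.
Variables (R : realType) (d : nat).

Definition rnrm m (Y : 'M[R]_(d, m)) : R := \sum_i \sum_j `|Y i j|.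
Definition mpow (B : 'M[R]_d) n : 'M[R]_d := iter n (mulmx B) 1%:M.

Lemma rnrm_ge0 m (Y : 'M[R]_(d, m)) : 0 <= rnrm Y.
Proof. by apply: sumr_ge0 => i _; apply: sumr_ge0. Qed.

Lemma iter_mpow (B : 'M[R]_d) m (v : 'M[R]_(d, m)) n : iter n (mulmx B) v = mpow B n *m v.
Proof. by elim: n => [|n IH] /=; rewrite /mpow ?mul1mx //= IH mulmxA. Qed.

Lemma mpowSr (B : 'M[R]_d) n : mpow B n.+1 = mpow B n *m B.
Proof. by rewrite /mpow iterSr iter_mpow mulmx1. Qed.

Lemma mpow_tr (B : 'M[R]_d) n : (mpow B n)^T = mpow B^T n.
Proof. by elim: n => [|n IH]; rewrite ?trmx1 // mpowSr trmx_mul IH. Qed.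

Lemma mpow_conj (S B S' : 'M[R]_d) n : S' *m S = 1%:M -> S *m S' = 1%:M ->
  mpow (S *m B *m S') n = S *m mpow B n *m S'.
Proof.
move=> h h'; elim: n => [|n IH]; first by rewrite /mpow /= mulmx1.
by rewrite {1}/mpow iterS -/(mpow _ n) IH !mulmxA -(mulmxA _ S' S) h mulmx1.
Qed.

Lemma rnrmM m (Y : 'M[R]_d) (Z : 'M[R]_(d, m)) : rnrm (Y *m Z) <= rnrm Y * rnrm Z.
Proof.
rewrite /rnrm mulr_suml; apply: ler_sum => i _.
apply: (@le_trans _ _ (\sum_j \sum_k `|Y i k| * `|Z k j|)).
  apply: ler_sum => j _; rewrite mxE; apply: le_trans (ler_norm_sum _ _ _) _.
  by apply: ler_sum => k _; rewrite normrM.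
rewrite exchange_big /= mulr_suml; apply: ler_sum => k _; rewrite -mulr_sumr ler_wpM2l //.
rewrite [X in _ <= X](bigD1 k) //= lerDl; apply: sumr_ge0 => j _; exact: sumr_ge0.
Qed.

Lemma rnrm_tr (Y : 'M[R]_d) : rnrm Y^T = rnrm Y.
Proof. by rewrite /rnrm exchange_big; do 2 (apply: eq_bigr => ? _); rewrite mxE. Qed.

(** The form in which expansiveness is used: the sum controls the infinite product, and the decay of
    the terms drives both limits in the scale. *)
Definition pow_summable (B : 'M[R]_d) :=
  exists K : R, 0 <= K /\ forall N, \sum_(0 <= n < N) rnrm (mpow B n) <= K.

Lemma pow_summable_conj (S B S' : 'M[R]_d) : S' *m S = 1%:M -> S *m S' = 1%:M ->
  pow_summable B -> pow_summable (S *m B *m S').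
Proof.
move=> h h' [K [K0 hK]]; exists (rnrm S * rnrm S' * K); split.
  by rewrite !mulr_ge0 // rnrm_ge0.
move=> N; apply: (@le_trans _ _ (\sum_(0 <= n < N) (rnrm S * rnrm S') * rnrm (mpow B n))).
  apply: ler_sum => n _; rewrite mpow_conj //.
  apply: le_trans (rnrmM _ _) _; rewrite mulrAC ler_wpM2r ?rnrm_ge0 //; exact: rnrmM.
by rewrite -mulr_sumr ler_wpM2l // mulr_ge0 // rnrm_ge0.
Qed.

Lemma pow_summable_tr (B : 'M[R]_d) : pow_summable B -> pow_summable B^T.
Proof.
move=> [K [K0 hK]]; exists K; split=> // N.
by under eq_bigr do rewrite -mpow_tr rnrm_tr.
Qed.

Lemma pow_summable_expansive (A : 'M[int]_d) : expansive R A -> \det A != 0 ->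
  pow_summable (invmx (mxR R A)).
Proof.
move=> eA dA; have uA : mxR R A \in unitmx.
  by rewrite unitmxE unitfE /mxR det_map_mx /= intr_eq0.
pose toC := real_complex R.
have MA : map_mx toC (invmx (mxR R A)) *m (map_mx (fun x : int => x%:~R) A : 'M[R[i]]_d) = 1%:M.
  have -> : (map_mx (fun x : int => x%:~R) A : 'M[R[i]]_d) = map_mx toC (mxR R A).
    by apply/matrixP => i j; rewrite !mxE; apply/esym; exact: (rmorph_int (real_complex R)).
  by rewrite -map_mxM mulVmx // map_mx1.
have [K hK] := psummable_expansive MA eA.
exists K; split; first by have := hK 0%N; rewrite big_geq.
move=> N; apply: le_trans (hK N); apply: ler_sum => n _.
rewrite le_eqVlt; apply/orP; left; apply/eqP; apply: eq_bigr => i _; apply: eq_bigr => j _.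
have -> : iter n (mulmx (map_mx toC (invmx (mxR R A)))) 1%:M = map_mx toC (mpow (invmx (mxR R A)) n).
  by elim: n => [|n IH] /=; [rewrite map_mx1|rewrite IH -map_mxM].
by rewrite mxE cmod_real.
Qed.

Lemma pow_summable_small (B : 'M[R]_d) : pow_summable B -> forall eps : R, 0 < eps ->
  exists N, forall n, (N <= n)%N -> rnrm (mpow B n) < eps.
Proof.
move=> [K [K0 hK]] eps ep0.
have cv : cvgn (series (fun n => rnrm (mpow B n))).
  apply: nondecreasing_is_cvgn.
    by apply/nondecreasing_seqP => n; rewrite /series /= big_nat_recr //= lerDl rnrm_ge0.
  by exists K => _ [n _ <-]; exact: hK.
have := cvg_series_cvg_0 cv => c0.
have [N _ hN] := cvgr_lt _ c0 _ ep0.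
by exists N => n Nn; exact: hN.
Qed.

End RealPowers.

(** * The infinite product *)

Section ProductEstimates.
Variable R : realType.
Local Notation C := (R[i]).

Lemma sin_norm_le (x : R) : `|sin x| <= `|x|.
Proof.
wlog x0 : x / 0 <= x.
  by move=> H; have [/H//|/ltW] := leP 0 x; rewrite -oppr_ge0 => /H; rewrite sinN !normrN.
have [c _] : exists2 c : R, c \in `[0, x]%R & sin x - sin 0 = cos c * (x - 0).
  apply: (@MVT_segment R (@sin R) (@cos R)) => //.
  by apply: continuous_subspaceT => y; exact: continuous_sin.
rewrite sin0 !subr0 => ->; rewrite normrM ler_piMl //; exact: cos_max.
Qed.

Lemma cmod_cexpiB1 (x : R) : cmod (cexpi x - 1) <= `|x|.
Proof.
rewrite -[leRHS]sqrtr_sqr /cmod ler_sqrt ?sqr_ge0 // /cabs2 cReD cImD cReN cImN /=.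
have -> : cos x = 1 - 2 * sin (x / 2) ^+ 2.
  have := cos2Dsin2 (x / 2) => h; rewrite [in LHS](splitr x) cosD -!expr2; lra.
have E : sin x ^+ 2 = 4 * sin (x / 2) ^+ 2 * cos (x / 2) ^+ 2.
  by rewrite [in LHS](splitr x) sinD; ring.
have h : sin (x / 2) ^+ 2 <= (x / 2) ^+ 2.
  rewrite -[leLHS]real_normK ?num_real // -[leRHS]real_normK ?num_real //.
  by rewrite lerXn2r ?nnegrE //; exact: sin_norm_le.
have := cos2Dsin2 (x / 2) => h2; rewrite oppr0 addr0 E.
set s := sin (x / 2) ^+ 2 in h h2 *; set c := cos (x / 2) ^+ 2 in h2 *.
have -> : c = 1 - s by lra.
have -> : (1 - 2 * s - 1) ^+ 2 + 4 * s * (1 - s) = 4 * s by ring.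
move: h; rewrite expr_div_n; lra.
Qed.

(** Expanding [z P - 1] in terms of [z - 1] and [P - 1] reduces the induction step to
    [1 + x <= exp x]. *)
Lemma prod_sub1 (I : Type) (s : seq I) (z : I -> C) (x : I -> R) :
  (forall i, cmod (z i - 1) <= x i) ->
  cmod (\prod_(i <- s) z i - 1) <= expR (\sum_(i <- s) x i) - 1.
Proof.
move=> hz; have x0 i : 0 <= x i by exact: le_trans (cmod_ge0 _) (hz i).
elim: s => [|i s IH]; first by rewrite !big_nil subrr cmod0 expR0 subrr.
rewrite !big_cons expRD.
set P := \prod_(j <- s) z j in IH *; set Q := expR (\sum_(j <- s) x j) in IH *.
have -> : z i * P - 1 = (z i - 1) * (P - 1) + (z i - 1) + (P - 1) by ring.
apply: le_trans (cmodD _ _) _; apply: le_trans (lerD (cmodD _ _) (lexx _)) _.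
rewrite cmodM.
have h1 : cmod (z i - 1) * cmod (P - 1) <= x i * (Q - 1) by rewrite ler_pM // cmod_ge0.
have h2 : x i * (Q - 1) + x i + (Q - 1) = (1 + x i) * Q - 1 by ring.
have h3 : (1 + x i) * Q <= expR (x i) * Q by rewrite ler_wpM2r ?expR_ge0 ?expR_ge1Dx.
have := hz i; lra.
Qed.

Lemma cmod_cvg (u : nat -> C) (l : C) :
  (fun n => complex.Re (u n)) @ \oo --> complex.Re l ->
  (fun n => complex.Im (u n)) @ \oo --> complex.Im l ->
  (fun n => cmod (u n)) @ \oo --> cmod l.
Proof.
move=> h1 h2; apply: (@cvg_comp _ _ _ (fun n => cabs2 (u n)) (@Num.sqrt R)); last exact: sqrt_continuous.
by apply: cvgD; rewrite /GRing.exp /=; apply: cvgM.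
Qed.

Lemma cvg_csub (u : nat -> C) (l c : C) :
  (fun n => complex.Re (u n)) @ \oo --> complex.Re l ->
  (fun n => complex.Im (u n)) @ \oo --> complex.Im l ->
  (fun n => cmod (u n - c)) @ \oo --> cmod (l - c).
Proof.
move=> h1 h2; apply: cmod_cvg.
  by under eq_fun do rewrite cReD cReN; rewrite cReD cReN; apply: cvgB => //; exact: cvg_cst.
by under eq_fun do rewrite cImD cImN; rewrite cImD cImN; apply: cvgB => //; exact: cvg_cst.
Qed.

End ProductEstimates.

Section InfiniteProduct.
Variables (R : realType) (d : nat).
Local Notation C := (R[i]).
Local Notation T := (cvT R d).
Variables (B : 'M[R]_d) (N : nat) (h : 'cV[int]_d -> C).
Hypothesis hB : pow_summable B.
Hypothesis hsum : \sum_(f : {ffun 'I_d -> 'I_(N.*2.+1)}) h (boxv f) = sqrt2C R.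
Local Notation m := (m0 N h).
Local Notation c := (c2pi R d).

Lemma sqrt2C_neq0 : sqrt2C R != 0.
Proof.
by apply/eqP => -[] /eqP; rewrite sqrtr_eq0 leNgt ltr0n.
Qed.

Lemma dotR_le (x y : 'cV[R]_d) : `|dotR x y| <= rnrm x * rnrm y.
Proof.
have e (z : 'cV[R]_d) : rnrm z = \sum_i `|z i 0| by apply: eq_bigr => i _; rewrite big_ord1.
rewrite !e mulr_suml; apply: le_trans (ler_norm_sum _ _ _) _; apply: ler_sum => i _.
rewrite normrM ler_wpM2l // [leRHS](bigD1 i) //= lerDl; exact: sumr_ge0.
Qed.

Definition m0lip : R := cmod (sqrt2C R)^-1 *
  \sum_(f : {ffun 'I_d -> 'I_(N.*2.+1)}) cmod (h (boxv f)) * rnrm (cvR R (boxv f)).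

Lemma m0lip_ge0 : 0 <= m0lip.
Proof.
by rewrite mulr_ge0 ?cmod_ge0 // sumr_ge0 // => f _; rewrite mulr_ge0 ?cmod_ge0 ?rnrm_ge0.
Qed.

(** [hsum] says that [m0] equals 1 at the origin; the exponentials are Lipschitz. *)
Lemma m0_sub1 (t : 'cV[R]_d) : cmod (m t - 1) <= m0lip * rnrm t.
Proof.
have -> : m t - 1 = (sqrt2C R)^-1 * \sum_(f : {ffun 'I_d -> 'I_(N.*2.+1)})
    h (boxv f) * (cexpi (- dotR (cvR R (boxv f)) t) - 1).
  under eq_bigr do rewrite mulrBr mulr1.
  by rewrite sumrB hsum mulrBr mulVf // sqrt2C_neq0.
rewrite cmodM /m0lip -mulrA ler_wpM2l ?cmod_ge0 // mulr_suml.
apply: le_trans (cmod_sum _ _) _; apply: ler_sum => f _.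
rewrite cmodM -mulrA ler_wpM2l ?cmod_ge0 //.
apply: le_trans (cmod_cexpiB1 _) _; rewrite normrN; exact: dotR_le.
Qed.

Lemma cmeas_m0 : cmeas (m : T -> C).
Proof.
apply: cmeasZ; apply: cmeas_sum => f; apply: cmeasZ; apply: cmeas_cexpi.
by apply: measurable_funN; exact: measurable_dotR.
Qed.

Definition gprod J (xi : 'cV[R]_d) : C := c * \prod_(1 <= j < J.+1) m (iter j (mulmx B) xi).

Variable g : 'cV[R]_d -> C.
Hypothesis gre : forall xi, (fun J => complex.Re (gprod J xi)) @ \oo --> complex.Re (g xi).
Hypothesis gim : forall xi, (fun J => complex.Im (gprod J xi)) @ \oo --> complex.Im (g xi).

(** The estimate is uniform in the number of factors, by summability of the powers, and passes to
    the limit. It contains both the continuity of [g] at the origin and its local boundedness. *)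
Lemma infprod_bound : exists K : R, 0 <= K /\
  forall xi, cmod (g xi - c) <= cmod c * (expR (K * rnrm xi) - 1).
Proof.
have [K [K0 hK]] := hB; exists (m0lip * K); split; first by rewrite mulr_ge0 ?m0lip_ge0.
move=> xi.
have cv := @cvg_csub R (fun J => gprod J xi) (g xi) c (@gre xi) (@gim xi).
rewrite -(cvg_lim _ cv) //; apply: limr_le; first by apply/cvg_ex; eexists; exact: cv.
near=> J; rewrite /gprod -[X in _ - X]mulr1 -mulrBr cmodM ler_wpM2l ?cmod_ge0 //.
apply: le_trans (prod_sub1 _ (fun j => m0_sub1 _)) _.
rewrite lerD2r ler_expR -mulr_sumr -(mulrA m0lip K); apply: (ler_wpM2l m0lip_ge0).
apply: (@le_trans _ _ (\sum_(1 <= j < J.+1) rnrm (mpow B j) * rnrm xi)).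
  by apply: ler_sum => j _; rewrite iter_mpow; exact: rnrmM.
rewrite -mulr_suml ler_wpM2r ?rnrm_ge0 //; apply: le_trans (hK J.+1).
by rewrite [leRHS]big_nat_recl // [leLHS]big_add1 lerDr rnrm_ge0.
Unshelve. all: by end_near. Qed.

Lemma rnrm_mpow_le : exists K : R, 0 <= K /\ forall n, rnrm (mpow B n) <= K.
Proof.
have [K [K0 hK]] := hB; exists K; split=> // n; apply: le_trans (hK n.+1).
by rewrite big_nat_recr //= lerDr sumr_ge0 // => i _; exact: rnrm_ge0.
Qed.

Lemma rnrm_cube (K : R) (v : T) : cube d K v -> rnrm (v : 'cV[R]_d) <= d%:R * K.
Proof.
move=> hv; apply: (@le_trans _ _ (\sum_(i < d) K)).
  by apply: ler_sum => i _; rewrite big_ord1; exact: hv.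
by rewrite sumr_const card_ord mulr_natl.
Qed.

Lemma infprod_cvg (xi : T) : (fun n => cabs2 (g (mpow B n *m xi))) @ \oo --> cabs2 c.
Proof.
have [K [K0 hK]] := infprod_bound.
suff cv : (fun n => cmod (g (mpow B n *m xi))) @ \oo --> cmod c.
  by under eq_fun do rewrite cabs2_cmod; rewrite cabs2_cmod /GRing.exp /=; apply: cvgM.
have cb : (fun n => cmod c * (expR (K * (rnrm (mpow B n) * rnrm xi)) - 1)) @ \oo --> (0 : R).
  have c0 : (fun n => rnrm (mpow B n)) @ \oo --> (0 : R).
    apply/cvgrPdist_lt => ep ep0; have [M hM] := pow_summable_small hB ep0.
    exists M => // n /= Mn; rewrite sub0r normrN ger0_norm ?rnrm_ge0 //; exact: hM.
  rewrite -[X in _ --> X](mulr0 (cmod c)); apply: cvgMr.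
  rewrite -[X in _ --> X](subrr 1); apply: cvgB; last exact: cvg_cst.
  rewrite -[X in _ --> X]expR0; apply: (@cvg_comp _ _ _ (fun n => K * (rnrm (mpow B n) * rnrm xi)) (@expR R)); last exact: continuous_expR.
  have cK : (fun n => K * (rnrm (mpow B n) * rnrm xi)) @ \oo --> K * (0 * rnrm xi).
    by apply: cvgMr; apply: cvgMl.
  by move: cK; rewrite mul0r mulr0.
apply/cvgrPdist_le => ep ep0; have [M _ hM] := cvgr_lt _ cb _ ep0.
exists M => // n /= Mn; apply: le_trans (ltW (hM n Mn)).
have h1 : cmod (g (mpow B n *m xi) - c) <= cmod c * (expR (K * (rnrm (mpow B n) * rnrm xi)) - 1).
  apply: le_trans (hK _) _; rewrite ler_wpM2l ?cmod_ge0 // lerD2r ler_expR ler_wpM2l //; exact: rnrmM.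
apply: le_trans h1.
have := cmodD (g (mpow B n *m xi) - c) c; rewrite subrK => h2.
have := cmodB (g (mpow B n *m xi)) (g (mpow B n *m xi) - c); rewrite opprB addrC subrK => h3.
by rewrite ler_norml; apply/andP; split; lra.
Qed.

(** The bound does not depend on [n], because the powers of [B] are bounded; it provides the
    dominating function in [level_energy_cvg]. *)
Lemma infprod_bounded (K : R) : 0 <= K -> exists M, 0 <= M /\
  forall n (xi : T), cube d K xi -> cabs2 (g (mpow B n *m xi)) <= M ^+ 2.
Proof.
move=> K0; have [L [L0 hL]] := infprod_bound; have [P [P0 hP]] := rnrm_mpow_le.
exists (cmod c * expR (L * (P * (d%:R * K)))); split; first by rewrite mulr_ge0 ?cmod_ge0 ?expR_ge0.
move=> n xi hxi; rewrite cabs2_cmod lerXn2r ?nnegrE ?cmod_ge0 //.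
  by rewrite mulr_ge0 ?cmod_ge0 ?expR_ge0.
have := cmodD (g (mpow B n *m xi) - c) c; rewrite subrK => /le_trans; apply.
apply: le_trans (lerD (hL _) (lexx _)) _; rewrite mulrBr mulr1 subrK.
rewrite ler_wpM2l ?cmod_ge0 // ler_expR ler_wpM2l //.
apply: le_trans (rnrmM _ _) _; rewrite ler_pM ?rnrm_ge0 //; exact: rnrm_cube.
Qed.

Lemma cmeas_infprod : cmeas (g : T -> C).
Proof.
have mp J : cmeas (gprod J : T -> C).
  apply: cmeasZ; apply: cmeas_prod => j; apply: (cmeas_comp cmeas_m0).
  rewrite (_ : iter j _ = mulmx (mpow B j)); last by apply/funext => v; rewrite iter_mpow.
  exact: measurable_mulmx.
split.
  by apply: (@measurable_fun_cvg _ T R setT (fun J x => complex.Re (gprod J x)) (fun x => complex.Re (g x))) => [J|x _]; [case: (mp J)|exact: gre].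
by apply: (@measurable_fun_cvg _ T R setT (fun J x => complex.Im (gprod J x)) (fun x => complex.Im (g x))) => [J|x _]; [case: (mp J)|exact: gim].
Qed.

(** The refinement equation on the Fourier side: split off the first factor and shift the
    product. *)
Lemma infprod_refine xi : g xi = m (B *m xi) * g (B *m xi).
Proof.
have E J : gprod J.+1 xi = m (B *m xi) * gprod J (B *m xi).
  rewrite /gprod mulrCA; congr (_ * _); rewrite big_nat_recl //=; congr (_ * _).
  by rewrite big_add1 /= [RHS]big_add1 /=; apply: eq_bigr => j _; rewrite -iterSr.
have re : (fun J => complex.Re (gprod J.+1 xi)) @ \oo --> complex.Re (g xi).
  by rewrite (cvg_shiftS (fun J => complex.Re (gprod J xi))); exact: gre.
have im : (fun J => complex.Im (gprod J.+1 xi)) @ \oo --> complex.Im (g xi).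
  by rewrite (cvg_shiftS (fun J => complex.Im (gprod J xi))); exact: gim.
apply: c_ext.
  rewrite -(cvg_lim _ re) //; apply: cvg_lim => //.
  under eq_fun do rewrite E cReM; rewrite cReM.
  by apply: cvgB; apply: cvgMr; [exact: gre|exact: gim].
rewrite -(cvg_lim _ im) //; apply: cvg_lim => //.
under eq_fun do rewrite E cImM; rewrite cImM.
by apply: cvgD; apply: cvgMr; [exact: gim|exact: gre].
Qed.

End InfiniteProduct.

(** * Dilations and translations *)

Section Isometries.
Context dd (T : measurableType dd) (R : realType) (mu : {measure set T -> \bar R}).
Local Notation C := (R[i]).

(** Polarization for linear isometries; for dilations, translations and the change of lattice only
    the preservation of norms then has to be checked. *)
Lemma ip_isometry (U : (T -> C) -> T -> C) :
  (forall f g x, U (fun y => f y + g y) x = U f x + U g x) ->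
  (forall (c : C) f x, U (fun y => c * f y) x = c * U f x) ->
  (forall f, L2 mu f -> L2 mu (U f)) -> (forall f, L2 mu f -> n2 mu (U f) = n2 mu f) ->
  forall f g, L2 mu f -> L2 mu g -> ip mu (U f) (U g) = ip mu f g.
Proof.
move=> UD UZ UL UN.
have key f g : L2 mu f -> L2 mu g -> complex.Re (ip mu (U f) (U g)) = complex.Re (ip mu f g).
  move=> lf lg; have : Nm mu (U (fun y => f y + g y)) = Nm mu (fun y => f y + g y).
    by rewrite /Nm UN //; exact: L2D.
  rewrite (_ : U _ = (fun x => U f x + U g x)); last by apply/funext => x.
  by rewrite !NmD; do ?exact: UL; rewrite /Nm ?UN //; lra.
move=> f g lf lg; apply: c_ext; first exact: key.
have := key _ _ (L2Z (Complex 0 (-1)) lf) lg.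
rewrite (_ : U _ = (fun v => Complex 0 (-1) * U f v)); last by apply/funext => x.
rewrite (ipZl _ (UL _ lf) (UL _ lg)) (ipZl _ lf lg).
by rewrite !cReM /=; lra.
Qed.

End Isometries.

Section Dilations.
Variables (R : realType) (d : nat).
Local Notation C := (R[i]).
Local Notation T := (cvT R d).
Local Notation mu := (@muT R d).
Local Notation cmeasT := (@cmeas _ T R).
Variable B : 'M[int]_d.
Hypothesis hdet : \det B = 2 \/ \det B = -2.
Local Notation M := (mxR R B).
Local Notation s := (sqrt2C R).
Implicit Types (f g G : T -> C).

Lemma det_mxR (B' : 'M[int]_d) : \det (mxR R B') = (\det B')%:~R.
Proof. by rewrite /mxR det_map_mx. Qed.

Lemma norm_det_mxR : `|\det M| = 2.
Proof. by rewrite det_mxR; case: hdet => ->; rewrite ?rmorphN /= ?normrN ger0_norm // ler0n. Qed.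

Lemma det_mxR_neq0 : \det M != 0.
Proof. by rewrite -normr_eq0 norm_det_mxR pnatr_eq0. Qed.

Lemma unit_mxR : M \in unitmx.
Proof. by rewrite unitmxE unitfE det_mxR_neq0. Qed.

Lemma sqrt2C_sqr : s * s = Complex 2 0.
Proof.
apply: c_ext; rewrite ?cReM ?cImM /=; last by rewrite mul0r mulr0 addr0.
by rewrite mulr0 subr0 -expr2 sqr_sqrtr.
Qed.

Lemma cabs2_sqrt2C : cabs2 s = 2.
Proof. by rewrite cabs2_real sqr_sqrtr. Qed.

Lemma cmeas_comp_mulmx (P : 'M[R]_d) f : cmeasT f -> cmeasT (fun t : T => f (P *m t)).
Proof. by move=> mf; apply: (cmeas_comp mf); exact: measurable_mulmx. Qed.

Lemma n2_dil f : cmeasT f -> n2 mu (dil B f) = n2 mu f.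
Proof.
move=> mf; rewrite /dil n2Z; last exact: cmeas_comp_mulmx.
by rewrite cabs2_sqrt2C -norm_det_mxR n2_cov // det_mxR_neq0.
Qed.

Lemma dilK f : dil B (dilinv B f) = f.
Proof.
apply/funext => t; rewrite /dil /dilinv mulKmx ?unit_mxR //.
by rewrite mulrC divfK // sqrt2C_neq0.
Qed.

Lemma dilinvK f : dilinv B (dil B f) = f.
Proof.
apply/funext => t; rewrite /dil /dilinv mulKVmx ?unit_mxR //.
by rewrite mulrC mulKf // sqrt2C_neq0.
Qed.

Lemma cmeas_dil f : cmeasT f -> cmeasT (dil B f).
Proof. by move=> mf; apply: cmeasZ; exact: cmeas_comp_mulmx. Qed.

Lemma cmeas_dilinv f : cmeasT f -> cmeasT (dilinv B f).
Proof.
move=> mf; rewrite /dilinv; under eq_fun do rewrite mulrC.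
by apply: cmeasZ; exact: cmeas_comp_mulmx.
Qed.

Lemma L2_dil f : L2 mu f -> L2 mu (dil B f).
Proof. by move=> [mf ff]; split; [exact: cmeas_dil|rewrite n2_dil]. Qed.

Lemma n2_dilinv f : cmeasT f -> n2 mu (dilinv B f) = n2 mu f.
Proof. by move=> mf; rewrite -[in RHS](dilK f) n2_dil //; exact: cmeas_dilinv. Qed.

Lemma L2_dilinv f : L2 mu f -> L2 mu (dilinv B f).
Proof. by move=> [mf ff]; split; [exact: cmeas_dilinv|rewrite n2_dilinv]. Qed.

Lemma ip_dil f g : L2 mu f -> L2 mu g -> ip mu (dil B f) (dil B g) = ip mu f g.
Proof.
apply: (@ip_isometry _ _ _ mu (dil B)).
- by move=> ? ? ?; rewrite /dil mulrDr.
- by move=> ? ? ?; rewrite /dil mulrCA.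
- exact: L2_dil.
- by move=> u []; move=> mu' _; exact: n2_dil.
Qed.

Lemma ip_iter_dil k f g : L2 mu f -> L2 mu g ->
  ip mu f (iter k (dil B) g) = ip mu (iter k (dilinv B) f) g.
Proof.
elim: k f => //= k IH f lf lg; rewrite -[in LHS](dilK f) ip_dil; last 2 first.
- exact: L2_dilinv.
- by elim: k {IH} => //= k; exact: L2_dil.
by rewrite IH -?iterSr //; exact: L2_dilinv.
Qed.

Lemma ip_iter_dilinv k f g : L2 mu f -> L2 mu g ->
  ip mu f (iter k (dilinv B) g) = ip mu (iter k (dil B) f) g.
Proof.
elim: k f => //= k IH f lf lg; rewrite -ip_dil //; last first.
  by apply: L2_dilinv; elim: k {IH} => //= k; exact: L2_dilinv.
by rewrite dilK IH -?iterSr //; exact: L2_dil.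
Qed.

Lemma cvRD (k l : 'cV[int]_d) : cvR R (k + l) = cvR R k + cvR R l.
Proof. by apply/matrixP => i j; rewrite !mxE intrD. Qed.
Lemma cvRN (l : 'cV[int]_d) : cvR R (- l) = - cvR R l.
Proof. by apply/matrixP => i j; rewrite !mxE rmorphN. Qed.
Lemma cvRM (P : 'M[int]_d) (l : 'cV[int]_d) : cvR R (P *m l) = mxR R P *m cvR R l.
Proof. exact: map_mxM. Qed.

Lemma cmeas_transl l f : cmeasT f -> cmeasT (transl l f).
Proof. by move=> mf; apply: (cmeas_comp mf); exact: measurable_translate. Qed.

Lemma n2_transl l f : cmeasT f -> n2 mu (transl l f) = n2 mu f.
Proof. exact: n2_translate. Qed.

Lemma L2_transl l f : L2 mu f -> L2 mu (transl l f).
Proof. by move=> [mf ff]; split; [exact: cmeas_transl|rewrite n2_transl]. Qed.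

Lemma translD k l f : transl k (transl l f) = transl (k + l) f.
Proof. by apply/funext => t; rewrite /transl cvRD opprD addrA. Qed.

Lemma transl0 f : transl 0 f = f.
Proof.
apply/funext => t; rewrite /transl (_ : cvR R 0 = 0) ?subr0 //.
by apply/matrixP => i j; rewrite !mxE.
Qed.

Lemma ip_transl l f g : L2 mu f -> L2 mu g -> ip mu f (transl l g) = ip mu (transl (- l) f) g.
Proof.
move=> lf lg; rewrite -[in LHS](transl0 f) -(subrr l) -translD.
apply: (@ip_isometry _ _ _ mu (transl l)) => //.
- by move=> u; exact: L2_transl.
- by move=> u [mu' _]; exact: n2_transl.
- exact: L2_transl.
Qed.

Lemma transl_dil l f : transl l (dil B f) = dil B (transl (B *m l) f).
Proof. by apply/funext => t; rewrite /transl /dil cvRM mulmxBr. Qed.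

Lemma dilzS n f : dilz B (n + 1) f = dilz B n (dil B f).
Proof.
case: n => [k|[|k]] /=; first by rewrite addn1 -iterSr.
  by rewrite dilinvK.
by rewrite subn1 -[in RHS]iterS [in RHS]iterSr dilinvK.
Qed.

(** A form common to powers of both signs, from which linearity and measurability are immediate. *)
Lemma dilz_closed n : exists (c : C) (P : 'M[R]_d), forall f t, dilz B n f t = c * f (P *m t).
Proof.
have it (D : (T -> C) -> T -> C) (c : C) (P : 'M[R]_d) k : (forall f t, D f t = c * f (P *m t)) ->
    exists (c : C) (P : 'M[R]_d), forall f t, iter k D f t = c * f (P *m t).
  move=> h; elim: k => [|k [c' [P' IH]]]; first by exists 1, 1%:M => f t; rewrite mul1r mul1mx.
  by exists (c * c'), (P' *m P) => f t; rewrite iterS h IH mulrA mulmxA.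
case: n => k /=; first exact: it.
by apply: (it (dilinv B) s^-1 (invmx M) k.+1) => f t; rewrite /dilinv mulrC.
Qed.

Lemma dilz_sum n I (r : seq I) (a : I -> C) (F : I -> T -> C) t :
  dilz B n (fun x => \sum_(i <- r) a i * F i x) t = \sum_(i <- r) a i * dilz B n (F i) t.
Proof.
have [c [P h]] := dilz_closed n; rewrite h mulr_sumr; apply: eq_bigr => i _.
by rewrite h mulrCA.
Qed.

Lemma dilzB n f g t : dilz B n (fun x => f x - g x) t = dilz B n f t - dilz B n g t.
Proof. by have [c [P h]] := dilz_closed n; rewrite !h mulrBr. Qed.

Lemma cmeas_dilz n f : cmeasT f -> cmeasT (dilz B n f).
Proof.
move=> mf; have [c [P h]] := dilz_closed n; rewrite (_ : dilz B n f = (fun t => c * f (P *m t))).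
  by apply: cmeasZ; exact: cmeas_comp_mulmx.
by apply/funext => t; rewrite h.
Qed.

Lemma n2_dilz n f : cmeasT f -> n2 mu (dilz B n f) = n2 mu f.
Proof.
move=> mf; have m1 k : cmeasT (iter k (dil B) f) by elim: k => //= k; exact: cmeas_dil.
have m2 k : cmeasT (iter k (dilinv B) f) by elim: k => //= k; exact: cmeas_dilinv.
case: n => k /=; last rewrite n2_dilinv //.
  by elim: k => //= k <-; exact: n2_dil.
by elim: k => //= k <-; exact: n2_dilinv.
Qed.

Lemma L2_dilz n f : L2 mu f -> L2 mu (dilz B n f).
Proof. by move=> [mf ff]; split; [exact: cmeas_dilz|rewrite n2_dilz]. Qed.

Lemma Nice_mul (P : 'M[R]_d) G : P \in unitmx -> Nice G -> Nice (fun v => G (P *m v)).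
Proof. by move=> uP [L [K nG]]; have [K' nG'] := nice_mul uP nG; exists L, K'. Qed.

Lemma Nice_cexpi (F : T -> R) G : measurable_fun setT F -> Nice G -> Nice (fun v => cexpi (F v) * G v).
Proof. by move=> mF [L [K nG]]; exists L, K; exact: nice_cexpi. Qed.

Lemma unit_trmxR : M^T \in unitmx.
Proof. by rewrite unitmx_tr unit_mxR. Qed.

(** The change of variables by [M^T] produces the determinant 2, and dividing by the square root of
    2 leaves the factor [s]. *)
Lemma dilinv_invF G : Nice G -> dilinv B (invF G) = invF (fun xi => s * G (M^T *m xi)).
Proof.
move=> nG; have [L [K nG']] := nG; apply/funext => t; rewrite /dilinv.
rewrite invFZ; last exact: Nice_mul unit_trmxR nG.
rewrite -(invF_mul _ unit_trmxR nG') trmxK det_tr norm_det_mxR mulKVmx ?unit_mxR //.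
by rewrite -sqrt2C_sqr -(mulrA s s) mulrAC mulfV ?mul1r // sqrt2C_neq0.
Qed.

Lemma unit_mpow (P : 'M[R]_d) k : P \in unitmx -> mpow P k \in unitmx.
Proof. by move=> uP; elim: k => [|k IH]; rewrite ?unitmx1 // /mpow iterS unitmx_mul uP. Qed.

Lemma iter_dilinv_invF k G : Nice G ->
  iter k (dilinv B) (invF G) = invF (fun xi => s ^+ k * G (mpow M^T k *m xi)).
Proof.
move=> nG; elim: k => [|k IH].
  by congr invF; apply/funext => xi; rewrite mul1r mul1mx.
rewrite iterS IH dilinv_invF; last by apply: NiceZ; apply: Nice_mul => //; exact: unit_mpow unit_trmxR.
by congr invF; apply/funext => xi; rewrite mulrA exprS mpowSr mulmxA.
Qed.

Lemma transl_invF l G : transl (- l) (invF G) = invF (fun xi => cexpi (dotR (cvR R l) xi) * G xi).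
Proof.
apply/funext => t; rewrite /transl cvRN opprK; congr (_ * _); apply: eq_cI => xi.
by rewrite dotRDr cexpiD mulrA (dotRC (cvR R l)).
Qed.

End Dilations.

(** * The scaling function *)

Section ScalingFunction.
Variables (R : realType) (d : nat).
Local Notation C := (R[i]).
Local Notation T := (cvT R d).
Local Notation mu := (@muT R d).
Variables (A : 'M[int]_d) (N0 : nat) (h : 'cV[int]_d -> C) (g phi : T -> C).
Hypothesis hdet : \det A = 2 \/ \det A = -2.
Local Notation M := (mxR R A).
Local Notation B := (invmx (mxR R A^T)).
Local Notation s := (sqrt2C R).
Hypothesis hB : pow_summable B.
Hypothesis hsum : \sum_(f : {ffun 'I_d -> 'I_(N0.*2.+1)}) h (boxv f) = s.
Hypothesis hg : is_infprod_g A N0 h g.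
Hypothesis hphi : is_invFT g phi.
Implicit Types (f G H : T -> C).

Let gre xi : (fun J => complex.Re (gprod B N0 h J xi)) @ \oo --> complex.Re (g xi).
Proof. exact: (hg xi).1. Qed.
Let gim xi : (fun J => complex.Im (gprod B N0 h J xi)) @ \oo --> complex.Im (g xi).
Proof. exact: (hg xi).2. Qed.

Let mg : cmeas g := cmeas_infprod gre gim.

Lemma mxR_tr (P : 'M[int]_d) : mxR R P^T = (mxR R P)^T.
Proof. by rewrite /mxR map_trmx. Qed.

Lemma infprod_locally_bounded (K : R) : 0 <= K ->
  exists L, 0 <= L /\ forall xi : T, cube d K xi -> cabs2 (g xi) <= L ^+ 2.
Proof.
move=> K0; have [L [L0 hL]] := infprod_bounded hB hsum gre gim K0.
by exists L; split=> // xi hxi; have := hL 0%N xi hxi; rewrite mul1mx.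
Qed.

Definition gtrunc (N : nat) (xi : T) : C := Complex (\1_(cube d N%:R : set T) xi) 0 * g xi.

Lemma Nice_gtrunc N : Nice (gtrunc N).
Proof.
have [L [L0 hL]] := infprod_locally_bounded (ler0n R N).
exists L, N%:R; apply: niceP => //.
- apply: cmeasM => //; split => /=; [apply: measurable_indic; exact: measurable_cube|exact: measurable_cst].
- move=> v; rewrite /gtrunc indicE; case: (boolP (v \in cube d N%:R)).
    by rewrite inE => hv; rewrite mul1r; exact: hL.
  by rewrite mul0r cabs20 sqr_ge0.
- by move=> v nv; rewrite /gtrunc indicE memNset // mul0r.
Qed.

Lemma invFT_truncE N : invFT_trunc g N = invF (gtrunc N).
Proof.
apply/funext => t; rewrite /invFT_trunc /invF; congr (_ * _).
have [L [K nG]] := Nice_gtrunc N.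
rewrite -cintE; last exact: invF_cintble nG.
congr cint; apply/funext => xi; rewrite /gtrunc mulrA (mulrC (cexpi _)); congr (_ * _ * _).
rewrite indicE; case: ifP => [/forallP hx|hx].
  by rewrite mem_set.
rewrite memNset // => hc; move/negP: hx; apply; apply/forallP => j; exact: hc.
Qed.

Lemma L2_phi : L2 mu phi.
Proof. by apply/inL2P; case: hphi. Qed.

(** [phi] is linked to [g] only through truncated transforms. As [H] vanishes outside a cube, its
    pairing with [gtrunc N] equals its pairing with [g] as soon as [N] is at least [K]; Plancherel
    and the convergence of the truncations conclude. *)
Lemma ip_invF_phi H : Nice H -> ip mu (invF H) phi = ip mu H g.
Proof.
move=> nH; have lphi := L2_phi; have lH := L2_invF nH.
apply/eqP; rewrite -subr_eq0; apply/eqP; apply: cabs2_eq0.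
apply/eqP; rewrite eq_le cabs2_ge0 andbT; apply/ler_addgt0Pr => ep ep0; rewrite add0r.
have NH0 := Nm_ge0 mu (invF H).
have e0 : 0 < ep / (Nm mu (invF H) + 1) by rewrite divr_gt0 // ltr_wpDl.
have [_ /(_ _ e0) [N1 hN1]] := hphi.
have [L [K [_ _ _ _ [_ hK]]]] := nH.
pose N := maxn N1 (Num.bound K).
have NK : K <= N%:R.
  apply: le_trans (ler_norm K) _; apply: le_trans (ltW (archi_boundP (normr_ge0 K))) _.
  rewrite ler_nat (_ : Num.bound `|K| = Num.bound K); first exact: leq_maxr.
  by rewrite /Num.bound /= normr_id.
have nN := Nice_gtrunc N; have lN := L2_invF nN.
have -> : ip mu H g = ip mu (invF H) (invF (gtrunc N)).
  rewrite plancherel_ip //; apply: eq_cI => xi; rewrite /gtrunc indicE.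
  have [hx|hx] := pselect (cube d N%:R xi); first by rewrite mem_set // mul1r.
  rewrite hK ?mul0r // => hx'; apply: hx => j; exact: le_trans (hx' j) NK.
rewrite -ipBr //; apply: le_trans (cauchy_schwarz lH (L2B lphi lN)) _.
have := hN1 N (leq_maxl _ _); rewrite invFT_truncE dist2E; [|by case: lphi|by case: lN].
rewrite -NmE ?lte_fin; last exact: L2B.
move/ltW => hd; apply: le_trans (ler_wpM2l NH0 hd) _.
rewrite mulrCA -[leRHS]mulr1 (ler_pM2l ep0) ler_pdivrMr ?mul1r ?lerDl //.
by rewrite ltr_wpDl.
Qed.

(** With dilation and translation moved onto [invF G], the coefficients of level [k] become the
    Fourier coefficients of one function, independent of [l]. *)
Lemma phi_coef k l G : Nice G ->
  ip mu (invF G) (dilz A (Posz k) (transl l phi)) =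
  dhat (fun xi => s ^+ k * G (mpow M^T k *m xi) * (g xi)^*) l.
Proof.
move=> nG; have lphi := L2_phi.
have nk : Nice (fun xi : T => s ^+ k * G (mpow M^T k *m xi)).
  apply: NiceZ; apply: Nice_mul => //; apply: unit_mpow; exact: unit_trmxR.
rewrite /= (ip_iter_dil hdet); [|exact: L2_invF|exact: L2_transl].
rewrite (iter_dilinv_invF hdet) // ip_transl //; last exact: L2_invF.
rewrite transl_invF ip_invF_phi; last by apply: Nice_cexpi => //; exact: measurable_dotR.
by rewrite /ip /dhat; apply: eq_cI => xi; rewrite -[LHS]mulrA.
Qed.

Lemma invmx_trE : B = invmx M^T.
Proof. by rewrite mxR_tr. Qed.

Lemma norm_detB : `|\det B| = 2^-1.
Proof. by rewrite invmx_trE det_inv det_tr normrV ?unitfE ?(det_mxR_neq0 R hdet) // norm_det_mxR. Qed.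

(** Tested against every [invF G], which form a total family. Each pairing is a Fourier integral,
    where the claim reduces to [infprod_refine]. *)
Lemma two_scale : n2 mu (fun t => phi t -
  \sum_(f : {ffun 'I_d -> 'I_(N0.*2.+1)}) h (boxv f) * dil A (transl (boxv f) phi) t) = 0%E.
Proof.
have lphi := L2_phi; have lD l := L2_dil hdet (L2_transl l lphi).
have lS : L2 mu (fun t => \sum_(f : {ffun 'I_d -> 'I_(N0.*2.+1)})
     h (boxv f) * dil A (transl (boxv f) phi) t).
  by apply: L2_sum => f; apply: L2Z.
apply: invF_total; first exact: L2B.
move=> G nG; have lG := L2_invF nG; have [mG _] := Nice_L2 nG.
rewrite ipBr // ip_sumr //; last by move=> f; apply: L2Z.
have uB : B \in unitmx by rewrite invmx_trE unitmx_inv unit_trmxR.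
have MB (x : 'cV[R]_d) : M^T *m (B *m x) = x by rewrite invmx_trE mulKVmx ?unit_trmxR.
have nG1 : Nice (fun xi : T => s * G (M^T *m xi)).
  by apply: NiceZ; apply: Nice_mul => //; exact: unit_trmxR.
have [L [K nG1']] := nG1; have [_ L0 _ _ [hL hK]] := nG1'.
have K0 : 0 <= Num.max K 0 by rewrite le_max lexx orbT.
have [Lg [Lg0 hLg]] := infprod_locally_bounded K0.
have nGg : nice (fun xi : T => s * G (M^T *m xi) * (g xi)^*) (L * Lg) K.
  apply: niceP.
  - by apply: cmeasM; [exact: Nice_cmeas|exact: cmeasJ].
  - exact: mulr_ge0.
  - move=> v; have [hv|hv] := pselect (cube d K v); last by rewrite hK // mul0r cabs20 sqr_ge0.
    rewrite cabs2M exprMn ler_pM ?cabs2_ge0 // cabs2J; apply: hLg => j.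
    by rewrite le_max hv.
  - by move=> v hv; rewrite hK // mul0r.
have nGe l : nice (fun xi : T => cexpi (dotR (cvR R l) xi) * (s * G (M^T *m xi) * (g xi)^*)) (L * Lg) K.
  by apply: nice_cexpi => //; exact: measurable_dotR.
have E (f : {ffun 'I_d -> 'I_(N0.*2.+1)}) : ip mu (invF G) (fun x => h (boxv f) * dil A (transl (boxv f) phi) x) =
    cI mu (fun xi => (h (boxv f))^* * (cexpi (dotR (cvR R (boxv f)) xi) * (s * G (M^T *m xi) * (g xi)^*))).
  rewrite ipZr // -[dil A (transl (boxv f) phi)]/(dilz A (Posz 1) (transl (boxv f) phi)).
  rewrite phi_coef // cIZ; last exact: bdd_supp_cintble (nGe _).
  by congr (_ * _); apply: eq_cI => xi; rewrite /mpow /= mulmx1 expr1.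
under eq_bigr do rewrite E.
rewrite -cI_sum; last by move=> f; apply: cintbleZ; exact: bdd_supp_cintble (nGe _).
rewrite ip_invF_phi //; apply/eqP; rewrite subr_eq0; apply/eqP.
have iS : cintble mu (fun xi => \sum_(f : {ffun 'I_d -> 'I_(N0.*2.+1)})
    (h (boxv f))^* * (cexpi (dotR (cvR R (boxv f)) xi) * (s * G (M^T *m xi) * (g xi)^*))).
  by apply: cintble_sum => f; apply: cintbleZ; exact: bdd_supp_cintble (nGe _).
have dB0 : \det B != 0 by rewrite -normr_eq0 norm_detB invr_eq0 pnatr_eq0.
(* The substitution by [B] brings the factor 1/2, which combines with [s] into the normalization
   [s^-1] of [m0]. *)
rewrite -[RHS](cI_cov dB0 iS) norm_detB -cIZ; last first.
  rewrite (_ : (fun x => _) = (fun x : T => \sum_(f : {ffun 'I_d -> 'I_(N0.*2.+1)})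
    (h (boxv f))^* * (cexpi (dotR (cvR R (boxv f)) (B *m x)) * (s * G x * (g (B *m x))^*)))); last first.
    by apply/funext => x; apply: eq_bigr => f _; rewrite MB.
  apply: cintble_sum => f; apply: cintbleZ.
  have [K' nGB] := nice_mul uB (nGe (boxv f)).
  by have := bdd_supp_cintble nGB; under eq_fun do rewrite MB.
apply: eq_cI => xi; rewrite (infprod_refine gre gim xi) /m0 !cJM raddf_sum /=.
under [in RHS]eq_bigr do rewrite MB.
under [in LHS]eq_bigr do rewrite cJM cexpiN conjCK.
have -> : (s^-1)^* = Complex 2^-1 0 * s.
  have c2 : Complex (2^-1 : R) 0 = (Complex 2 0)^-1.
    apply: (@mulIf _ (Complex 2 0)); first by apply/eqP => -[] /eqP; rewrite pnatr_eq0.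
    rewrite mulVf; last by apply/eqP => -[] /eqP; rewrite pnatr_eq0.
    by apply: c_ext; rewrite ?cReM ?cImM /=; rewrite ?mulr0 ?mul0r ?subr0 ?addr0 // mulVf // pnatr_eq0.
  by rewrite fmorphV /= cJ_real c2 -sqrt2C_sqr invfM -mulrA mulVf ?mulr1 // sqrt2C_neq0.
rewrite mulr_sumr mulr_suml mulr_sumr mulr_sumr; apply: eq_bigr => f _; ring.
Qed.

Lemma mpow_inv (P Q : 'M[R]_d) k : P *m Q = 1%:M -> mpow P k *m mpow Q k = 1%:M.
Proof.
move=> PQ; elim: k => [|k IH]; first by rewrite mul1mx.
by rewrite mpowSr {2}/mpow iterS -mulmxA (mulmxA P) PQ mul1mx.
Qed.

Lemma norm_det_mpow k : `|\det (mpow B k)| = 2 ^- k.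
Proof.
elim: k => [|k IH]; first by rewrite det1 normr1 expr0 invr1.
by rewrite /mpow iterS det_mulmx normrM IH norm_detB exprS invfM.
Qed.

(* For large [k] the dilate [G ((A^T)^k .)] lives in a cube inside the fundamental domain
   of [2 pi Z^d], so that Parseval's identity for Fourier series applies. *)
Lemma level_energy G : Nice G -> \forall k \near \oo,
  SQ mu (fun l => dilz A (Posz k) (transl l phi)) (invF G) =
  (((2 * pi) ^+ d)%:E * n2 mu (fun xi => G xi * (g (mpow B k *m xi))^*)%R)%E.
Proof.
move=> nG; have [L [K [mG _ _ _ [hL hK]]]] := nG.
(* Below this norm, [mpow B k] maps the cube of half-side [|K| + 1], which contains the support of
   [G], into the cube of half-side 1. *)
have e0 : 0 < (`|K| + 1)^-1 by rewrite invr_gt0 ltr_wpDl.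
have [k0 hk0] := pow_summable_small hB e0.
exists k0 => // k /= kk0.
have uM := unit_mpow k (unit_trmxR R hdet).
have inv1 : mpow B k *m mpow M^T k = 1%:M.
  by apply: mpow_inv; rewrite invmx_trE mulVmx // unit_trmxR.
have inv2 : mpow M^T k *m mpow B k = 1%:M.
  by apply: mpow_inv; rewrite invmx_trE mulmxV // unit_trmxR.
pose H (xi : T) : C := s ^+ k * G (mpow M^T k *m xi).
have nH : Nice H by apply: NiceZ; apply: Nice_mul.
have H0 v : ~ cube d 1 v -> H v = 0.
  move=> hv; rewrite /H hK ?mulr0 // => hv'; apply: hv.
  have hv2 : cube d (`|K| + 1) (mpow M^T k *m v).
    by move=> j; apply: le_trans (hv' j) _; have := ler_norm K; lra.
  have := mulmx_cube (mpow B k) _ hv2; rewrite mulmxA inv1 mul1mx.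
  move=> hc j; apply: le_trans (hc _ j) _; first by rewrite addr_ge0.
  rewrite -ler_pdivlMr ?div1r ?ltr_wpDl //; apply: ltW; exact: hk0.
have [LH [KH [mH LH0 _ _ [hLH _]]]] := nH.
have [Lg [Lg0 hLg]] := infprod_locally_bounded ler01.
have nHg : nice (fun xi : T => H xi * (g xi)^*) (LH * Lg) 1.
  apply: niceP.
  - by apply: cmeasM => //; exact: cmeasJ.
  - exact: mulr_ge0.
  - move=> v; have [hv|hv] := pselect (cube d 1 v); last by rewrite H0 // mul0r cabs20 sqr_ge0.
    by rewrite cabs2M exprMn ler_pM ?cabs2_ge0 // cabs2J; exact: hLg.
  - by move=> v hv; rewrite H0 // mul0r.
rewrite /SQ; under eq_esum do rewrite phi_coef //.
rewrite (fourier_parseval nHg); congr (_ * _)%E.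
have dB : \det (mpow B k) != 0 by rewrite -normr_eq0 norm_det_mpow invr_eq0 expf_eq0 pnatr_eq0 andbF.
rewrite -(n2_cov dB); last by case: nHg.
rewrite norm_det_mpow.
rewrite (@eq_n2 _ _ _ mu _ (fun v : T => s ^+ k * (G v * (g (mpow B k *m v))^*))); last first.
  by move=> v; rewrite /H mulmxA inv2 mul1mx mulrA.
rewrite n2Z; last first.
  by apply: cmeasM => //; apply: cmeasJ; apply: (cmeas_comp mg); exact: measurable_mulmx.
have -> : cabs2 (s ^+ k) = 2 ^+ k.
  by elim: k {kk0 uM inv1 inv2 H nH H0 LH KH mH LH0 hLH nHg dB} => [|k IH]; rewrite ?cabs21 // !exprS cabs2M cabs2_sqrt2C IH.
by rewrite muleA -EFinM mulVf ?mul1e // expf_eq0 pnatr_eq0 andbF.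
Qed.

Lemma level_energy_cvg G : Nice G ->
  (fun k => SQ mu (fun l => dilz A (Posz k) (transl l phi)) (invF G)) @ \oo --> n2 mu G.
Proof.
move=> nG; have le := level_energy nG.
apply: (cvg_trans (near_eq_cvg _)); first by near=> k; symmetry; near: k; exact: le.
have p0 : 0 < (2 * pi) ^+ d :> R by rewrite exprn_gt0 // twopi_gt0.
have [L [K [mG _ _ _ [hL hK]]]] := nG.
have K0 : 0 <= Num.max K 0 by rewrite le_max lexx orbT.
have [Lg [Lg0 hLg]] := infprod_bounded hB hsum gre gim K0.
pose F k (xi : T) := (cabs2 (G xi * (g (mpow B k *m xi))^*))%:E.
have mF k : measurable_fun setT (F k).
  by apply: cmeas_ecabs2; apply: cmeasM => //; apply: cmeasJ; apply: (cmeas_comp mg); exact: measurable_mulmx.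
have H1 : {ae mu, forall x, setT x -> F k x @[k --> \oo] --> (cabs2 (G x) * cabs2 (c2pi R d))%:E}.
  apply: aeW => xi _; apply: cvg_EFin; first by near=> k.
  rewrite /F /comp /=; under eq_fun do rewrite cabs2M cabs2J.
  by apply: cvgMr; exact: (infprod_cvg hB hsum gre gim).
have H2 : {ae mu, forall x k, setT x -> (`|F k x| <= (Lg ^+ 2)%:E * (cabs2 (G x))%:E)%E}.
  apply: aeW => xi k _; rewrite /F gee0_abs ?lee_fin ?cabs2_ge0 //.
  have [hx|hx] := pselect (cube d K xi); last by rewrite hK // mul0r cabs20 mulr0.
  rewrite cabs2M cabs2J mulrC ler_wpM2r ?cabs2_ge0 //; apply: hLg => j.
  by rewrite le_max hx.
have i1 : mu.-integrable setT (fun x => ((Lg ^+ 2)%:E * (cabs2 (G x))%:E)%E).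
  by apply: integrableZl => //; apply: L2_integrable; exact: Nice_L2.
have mlim : measurable_fun setT (fun x : T => (cabs2 (G x) * cabs2 (c2pi R d))%:E).
  apply/measurable_EFinP; apply: measurable_funM; [exact: cmeas_cabs2|exact: measurable_cst].
have [_ _ cv] := @dominated_convergence _ _ _ mu setT measurableT F _ _ mF mlim H1 i1 H2.
have -> : n2 mu G = (((2 * pi) ^+ d)%:E * \int[mu]_x (cabs2 (G x) * cabs2 (c2pi R d))%:E)%E.
  under eq_integral do rewrite mulrC EFinM.
  rewrite ge0_integralZl //; last 3 first.
  - exact: cmeas_ecabs2.
  - by move=> x _; rewrite lee_fin cabs2_ge0.
  - by rewrite lee_fin cabs2_ge0.
  by rewrite muleA -EFinM cabs2_c2pi mulfV ?mul1e // gt_eqF.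
apply: cvgeZl => //.
Unshelve. all: by end_near. Qed.

End ScalingFunction.

(** * The filter bank *)

Ltac zmod_cV := repeat match goal with |- context [?X *m ?Y] => generalize (X *m Y); intro end;
  apply/matrixP => ? ?; rewrite !mxE; ring.

Lemma sum_uniq_le (R : realType) (I : eqType) (s t : seq I) (F : I -> R) :
  uniq s -> uniq t -> {subset s <= t} -> (forall i, 0 <= F i) ->
  \sum_(i <- s) F i <= \sum_(i <- t) F i.
Proof.
move=> us ut st F0.
have p : perm_eq s [seq i <- t | i \in s].
  apply: uniq_perm => //; first exact: filter_uniq.
  by move=> i; rewrite mem_filter; case: (boolP (i \in s)) => //= /st.
rewrite (perm_big _ p) /= big_filter [leRHS](bigID (fun i => i \in s)) /= lerDl.
exact: sumr_ge0.
Qed.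

Section FilterBank.
Variables (R : realType) (d : nat).
Local Notation C := (R[i]).
Local Notation Z := 'cV[int]_d.
Variables (A : 'M[int]_d) (lA qA : Z) (N : nat) (h : Z -> C).
Local Notation Box := {ffun 'I_d -> 'I_(N.*2.+1)}.
Hypothesis dA : \det A != 0.

Lemma boxv_inj : injective (@boxv d N).
Proof.
move=> f f' /matrixP e; apply/ffunP => j; apply: val_inj.
by have := e j 0; rewrite !mxE => /addIr [].
Qed.

Lemma boxv_surj (n : Z) : (forall j, `|n j 0| <= N%:Z) -> exists f : Box, boxv f = n.
Proof.
move=> hn; pose k j := `|(n j 0 + N%:Z)%R|%N.
have hk j : (k j < N.*2.+1)%N by have := hn j; rewrite /k; lia.
exists [ffun j => Ordinal (hk j)]; apply/matrixP => j i; rewrite !mxE ffunE ord1 /= /k.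
have := hn j; lia.
Qed.

Lemma mulA_inj : injective (fun l : Z => A *m l).
Proof.
move=> l l' e; have : \adj A *m (A *m l) = \adj A *m (A *m l') by rewrite e.
rewrite !mulmxA mul_adj_mx !mul_scalar_mx => /matrixP e'.
by apply/matrixP => i j; have := e' i j; rewrite !mxE => /(mulfI dA).
Qed.

(** Rewrites a sum over a parametrized coset as a sum over the box with a membership test, the shape
    in which [horth] and the coset conditions can be compared. The list [t] must contain every [l]
    with a nonzero term. *)
Lemma box_reindex (F : Z -> C) (p : Z -> Z) (t : seq Z) :
  (forall n, F n != 0 -> forall j, `|n j 0| <= N%:Z) -> injective p -> uniq t ->
  (forall l, F (p l) != 0 -> l \in t) ->
  \sum_(l <- t) F (p l) = \sum_(f : Box) if `[< exists l, p l = boxv f >] then F (boxv f) else 0.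
Proof.
move=> hF pI ut ht.
transitivity (\sum_(l <- t) \sum_(f : Box) if boxv f == p l then F (boxv f) else 0).
  apply: eq_bigr => l _; have [F0|Fn0] := eqVneq (F (p l)) 0.
    by rewrite F0 big1 // => f _; case: eqP => // ->.
  have [f0 e0] := boxv_surj (hF _ Fn0).
  rewrite (bigD1 f0) //= e0 eqxx big1 ?addr0 // => f ff0.
  by case: eqP => // e; case/eqP: ff0; apply: boxv_inj; rewrite e.
rewrite exchange_big /=; apply: eq_bigr => f _; case: ifPn => [/asboolP [l0 e0]|/asboolPn ne].
  have [F0|Fn0] := eqVneq (F (boxv f)) 0; first by rewrite F0 big1 // => l _; case: ifP.
  have l0t : l0 \in t by apply: ht; rewrite e0.
  rewrite (bigD1_seq l0) //= e0 eqxx big1 ?addr0 // => l ll0.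
  by case: eqP => // e; case/eqP: ll0; apply: pI; rewrite -e.
by rewrite big1 // => l _; case: eqP => // e; case: ne; exists l.
Qed.

(** [opA] and [opB] are the analysis operators of the low-pass and the high-pass filter, conjugated
    as the second argument of [ip] requires; they take coefficients of one level to those of the
    next coarser level. *)
Definition opA (c : Z -> C) (l : Z) : C := \sum_(f : Box) (h (boxv f))^* * c (A *m l + boxv f).
Definition opB (c : Z -> C) (l : Z) : C :=
  \sum_(f : Box) (-1) ^ dotZ qA (lA - boxv f) * h (boxv f) * c (A *m l + (lA - boxv f)).

Hypothesis coset2 : forall v, (inAZ A (v - lA) \/ inAZ A v) /\ ~ (inAZ A (v - lA) /\ inAZ A v).
Hypothesis qA_even : forall v, inAZ A v -> (2 %| dotZ qA v)%Z.
Hypothesis qA_odd : forall v, inAZ A (v - lA) -> ~~ (2 %| dotZ qA v)%Z.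
Hypothesis coset_even : forall m n, inAZ A m -> forall v,
  (inAZ A (n - v) \/ inAZ A (v - (lA - m - n))) /\
  ~ (inAZ A (n - v) /\ inAZ A (v - (lA - m - n))).
Hypothesis coset_odd : forall m n, inAZ A (m - lA) -> forall v,
  inAZ A (n - v) <-> inAZ A (v - (lA - m - n)).
Hypothesis hsupp : forall n, h n != 0 -> forall j, `|n j 0| <= N%:Z.
Hypothesis horth : forall k, inAZ A k ->
  \sum_(f : Box) h (boxv f) * (h (boxv f + k))^* = (k == 0)%:R.

Lemma dotZDr (x y z : Z) : dotZ x (y + z) = dotZ x y + dotZ x z.
Proof. by rewrite /dotZ -big_split; apply: eq_bigr => j _; rewrite mxE mulrDr. Qed.

Lemma expN1_parity (z : int) : (-1 : C) ^ z = if (2 %| z)%Z then 1 else -1.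
Proof.
rewrite dvdzE dvdn2; case: z => n /=.
  by rewrite -[(-1) ^ _]/((-1) ^+ n) -signr_odd; case: (odd n).
by rewrite -[(-1) ^ _]/((-1) ^- n.+1) -signr_odd invr_sign /=; case: (odd n).
Qed.

Lemma inAZ0 : inAZ A 0.
Proof. by exists 0; rewrite mulmx0. Qed.

(** With [m = k' - k] and [F n = h n (h (n + m))^*], the first half sums [F] over the coset
    [k - A Z^d], and the second sums it over [lA - m - k + A Z^d] with the sign [(-1)^(qA.m)]. If
    [m] is not in [A Z^d], the sign is -1 and the cosets coincide, so the halves cancel. If it is,
    the sign is 1 and the cosets partition [Z^d], so the total is the sum in [horth]. *)
Lemma perfect_reconstruction (k k' : Z) (t : seq Z) : uniq t ->
  (forall l, h (k - A *m l) != 0 -> l \in t) ->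
  (forall l, h (lA - k + A *m l) != 0 -> l \in t) ->
  \sum_(l <- t) (h (k - A *m l) * (h (k' - A *m l))^* +
     (-1) ^ dotZ qA (k - A *m l) * (-1) ^ dotZ qA (k' - A *m l) *
     ((h (lA - k + A *m l))^* * h (lA - k' + A *m l))) = (k == k')%:R.
Proof.
move=> ut t1 t2; set m := k' - k.
pose F n := h n * (h (n + m))^*.
have Fn n : F n != 0 -> h n != 0 /\ h (n + m) != 0.
  by rewrite /F mulf_eq0 negb_or conjC_eq0 => /andP[].
have hF n : F n != 0 -> forall j, `|n j 0| <= N%:Z by move/Fn => [/hsupp].
have E1 l : h (k - A *m l) * (h (k' - A *m l))^* = F (k - A *m l).
  by rewrite /F; congr (_ * (h _)^*); rewrite /m; zmod_cV.
have E2 l : (h (lA - k + A *m l))^* * h (lA - k' + A *m l) = F (lA - k' + A *m l).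
  by rewrite /F mulrC; congr (_ * (h _)^*); rewrite /m; zmod_cV.
pose e : C := (-1) ^ dotZ qA m.
have E3 l : (-1) ^ dotZ qA (k - A *m l) * (-1) ^ dotZ qA (k' - A *m l) = e.
  have -> : k' - A *m l = (k - A *m l) + m by rewrite /m; zmod_cV.
  rewrite (dotZDr qA (k - A *m l) m) expfzDr ?oppr_eq0 ?oner_eq0 // mulrA -/e.
  by rewrite expN1_parity; case: ifP => _; rewrite ?mulrNN !mul1r.
under eq_bigr do rewrite E1 E2 E3.
rewrite big_split -mulr_sumr /=.
rewrite (box_reindex hF (p := fun l => k - A *m l)) //; last 2 first.
- by move=> l l' /addrI /oppr_inj /mulA_inj.
- by move=> l /Fn [h1 _]; exact: t1.
rewrite (box_reindex hF (p := fun l => lA - k' + A *m l)) //; last 2 first.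
- by move=> l l' /addrI /mulA_inj.
- move=> l /Fn [_ h1]; apply: t2; rewrite (_ : lA - k + _ = lA - k' + A *m l + m) // /m; zmod_cV.
have i1 v : (exists l, k - A *m l = v) <-> inAZ A (k - v).
  by split=> -[l e1]; exists l; rewrite -e1; zmod_cV.
have i2 v : (exists l, lA - k' + A *m l = v) <-> inAZ A (v - (lA - m - k)).
  have -> : lA - m - k = lA - k' by rewrite /m; zmod_cV.
  by split=> -[l e1]; exists l; [rewrite -e1|rewrite -e1]; zmod_cV.
have [[mo|me] nme] := coset2 m.
  have -> : (k == k') = false.
    apply/eqP => kk; apply: nme; split=> //; rewrite /m kk subrr; exact: inAZ0.
  rewrite /e expN1_parity (negbTE (qA_odd mo)) mulN1r.
  apply/eqP; rewrite subr_eq0; apply/eqP; apply: eq_bigr => f _.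
  congr (if _ then _ else _); apply: asbool_equiv_eq.
  by rewrite i1 i2; exact: coset_odd.
rewrite /e expN1_parity (qA_even me) mul1r -big_split /=.
transitivity (\sum_(f : Box) F (boxv f)).
  apply: eq_bigr => f _; have [[h1|h1] h2] := coset_even k me (boxv f).
    rewrite asboolT ?i1 // asboolF ?addr0 //; rewrite i2 => h3; exact: h2.
  rewrite asboolF ?add0r ?asboolT ?i2 //; rewrite i1 => h3; exact: h2.
by rewrite /F horth // /m subr_eq0 eq_sym.
Qed.

Definition restr (s : seq Z) (c : Z -> C) (k : Z) : C := if k \in s then c k else 0.

Lemma opA_restr c s l : uniq s ->
  opA (restr s c) l = \sum_(k <- s) (h (k - A *m l))^* * c k.
Proof.
move=> us; pose F n := (h n)^* * restr s c (A *m l + n).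
have E k : A *m l + (k - A *m l) = k by zmod_cV.
have -> : \sum_(k <- s) (h (k - A *m l))^* * c k = \sum_(k <- s) F (k - A *m l).
  by rewrite big_seq [RHS]big_seq; apply: eq_bigr => k ks; rewrite /F E /restr ks.
rewrite (box_reindex (F := F) (p := fun k => k - A *m l)) //.
- apply: eq_bigr => f _; rewrite asboolT //.
  by exists (A *m l + boxv f); zmod_cV.
- by move=> n; rewrite /F mulf_eq0 negb_or conjC_eq0 => /andP[/hsupp].
- by move=> k k' /addIr.
- by move=> k; rewrite /F E /restr; case: ifP => //; rewrite mulr0 eqxx.
Qed.

Lemma opB_restr c s l : uniq s ->
  opB (restr s c) l =
  \sum_(k <- s) (-1) ^ dotZ qA (k - A *m l) * h (lA - k + A *m l) * c k.
Proof.
move=> us; pose F n := (-1) ^ dotZ qA (lA - n) * h n * restr s c (A *m l + (lA - n)).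
have E1 k : lA - (lA - k + A *m l) = k - A *m l by zmod_cV.
have E2 k : A *m l + (k - A *m l) = k by zmod_cV.
have -> : \sum_(k <- s) (-1) ^ dotZ qA (k - A *m l) * h (lA - k + A *m l) * c k =
    \sum_(k <- s) F (lA - k + A *m l).
  by rewrite big_seq [RHS]big_seq; apply: eq_bigr => k ks; rewrite /F E1 E2 /restr ks.
rewrite (box_reindex (F := F) (p := fun k => lA - k + A *m l)) //.
- apply: eq_bigr => f _; rewrite asboolT //.
  by exists (lA + A *m l - boxv f); zmod_cV.
- by move=> n; rewrite /F !mulf_eq0 !negb_or => /andP[/andP[_ /hsupp]].
- by move=> k k' /addIr /addrI /oppr_inj.
- by move=> k; rewrite /F E1 E2 /restr; case: ifP => //; rewrite mulr0 eqxx.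
Qed.

(** Expanding the squares and exchanging the sums leaves the conjugate of [perfect_reconstruction]
    as kernel. The input is truncated to [s], and [t] contains all indices where the output is
    nonzero, so every sum is finite. *)
Lemma filter_isometry c s t : uniq s -> uniq t ->
  (forall k l : Z, k \in s -> h (k - A *m l) != 0 -> l \in t) ->
  (forall k l : Z, k \in s -> h (lA - k + A *m l) != 0 -> l \in t) ->
  \sum_(l <- t) (cabs2 (opA (restr s c) l) + cabs2 (opB (restr s c) l)) =
  \sum_(k <- s) cabs2 (c k).
Proof.
move=> us ut t1 t2.
suff : \sum_(l <- t) (opA (restr s c) l * (opA (restr s c) l)^* +
    opB (restr s c) l * (opB (restr s c) l)^*) = \sum_(k <- s) c k * (c k)^*.
  move/(congr1 (@complex.Re R)); rewrite !cRe_sum.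
  under eq_bigr do rewrite cReD !mulcJ.
  by under [X in _ = X]eq_bigr do rewrite mulcJ.
have eJ z : ((-1 : C) ^ z)^* = (-1) ^ z by rewrite expN1_parity; case: ifP => _; rewrite ?conjC1 // conjCN1.
under eq_bigr do rewrite opA_restr // opB_restr // !raddf_sum /= !mulr_suml -big_split /=.
rewrite exchange_big /= big_seq [RHS]big_seq; apply: eq_bigr => k ks.
transitivity (\sum_(k' <- s) c k * (c k')^* * ((k' == k)%:R)^*); last first.
  rewrite (bigD1_seq k) //= eqxx conjC1 mulr1 big1 ?addr0 // => k' /negbTE ->.
  by rewrite conjC0 mulr0.
have pr k' : ((k' == k)%:R)^* = \sum_(l <- t) ((h (k - A *m l))^* * h (k' - A *m l) +
     (-1) ^ dotZ qA (k - A *m l) * (-1) ^ dotZ qA (k' - A *m l) *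
     (h (lA - k + A *m l) * (h (lA - k' + A *m l))^*)).
  rewrite eq_sym -(@perfect_reconstruction k k' t) //; last 2 first.
  - by move=> l; exact: t1.
  - by move=> l; exact: t2.
  rewrite raddf_sum; apply: eq_bigr => l _.
  by rewrite raddfD /= !cJM !conjCK !eJ.
under [RHS]eq_bigr do rewrite pr mulr_sumr.
rewrite exchange_big /=; apply: eq_bigr => l _.
rewrite !mulr_sumr -big_split /=; apply: eq_bigr => k' _.
rewrite !cJM conjCK eJ.
move: ((-1) ^ dotZ qA (k - A *m l)) ((-1) ^ dotZ qA (k' - A *m l)) => e1 e2.
move: (h (k - A *m l))^* (h (k' - A *m l)) (h (lA - k + A *m l)) (h (lA - k' + A *m l))^* => h1 h2 h3 h4.
move: (c k) (c k')^* => c1 c2; ring.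
Qed.

Lemma filter_range (s : seq Z) : exists t : seq Z, [/\ uniq t,
  forall k l : Z, k \in s -> h (k - A *m l) != 0 -> l \in t &
  forall k l : Z, k \in s -> h (lA - k + A *m l) != 0 -> l \in t].
Proof.
(* A left inverse of [A], with default value 0 off its image. *)
pose p v := xget 0 [set l : Z | A *m l = v].
have pE l : p (A *m l) = l.
  rewrite /p; by case: xgetP => [l' _ /mulA_inj //|ne]; case: (ne l).
pose t1 := [seq p (k - boxv f) | k <- s, f <- enum {: Box}].
pose t2 := [seq p (boxv f - (lA - k)) | k <- s, f <- enum {: Box}].
exists (undup (t1 ++ t2)); split; first exact: undup_uniq.
- move=> k l ks /hsupp /boxv_surj [f e]; rewrite mem_undup mem_cat.
  apply/orP; left; apply/allpairsP; exists (k, f); split=> //=; first by rewrite mem_enum.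
  by rewrite e (_ : k - _ = A *m l) ?pE //; zmod_cV.
- move=> k l ks /hsupp /boxv_surj [f e]; rewrite mem_undup mem_cat.
  apply/orP; right; apply/allpairsP; exists (k, f); split=> //=; first by rewrite mem_enum.
  by rewrite e (_ : _ - _ = A *m l) ?pE //; zmod_cV.
Qed.

Local Open Scope ereal_scope.
Local Notation En c := (\esum_(l in [set: Z]) (cabs2 (opA c l) + cabs2 (opB c l))%:E).
Local Notation Nl c := (\esum_(k in [set: Z]) (cabs2 (c k))%:E).
Local Close Scope ereal_scope.

(** Finitely many outputs involve finitely many inputs, so [c] may be truncated to these before
    [filter_isometry] is applied. *)
Lemma filter_bessel c : (En c <= Nl c)%E.
Proof.
apply: esum_le_finsum => t0 ut0.
pose s := undup ([seq A *m l + boxv f | l <- t0, f <- enum {: Box}] ++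
                 [seq A *m l + (lA - boxv f) | l <- t0, f <- enum {: Box}]).
have us : uniq s by exact: undup_uniq.
have [t [ut t1 t2]] := filter_range s.
have Ea l : l \in t0 -> opA c l = opA (restr s c) l.
  move=> lt; apply: eq_bigr => f _; rewrite /restr ifT // mem_undup mem_cat; apply/orP; left.
  by apply/allpairsP; exists (l, f); rewrite mem_enum.
have Eb l : l \in t0 -> opB c l = opB (restr s c) l.
  move=> lt; apply: eq_bigr => f _; rewrite /restr ifT // mem_undup mem_cat; apply/orP; right.
  by apply/allpairsP; exists (l, f); rewrite mem_enum.
pose F l := cabs2 (opA (restr s c) l) + cabs2 (opB (restr s c) l).
have F0 l : 0 <= F l by rewrite addr_ge0 ?cabs2_ge0.
apply: (@le_trans _ _ (\sum_(l <- t0) F l)%:E).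
  by rewrite -sumEFin big_seq [leRHS]big_seq; apply: lee_sum => l lt; rewrite Ea // Eb.
apply: (@le_trans _ _ (\sum_(l <- undup (t ++ t0)) F l)%:E).
  rewrite lee_fin; apply: sum_uniq_le => //; first exact: undup_uniq.
  by move=> l lt; rewrite mem_undup mem_cat lt orbT.
rewrite filter_isometry ?undup_uniq //; last 2 first.
- by move=> k l ks /(t1 k l ks); rewrite mem_undup mem_cat => ->.
- by move=> k l ks /(t2 k l ks); rewrite mem_undup mem_cat => ->.
rewrite -sumEFin; apply: finsum_le_esum => // k; by rewrite lee_fin cabs2_ge0.
Qed.

(** The isometry on truncations is extended without a continuity argument. Flipping the sign of [c]
    outside [s] keeps its norm [n], so the output energy of the flipped sequence is at most [n]. The
    parallelogram inequality bounds the energy of the truncation by [(e + n) / 2]; the supremum over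
    [s] gives [n <= e]. *)
Lemma filter_parseval c : (Nl c < +oo)%E -> En c = Nl c.
Proof.
move=> fin; apply/eqP; rewrite eq_le filter_bessel /=.
have N0 : (0 <= Nl c)%E by apply: esum_ge0 => k _; rewrite lee_fin cabs2_ge0.
have E0 : (0 <= En c)%E by apply: esum_ge0 => k _; rewrite lee_fin addr_ge0 ?cabs2_ge0.
have fn : Nl c \is a fin_num by rewrite ge0_fin_numE.
have fe : En c \is a fin_num by rewrite ge0_fin_numE // (le_lt_trans (filter_bessel c)).
set n := fine (Nl c); set e := fine (En c).
have nE : Nl c = n%:E by rewrite fineK.
have eE : En c = e%:E by rewrite fineK.
suff : (Nl c <= ((e + n) / 2)%:E)%E by rewrite nE eE !lee_fin; lra.
apply: esum_le_finsum => s us; rewrite sumEFin lee_fin.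
have [t [ut t1 t2]] := filter_range s.
(* [c'] has the same norm as [c], and [c + c'] is twice the truncation of [c]. *)
pose c' k := if k \in s then c k else - c k.
have cc k : c k + c' k = 2 * restr s c k.
  by rewrite /c' /restr; case: ifP => _; rewrite ?subrr ?mulr0 // -mulr2n mulr_natl.
have Nc' : Nl c' = n%:E.
  by rewrite -nE; apply: eq_esum => k _; rewrite /c'; case: ifP => _ //; rewrite cabs2N.
have aE l : opA c l + opA c' l = 2 * opA (restr s c) l.
  by rewrite /opA mulr_sumr -big_split; apply: eq_bigr => f _ /=; rewrite -mulrDr cc mulrCA.
have bE l : opB c l + opB c' l = 2 * opB (restr s c) l.
  by rewrite /opB mulr_sumr -big_split; apply: eq_bigr => f _ /=; rewrite -mulrDr cc mulrCA.
have c2 : cabs2 (2 : C) = 4.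
  by rewrite (_ : 2 = Complex 2 0) ?cabs2_real; [ring|apply: c_ext => /=; rewrite ?cReD ?cImD /= ?addr0].
have le l : 4 * (cabs2 (opA (restr s c) l) + cabs2 (opB (restr s c) l)) <=
    2 * (cabs2 (opA c l) + cabs2 (opB c l)) + 2 * (cabs2 (opA c' l) + cabs2 (opB c' l)).
  have := cabs2D_le (opA c l) (opA c' l); have := cabs2D_le (opB c l) (opB c' l).
  by rewrite aE bE !cabs2M c2; lra.
have : 4 * \sum_(k <- s) cabs2 (c k) <=
    2 * \sum_(l <- t) (cabs2 (opA c l) + cabs2 (opB c l)) +
    2 * \sum_(l <- t) (cabs2 (opA c' l) + cabs2 (opB c' l)).
  rewrite -(filter_isometry c us ut t1 t2) !mulr_sumr -big_split; apply: ler_sum => l _; exact: le.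
have h1 : \sum_(l <- t) (cabs2 (opA c l) + cabs2 (opB c l)) <= e.
  rewrite -lee_fin -eE -sumEFin; apply: finsum_le_esum => // l.
  by rewrite lee_fin addr_ge0 ?cabs2_ge0.
have h2 : \sum_(l <- t) (cabs2 (opA c' l) + cabs2 (opB c' l)) <= n.
  rewrite -lee_fin -Nc' -sumEFin; apply: le_trans (filter_bessel c'); apply: finsum_le_esum => // l.
  by rewrite lee_fin addr_ge0 ?cabs2_ge0.
by lra.
Qed.

End FilterBank.

(** * Decay at coarse scales *)

Lemma esum_opp (R : realType) d (a : 'cV[int]_d -> \bar R) :
  \esum_(l in [set: 'cV[int]_d]) a (- l) = \esum_(l in [set: 'cV[int]_d]) a l.
Proof.
rewrite [RHS](@reindex_esum _ _ _ [set: 'cV[int]_d] [set: 'cV[int]_d] (fun l => - l)) //.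
Qed.

Lemma muT_origin (R : realType) d : muT d.+1 (cube d.+1 (0 : R)) = 0%E.
Proof.
rewrite (@muT_colf R d [set 0] (cube d 0)).
- by rewrite lebesgue_measure_set1 mul0e.
- exact: measurable_set1.
- exact: measurable_cube.
- move=> x v; rewrite cube_colf; split=> -[h1 h2]; split=> //.
    by apply/eqP; rewrite -normr_le0.
  by rewrite h1 normr0.
Qed.

Section Vanishing.
Variables (R : realType) (d : nat).
Local Notation C := (R[i]).
Local Notation T := (cvT R d).
Local Notation mu := (@muT R d).
Variable phi : T -> C.
Hypothesis lphi : L2 mu phi.
Hypothesis d_gt0 : (0 < d)%N.

Definition periodization (t : T) : \bar R :=
  \esum_(l in [set: 'cV[int]_d]) (cabs2 (phi (t + cvR R l)))%:E.

Let mphi : cmeas phi := lphi.1.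

Lemma cmeas_shift (b : 'cV[R]_d) : cmeas (fun t : T => phi (t + b)).
Proof. by apply: (cmeas_comp mphi); exact: measurable_translate. Qed.

Lemma measurable_periodization : measurable_fun setT periodization.
Proof.
apply: measurable_esum => [l|l t]; last by rewrite lee_fin cabs2_ge0.
by apply: cmeas_ecabs2; exact: cmeas_shift.
Qed.

Lemma periodization_ge0 t : (0 <= periodization t)%E.
Proof. by apply: esum_ge0 => l _; rewrite lee_fin cabs2_ge0. Qed.

(** Shifted by [e], the cube of half-side 1/4 lies inside the unit cube, over which the
    periodization integrates to the squared norm of [phi]. *)
Lemma local_energy_finite :
  (\int[mu]_t ((\1_(cube d 4^-1 : set T) t)%:E * periodization t) <= n2 mu phi)%E.
Proof.
pose e : 'cV[R]_d := const_mx 2^-1.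
have mI (U : set T) : measurable U -> measurable_fun setT (fun t : T => (\1_U t : R)%:E).
  by move=> mU; apply/measurable_EFinP; apply: measurable_indic.
have mu1 := mI _ (@measurable_ucube R d).
have mP := measurable_periodization; have P0 := periodization_ge0.
have mtr (b : 'cV[R]_d) (F : T -> \bar R) : measurable_fun setT F -> measurable_fun setT (fun t : T => F (t + b)).
  by move=> mF; apply: (@measurableT_comp _ _ _ _ _ _ F) => //; exact: measurable_translate.
apply: (@le_trans _ _ (\int[mu]_t ((\1_(@ucube R d) ((t + e)%R : T))%:E * periodization t))%E).
  apply: ge0_le_integral => //.
  - by move=> t _; rewrite mule_ge0 // lee_fin.
  - by apply: emeasurable_funM => //; apply: mI; exact: measurable_cube.
  - by apply: emeasurable_funM => //; exact: (mtr e (fun t => (\1_(@ucube R d) t)%:E)).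
  - move=> t _; apply: lee_wpmul2r => //; rewrite lee_fin !indicE.
    case: (boolP (t \in cube d 4^-1)) => //; rewrite inE => ht; rewrite mem_set // => j.
    rewrite !mxE; have := ht j; rewrite ler_norml => /andP[h1 h2].
    by apply/andP; split; lra.
rewrite le_eqVlt; apply/orP; left; apply/eqP.
have -> : (\int[mu]_t ((\1_(@ucube R d) ((t + e)%R : T))%:E * periodization t) =
    \int[mu]_t ((\1_(@ucube R d) t)%:E * periodization (t - e)%R))%E.
  rewrite -(ge0_integral_translate e (F := fun t => (\1_(@ucube R d) t)%:E * periodization (t - e)%R)%E).
  - by apply: eq_integral => t _; rewrite addrK.
  - by apply: emeasurable_funM => //; exact: mtr.
  - by move=> t; rewrite mule_ge0 // lee_fin.
rewrite -(n2_translate (- e) mphi) /n2 (tiling (F := fun v => (cabs2 (phi (v - e)))%:E)).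
- apply: eq_integral => t _; congr (_ * _)%E; apply: eq_esum => l _.
  by rewrite addrAC.
- by apply: cmeas_ecabs2; exact: cmeas_shift.
- by move=> v; rewrite lee_fin cabs2_ge0.
Qed.

(** Dominated convergence: the shrinking cubes reduce to the origin, a null set because the
    dimension is positive. *)
Lemma local_energy_small (eps : R) : 0 < eps -> exists r : R, 0 < r /\
  (\int[mu]_t ((\1_(cube d r : set T) t)%:E * periodization t) < eps%:E)%E.
Proof.
(* Starting at 1/4 makes the first function, integrable by [local_energy_finite], dominate all the
   others. *)
move=> ep0; pose r k : R := k.+4%:R^-1.
have r0 k : 0 < r k by rewrite invr_gt0 ltr0n.
have mP := measurable_periodization; have P0 := periodization_ge0.
have mI (U : set T) : measurable U -> measurable_fun setT (fun t : T => (\1_U t : R)%:E).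
  by move=> mU; apply/measurable_EFinP; apply: measurable_indic.
pose F k (t : T) := ((\1_(cube d (r k) : set T) t)%:E * periodization t)%E.
have mF k : measurable_fun setT (F k).
  by apply: emeasurable_funM => //; apply: mI; exact: measurable_cube.
have H1 : {ae mu, forall t, setT t -> F k t @[k --> \oo] --> 0%E}.
  exists (cube d 0 : set T); split; first exact: measurable_cube.
    by move: d_gt0; clear; case: d => // d' _; exact: muT_origin.
  move=> t /= nt; apply: contrapT => ht; apply: nt => _.
  have [j hj] : exists j, 0 < `|t j 0|.
    by apply: contrapT => /forallNP h; apply: ht => j; rewrite leNgt; apply/negP.
  have [k0 hk0] : exists k0 : nat, `|t j 0|^-1 < k0%:R.
    by exists (Num.bound `|t j 0|^-1); apply: archi_boundP; rewrite invr_ge0.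
  apply: cvg_near_cst; exists k0 => // k /= kk0.
  rewrite /F indicE memNset ?mul0e // => /(_ j); apply/negP; rewrite -ltNge.
  rewrite /r -[ltRHS]invrK ltf_pV2 ?posrE ?invr_gt0 //.
  apply: lt_le_trans hk0 _; rewrite ler_nat; apply: leq_trans kk0 _.
  by rewrite -addn4 leq_addr.
have H2 : {ae mu, forall t k, setT t -> (`|F k t| <= F 0%N t)%E}.
  apply: aeW => t k _; rewrite gee0_abs ?mule_ge0 ?lee_fin //.
  apply: lee_wpmul2r => //; rewrite lee_fin !indicE.
  case: (boolP (t \in cube d (r k))) => //; rewrite inE => ht; rewrite mem_set // => j.
  apply: le_trans (ht j) _; rewrite /r lef_pV2 ?posrE ?ltr0n // ler_nat.
  by rewrite !ltnS.
have iF : mu.-integrable setT (F 0%N).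
  apply/integrableP; split=> //.
  under eq_integral do rewrite gee0_abs ?mule_ge0 ?lee_fin //.
  by apply: le_lt_trans local_energy_finite _; case: lphi.
have [_ _] := @dominated_convergence _ _ _ mu setT measurableT F (fun=> 0%E) _ mF (measurable_cst _) H1 iF H2.
rewrite integral0 => cv.
have [k _ hk] : \forall k \near \oo, (\int[mu]_t F k t < eps%:E)%E.
  by apply: (cv [set x | (x < eps%:E)%E]); apply: open_nbhs_nbhs; split; [exact: open_ereal_lt_ereal|rewrite /= lte_fin].
by exists (r k); split=> //; exact: (hk k (leqnn k)).
Qed.

(** Cauchy-Schwarz on the cube for each translate separately; summing the local energies of the
    translates rebuilds the periodization, up to the sign of [l]. *)
Lemma translates_energy (F : T -> C) (r : R) : L2 mu F ->
  (forall t, ~ cube d r t -> F t = 0) ->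
  (SQ mu (fun l => transl l phi) F <=
   (Nm mu F)%:E * \int[mu]_t ((\1_(cube d r : set T) t)%:E * periodization t))%E.
Proof.
move=> lF hF; pose I t : C := Complex (\1_(cube d r : set T) t) 0.
have mI : cmeas I by split => /=; [apply: measurable_indic; exact: measurable_cube|exact: measurable_cst].
have lT l : L2 mu (fun t => I t * transl l phi t).
  have [mt ft] := L2_transl l lphi; split; first exact: cmeasM.
  apply: le_lt_trans ft; apply: ge0_le_integral => //.
  - by move=> t _; rewrite lee_fin cabs2_ge0.
  - by apply: cmeas_ecabs2; exact: cmeasM.
  - exact: cmeas_ecabs2.
  - move=> t _; rewrite lee_fin cabs2M ler_piMl ?cabs2_ge0 // cabs2_real indicE.
    by case: (_ \in _); rewrite ?expr1n ?expr0n.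
have E l : ip mu F (transl l phi) = ip mu F (fun t => I t * transl l phi t).
  apply: eq_cI => t; have [ht|ht] := pselect (cube d r t); last by rewrite hF // !mul0r.
  by rewrite /I indicE mem_set // mul1r.
apply: (@le_trans _ _ (\esum_(l in [set: 'cV[int]_d]) ((Nm mu F)%:E *
   \int[mu]_t ((\1_(cube d r : set T) t)%:E * (cabs2 (transl l phi t))%:E)))%E).
  apply: le_esum => l _; rewrite E.
  apply: (@le_trans _ _ ((Nm mu F) * Nm mu (fun t => I t * transl l phi t))%:E).
    by rewrite lee_fin; apply: cauchy_schwarz.
  rewrite EFinM (NmE (lT l)); apply: lee_wpmul2l; first by rewrite lee_fin Nm_ge0.
  rewrite le_eqVlt; apply/orP; left; apply/eqP; apply: eq_integral => t _.
  rewrite cabs2M cabs2_real -EFinM indicE; congr (_ * _)%:E.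
  by case: (_ \in _); rewrite ?expr1n ?expr0n.
have ci l t : (0 <= (\1_(cube d r : set T) t)%:E * (cabs2 (transl l phi t))%:E)%E.
  by rewrite mule_ge0 // lee_fin ?cabs2_ge0.
rewrite esumZl ?Nm_ge0 //; last by move=> l; apply: integral_ge0.
rewrite -integral_esum //; last first.
  move=> l; apply: emeasurable_funM; last by apply: cmeas_ecabs2; exact: cmeas_transl.
  by apply/measurable_EFinP; apply: measurable_indic; exact: measurable_cube.
apply: lee_wpmul2l; first by rewrite lee_fin Nm_ge0.
rewrite le_eqVlt; apply/orP; left; apply/eqP; apply: eq_integral => t _.
rewrite esumZl //; last by move=> l; rewrite lee_fin cabs2_ge0.
congr (_ * _)%E; rewrite /periodization -esum_opp; apply: eq_esum => l _.
by rewrite /transl cvRN.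
Qed.

Variable A : 'M[int]_d.
Hypothesis hdet : \det A = 2 \/ \det A = -2.
Hypothesis hA : pow_summable (invmx (mxR R A)).

Lemma iter_dilE k f t : iter k (dil A) f t = sqrt2C R ^+ k * f (mpow (mxR R A) k *m t).
Proof.
elim: k t => [|k IH] t; first by rewrite mul1r mul1mx.
by rewrite iterS {1}/dil IH mulrA exprS mpowSr mulmxA.
Qed.

Lemma coarse_energy f (eps : R) : Nice f -> 0 < eps -> exists k0, forall k, (k0 <= k)%N ->
  (SQ mu (fun l => dilz A (Negz k) (transl l phi)) f <= eps%:E)%E.
Proof.
move=> nf ep0; have lf := Nice_L2 nf; have [L [K [_ _ _ _ [_ hK]]]] := nf.
have N0 := Nm_ge0 mu f.
have e0 : 0 < eps / (Nm mu f + 1) by rewrite divr_gt0 // ltr_wpDl.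
have [r [r0 hr]] := local_energy_small e0.
have e1 : 0 < r / (`|K| + 1) by rewrite divr_gt0 // ltr_wpDl.
have [k0 hk0] := pow_summable_small hA e1.
(* [Negz k] stands for [-(k+1)], whence the [k.+1] dilations. *)
exists k0 => k kk0; pose F := iter k.+1 (dil A) f.
have lF : L2 mu F by exact: (L2_dilz hdet (Posz k.+1) lf).
have NF : Nm mu F = Nm mu f.
  by rewrite /Nm -[F]/(dilz A (Posz k.+1) f) (n2_dilz hdet) //; case: lf.
rewrite (_ : SQ mu _ f = SQ mu (fun l => transl l phi) F); last first.
  by apply: eq_esum => l _; rewrite /= (ip_iter_dilinv hdet k.+1) //; exact: L2_transl.
have hF t : ~ cube d r t -> F t = 0.
  move=> ht; rewrite /F iter_dilE hK ?mulr0 // => ht'; apply: ht.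
  have ht2 : cube d (`|K| + 1) (mpow (mxR R A) k.+1 *m t).
    by move=> j; apply: le_trans (ht' j) _; have := ler_norm K; lra.
  have := mulmx_cube (mpow (invmx (mxR R A)) k.+1) _ ht2.
  rewrite mulmxA mpow_inv ?mulVmx ?(unit_mxR R hdet) // mul1mx => hc j.
  apply: le_trans (hc _ j) _; first by rewrite addr_ge0.
  rewrite -ler_pdivlMr ?ltr_wpDl //; apply: ltW; apply: hk0; exact: leqW.
apply: le_trans (translates_energy lF hF) _; rewrite NF.
apply: le_trans (lee_wpmul2l _ (ltW hr)) _; first by rewrite lee_fin.
rewrite -EFinM lee_fin mulrCA -[leRHS]mulr1 (ler_pM2l ep0) ler_pdivrMr ?mul1r ?lerDl //.
by rewrite ltr_wpDl.
Qed.

End Vanishing.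

(** * Multiresolution *)

Section Multiresolution.
Variables (R : realType) (d : nat).
Local Notation C := (R[i]).
Local Notation T := (cvT R d).
Local Notation mu := (@muT R d).
Local Notation Z := 'cV[int]_d.
Variables (A : 'M[int]_d) (lA qA : Z) (N : nat) (h : Z -> C) (phi : T -> C).
Local Notation Box := {ffun 'I_d -> 'I_(N.*2.+1)}.
Hypothesis hdet : \det A = 2 \/ \det A = -2.
Hypothesis lphi : L2 mu phi.
Hypothesis two_scale_eq : n2 mu (fun t => phi t -
  \sum_(f : Box) h (boxv f) * dil A (transl (boxv f) phi) t) = 0%E.
Hypothesis filter_le : forall c : Z -> C,
  (\esum_(l in [set: Z]) (cabs2 (opA A N h c l) + cabs2 (opB A lA qA N h c l))%:E <=
   \esum_(k in [set: Z]) (cabs2 (c k))%:E)%E.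
Hypothesis filter_eq : forall c : Z -> C, (\esum_(k in [set: Z]) (cabs2 (c k))%:E < +oo)%E ->
  (\esum_(l in [set: Z]) (cabs2 (opA A N h c l) + cabs2 (opB A lA qA N h c l))%:E =
   \esum_(k in [set: Z]) (cabs2 (c k))%:E)%E.
Hypothesis fine_limit : forall G : T -> C, Nice G ->
  (fun k => SQ mu (fun l => dilz A (Posz k) (transl l phi)) (invF G)) @ \oo --> n2 mu G.
Hypothesis coarse_limit : forall (f : T -> C) (eps : R), Nice f -> 0 < eps ->
  exists k0, forall k, (k0 <= k)%N ->
  (SQ mu (fun l => dilz A (Negz k) (transl l phi)) f <= eps%:E)%E.

Definition wavelet (t : 'cV[R]_d) : C := \sum_(f : Box)
  (-1) ^ (dotZ qA (lA - boxv f)) * (h (boxv f))^* * dil A (transl (lA - boxv f) phi) t.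
Local Notation e n := (fun l : Z => dilz A n (transl l phi)).
Local Notation w n := (fun l : Z => dilz A n (transl l wavelet)).
Implicit Types f : T -> C.

Lemma L2_wavelet : L2 mu wavelet.
Proof. by apply: L2_sum => f; apply: L2Z; apply: (L2_dil hdet); exact: L2_transl. Qed.

Lemma L2_e n l : L2 mu (dilz A n (transl l phi)).
Proof. by apply: (L2_dilz hdet); exact: L2_transl. Qed.

(** Uses the commutation of translations with the dilation, which sends [l] to [A *m l]. The
    refinement equation holds only almost everywhere, so the coefficients are compared through
    [ip_dist0]. *)
Lemma coef_scaling f n l : L2 mu f ->
  ip mu f (dilz A n (transl l phi)) = opA A N h (fun k => ip mu f (dilz A (n + 1) (transl k phi))) l.
Proof.
move=> lf.
pose S t := \sum_(b : Box) h (boxv b) * dilz A (n + 1) (transl (A *m l + boxv b) phi) t.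
have lS : L2 mu S by apply: L2_sum => b; apply: L2Z; exact: L2_e.
have mD : cmeas (fun t : T => phi t - \sum_(b : Box) h (boxv b) * dil A (transl (boxv b) phi) t).
  apply: cmeasB; first by case: lphi.
  by apply: cmeas_sum => b; apply: cmeasZ; apply: cmeas_dil; apply: cmeas_transl; case: lphi.
have E : n2 mu (fun t => dilz A n (transl l phi) t - S t) = 0%E.
  rewrite -[RHS]two_scale_eq -[RHS](n2_transl l mD) -[RHS](n2_dilz hdet n (cmeas_transl l mD)).
  apply: eq_n2 => t; rewrite (dilzB A n (transl l phi)
     (fun x => \sum_(b : Box) h (boxv b) * transl l (dil A (transl (boxv b) phi)) x)).
  rewrite dilz_sum; congr (_ - _); apply: eq_bigr => b _.
  by rewrite transl_dil translD (dilzS hdet).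
rewrite (ip_dist0 (L2_e n l) lS lf E) ip_sumr //; last by move=> b; apply: L2Z; exact: L2_e.
by apply: eq_bigr => b _; rewrite ipZr //; exact: L2_e.
Qed.

Lemma coef_wavelet f n l : L2 mu f ->
  ip mu f (dilz A n (transl l wavelet)) =
  opB A lA qA N h (fun k => ip mu f (dilz A (n + 1) (transl k phi))) l.
Proof.
move=> lf; have eJ z : ((-1 : C) ^ z)^* = (-1) ^ z.
  by rewrite expN1_parity; case: ifP => _; rewrite ?conjC1 // conjCN1.
have -> : dilz A n (transl l wavelet) = (fun t => \sum_(b : Box)
    (-1) ^ (dotZ qA (lA - boxv b)) * (h (boxv b))^* * dilz A (n + 1) (transl (A *m l + (lA - boxv b)) phi) t).
  apply/funext => t; rewrite (_ : transl l wavelet = (fun x => \sum_(b : Box)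
    (-1) ^ (dotZ qA (lA - boxv b)) * (h (boxv b))^* * transl l (dil A (transl (lA - boxv b) phi)) x)) //.
  rewrite dilz_sum; apply: eq_bigr => b _.
  by rewrite transl_dil translD (dilzS hdet).
rewrite ip_sumr //; last by move=> b; apply: L2Z; exact: L2_e.
by apply: eq_bigr => b _; rewrite ipZr ?cJM ?conjCK ?eJ //; exact: L2_e.
Qed.

Lemma energy_split f n : L2 mu f ->
  (SQ mu (e n) f + SQ mu (w n) f =
   \esum_(l in [set: Z]) (cabs2 (opA A N h (fun k => ip mu f (dilz A (n + 1) (transl k phi))) l) +
     cabs2 (opB A lA qA N h (fun k => ip mu f (dilz A (n + 1) (transl k phi))) l))%:E)%E.
Proof.
move=> lf; rewrite /SQ -esumD; last 2 first.
- by move=> l _; rewrite lee_fin cabs2_ge0.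
- by move=> l _; rewrite lee_fin cabs2_ge0.
by apply: eq_esum => l _; rewrite coef_scaling // coef_wavelet // EFinD.
Qed.

Lemma energy_le f n : L2 mu f -> (SQ mu (e n) f + SQ mu (w n) f <= SQ mu (e (n + 1)) f)%E.
Proof. by move=> lf; rewrite energy_split //; exact: filter_le. Qed.

Lemma energy_mono f n k : L2 mu f -> (SQ mu (e n) f <= SQ mu (e (n + k%:Z)) f)%E.
Proof.
move=> lf; elim: k => [|k IH]; first by rewrite addr0.
apply: le_trans IH _; rewrite intS (addrC 1) addrA; apply: le_trans (energy_le _ lf).
by rewrite leeDl // SQ_ge0.
Qed.

Lemma bessel_scaling n : bessel mu (e n).
Proof.
apply: bessel_dense => [l|f lf eps ep0]; first exact: L2_e.
have [G [nG hG]] := invF_dense lf ep0; have lG := L2_invF nG.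
exists (invF G); split=> //; have [M [K nG']] := nG; rewrite (plancherel nG').
have cv := fine_limit nG; rewrite -(cvg_lim _ cv) //.
apply: lime_ge; first by apply/cvg_ex; eexists; exact: cv.
exists `|n|%N => // k nk; have {}nk : (`|n| <= k)%N by [].
change (SQ mu (e n) (invF G) <= SQ mu (e (Posz k)) (invF G))%E.
have -> : Posz k = n + `|(k%:Z - n)%R|%N%:Z by lia.
exact: energy_mono.
Qed.

(** [filter_eq] asks for square summable coefficients, and their summability is what
    [bessel_scaling] provides. *)
Lemma energy_eq f n : L2 mu f -> (SQ mu (e n) f + SQ mu (w n) f = SQ mu (e (n + 1)) f)%E.
Proof.
move=> lf; rewrite energy_split // filter_eq //.
by apply: le_lt_trans (bessel_scaling (n + 1) lf) _; case: lf.
Qed.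

Lemma bessel_wavelet n : bessel mu (w n).
Proof.
move=> f lf; apply: le_trans (bessel_scaling (n + 1) lf).
by apply: le_trans (energy_le n lf); rewrite leeDr // SQ_ge0.
Qed.

Lemma sq_step f n : L2 mu f -> sq mu (w n) f = sq mu (e (n + 1)) f - sq mu (e n) f.
Proof.
move=> lf; have := energy_eq n lf.
rewrite -(sqE (bessel_scaling n) lf) -(sqE (bessel_wavelet n) lf) -(sqE (bessel_scaling (n + 1)) lf).
by rewrite -EFinD => -[<-]; rewrite addrC addKr.
Qed.

Lemma fine_energy f (eps : R) : L2 mu f -> 0 < eps ->
  exists k0, forall k, (k0 <= k)%N -> Nm mu f - eps < sq mu (e (Posz k)) f.
Proof.
(* In [defect_le] the distance to [invF G] and the defect of [invF G] are both doubled, hence the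
   quarters. *)
move=> lf ep0; have e4 : 0 < eps / 4 by rewrite divr_gt0.
have [G [nG hG]] := invF_dense lf e4; have lG := L2_invF nG.
have cv := fine_limit nG.
have {}cv : (fun k => sq mu (e (Posz k)) (invF G)) @ \oo --> Nm mu (invF G).
  rewrite Nm_invF //; apply: fine_cvg.
  by rewrite NmE //; exact: Nice_L2.
have e4' : Nm mu (invF G) - eps / 4 < Nm mu (invF G) by rewrite gtrBl.
have [k0 _ hk0] := cvgr_gt _ cv _ e4'.
exists k0 => k kk0; have /= h1 := hk0 k kk0.
have := defect_le (L2_e k) (bessel_scaling k) lf lG; lra.
Qed.

Lemma coarse_vanish f (eps : R) : L2 mu f -> 0 < eps ->
  exists k0, forall k, (k0 <= k)%N -> sq mu (e (Negz k)) f < eps.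
Proof.
move=> lf ep0; have e8 : 0 < eps / 8 by rewrite divr_gt0.
have [G [nG hG]] := Nice_dense lf e8; have lG := Nice_L2 nG.
have [k0 hk0] := coarse_limit nG e8; exists k0 => k kk0.
have := sq_le (L2_e (Negz k)) (bessel_scaling (Negz k)) lf lG.
have := hk0 k kk0; rewrite -(sqE (bessel_scaling _) lG) lee_fin; lra.
Qed.

Lemma telescope_energy f k : L2 mu f ->
  \sum_(0 <= i < k.*2) sq mu (w (i%:Z - k%:Z)) f = sq mu (e k%:Z) f - sq mu (e (- k%:Z)) f.
Proof.
move=> lf; pose u i := sq mu (e (i%:Z - k%:Z)) f.
have -> : sq mu (e k%:Z) f - sq mu (e (- k%:Z)) f = u k.*2 - u 0%N.
  by rewrite /u sub0r -addnn PoszD addrK.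
rewrite -telescope_sumr //; apply: eq_bigr => i _; rewrite sq_step // /u.
by rewrite intS (addrC 1) addrAC.
Qed.

Lemma wavelet_parseval f : L2 mu f ->
  (\esum_(p in [set: int * Z]) (cabs2 (ip mu f (dilz A p.1 (transl p.2 wavelet))))%:E = n2 mu f)%E.
Proof.
move=> lf.
have -> : (\esum_(p in [set: int * Z]) (cabs2 (ip mu f (dilz A p.1 (transl p.2 wavelet))))%:E =
    \esum_(n in [set: int]) (sq mu (w n) f)%:E)%E.
  under [RHS]eq_esum do rewrite (sqE (bessel_wavelet _) lf).
  rewrite /SQ (esum_esum (a := fun n l => (cabs2 (ip mu f (dilz A n (transl l wavelet))))%:E)); last first.
    by move=> *; rewrite lee_fin cabs2_ge0.
  by congr (\esum_(p in _) _); apply/seteqP; split.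
have s0 n : 0 <= sq mu (w n) f by exact: sq_ge0.
have mem (n : int) k : (`|n| < k)%N -> n \in [seq i%:Z - k%:Z | i <- index_iota 0 k.*2].
  move=> nk; apply/mapP; exists `|(n + k%:Z)%R|%N; last by lia.
  by rewrite mem_index_iota; lia.
have un k : uniq [seq i%:Z - k%:Z | i <- index_iota 0 k.*2].
  by rewrite map_inj_uniq ?iota_uniq // => i j /addIr [].
have tel k : \sum_(n <- [seq i%:Z - k%:Z | i <- index_iota 0 k.*2]) sq mu (w n) f =
    sq mu (e k%:Z) f - sq mu (e (- k%:Z)) f by rewrite big_map telescope_energy.
apply/eqP; rewrite eq_le; apply/andP; split.
  apply: esum_le_finsum => s us; rewrite sumEFin -NmE // lee_fin.
  pose k := (\max_(n <- s) `|n|%N).+1.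
  have sub : {subset s <= [seq i%:Z - k%:Z | i <- index_iota 0 k.*2]}.
    by move=> n ns; apply: mem; rewrite ltnS; exact: (leq_bigmax_seq (F := fun n : int => `|n|%N)).
  apply: le_trans (sum_uniq_le us (un k) sub s0) _; rewrite tel.
  rewrite lerBlDr; apply: le_trans (sq_le_Nm (bessel_scaling k%:Z) lf) _.
  by rewrite lerDl; exact: sq_ge0.
rewrite -NmE //; apply/lee_addgt0Pr => ep ep0.
have e2 : 0 < ep / 2 by rewrite divr_gt0.
have [k1 hk1] := fine_energy lf e2; have [k2 hk2] := coarse_vanish lf e2.
(* The successor makes [- k] of the form [Negz], as [coarse_vanish] expects. *)
pose k := (maxn k1 k2).+1.
have h1 : Nm mu f - ep / 2 < sq mu (e k%:Z) f by apply: hk1; rewrite leqW // leq_maxl.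
have h2 : sq mu (e (- k%:Z)) f < ep / 2.
  by rewrite -[- k%:Z]/(Negz (maxn k1 k2)); apply: hk2; exact: leq_maxr.
apply: (@le_trans _ _ ((\sum_(n <- [seq i%:Z - k%:Z | i <- index_iota 0 k.*2]) sq mu (w n) f)%:E + ep%:E)%E).
  rewrite -EFinD lee_fin tel; move: h1 h2.
  move: (sq mu (e k%:Z) f) (sq mu (e (- k%:Z)) f) (Nm mu f) => a b c *; lra.
by apply: leeD => //; rewrite -sumEFin; apply: finsum_le_esum.
Qed.

(** At a fine level almost all the energy of [f] is captured, and finitely many coefficients already
    carry it up to [eps / 2]; [synthesis_error] turns the missing energy into an approximation
    error. *)
Lemma scaling_dense f (eps : R) : L2 mu f -> 0 < eps ->
  exists (k : nat) (s : seq Z), Nm mu (fun t => f t -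
    \sum_(l <- s) ip mu f (dilz A k%:Z (transl l phi)) * dilz A k%:Z (transl l phi) t) < eps.
Proof.
move=> lf ep0; have e2 : 0 < eps / 2 by rewrite divr_gt0.
have [k hk] := fine_energy lf e2; exists k.
have be := bessel_scaling k%:Z.
have [s [us hs]] : exists s : seq Z, uniq s /\
    sq mu (e k%:Z) f - eps / 2 < \sum_(l <- s) cabs2 (ip mu f (dilz A k%:Z (transl l phi))).
  apply: contrapT => /forallNP hn.
  have : (SQ mu (e k%:Z) f <= (sq mu (e k%:Z) f - eps / 2)%:E)%E.
    apply: esum_le_finsum => s us; rewrite sumEFin lee_fin leNgt; apply/negP => hlt.
    by apply: (hn s); split.
  by rewrite -(sqE be lf) lee_fin; lra.
exists s; apply: le_lt_trans (synthesis_error (L2_e k%:Z) be lf us) _.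
have := hk k (leqnn k); lra.
Qed.

End Multiresolution.

(** * Change of lattice *)

Section ChangeOfLattice.
Variables (R : realType) (d : nat).
Local Notation C := (R[i]).
Local Notation T := (cvT R d).
Local Notation mu := (@muT R d).
Local Notation Z := 'cV[int]_d.
Variables (A0 S Si A : 'M[int]_d).
Hypothesis hdet0 : \det A0 = 2 \/ \det A0 = -2.
Hypothesis hdetA : \det A = 2 \/ \det A = -2.
Hypothesis hdetS : \det S = 1 \/ \det S = -1.
Hypothesis SSi : S *m Si = 1%:M.
Hypothesis SA : S *m A0 = A *m S.
Local Notation SR := (mxR R S).
Implicit Types f g : T -> C.

Definition pull (P : 'M[int]_d) (f : 'cV[R]_d -> C) (t : 'cV[R]_d) : C := f (mxR R P *m t).

Lemma mxRM (P Q : 'M[int]_d) : mxR R (P *m Q) = mxR R P *m mxR R Q.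
Proof. exact: map_mxM. Qed.

Lemma mxR1 : mxR R (1%:M : 'M[int]_d) = 1%:M.
Proof. exact: map_mx1. Qed.

Lemma SiS : Si *m S = 1%:M.
Proof. exact: mulmx1C. Qed.

Lemma pullK f : pull S (pull Si f) = f.
Proof. by apply/funext => t; rewrite /pull mulmxA -mxRM SiS mxR1 mul1mx. Qed.

Lemma pull_dil f : pull S (dil A f) = dil A0 (pull S f).
Proof. by apply/funext => t; rewrite /pull /dil !mulmxA -!mxRM SA. Qed.

Lemma pull_dilinv f : pull S (dilinv A f) = dilinv A0 (pull S f).
Proof.
by rewrite -[LHS](dilinvK hdet0) -pull_dil dilK.
Qed.

Lemma pull_dilz n f : pull S (dilz A n f) = dilz A0 n (pull S f).
Proof.
by case: n => k /=; [|rewrite pull_dilinv; congr dilinv];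
  elim: k => //= k <-; rewrite ?pull_dil ?pull_dilinv.
Qed.

Lemma pull_transl l f : pull S (transl (S *m l) f) = transl l (pull S f).
Proof. by apply/funext => t; rewrite /pull /transl cvRM mulmxBr. Qed.

Lemma pull_transl_inv l f : pull S (transl l f) = transl (Si *m l) (pull S f).
Proof. by rewrite -pull_transl mulmxA SSi mul1mx. Qed.

Lemma norm_detS : `|\det SR| = 1.
Proof. by rewrite det_mxR; case: hdetS => ->; rewrite ?rmorphN /= ?normrN normr1. Qed.

Lemma n2_pull f : cmeas f -> n2 mu (pull S f) = n2 mu f.
Proof.
move=> mf; rewrite -[RHS](@n2_cov R d SR) ?norm_detS ?mul1e //.
by rewrite -normr_eq0 norm_detS oner_eq0.
Qed.

Lemma cmeas_pull P f : cmeas f -> @cmeas _ T R (pull P f).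
Proof. by move=> mf; exact: cmeas_comp_mulmx. Qed.

Lemma L2_pull f : L2 mu f -> L2 mu (pull S f).
Proof. by move=> [mf ff]; split; [exact: cmeas_pull|rewrite n2_pull]. Qed.

Lemma n2_pullV f : cmeas f -> n2 mu (pull Si f) = n2 mu f.
Proof. by move=> mf; rewrite -[in RHS](pullK f) n2_pull //; exact: cmeas_pull. Qed.

Lemma L2_pullV f : L2 mu f -> L2 mu (pull Si f).
Proof. by move=> [mf ff]; split; [exact: cmeas_pull|rewrite n2_pullV]. Qed.

Lemma ip_pull f g : L2 mu f -> L2 mu g -> ip mu f (pull S g) = ip mu (pull Si f) g.
Proof.
move=> lf lg; rewrite -[in LHS](pullK f); apply: (@ip_isometry _ _ _ mu (pull S)) => //.
- exact: L2_pull.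
- by move=> u [mu' _]; exact: n2_pull.
- exact: L2_pullV.
Qed.

(** Composition with [S] is unitary and intertwines the dilations of [A] and [A0]. Translations are
    relabelled by [l] to [S *m l], a bijection of [Z^d] since [S] is unimodular. *)
Lemma pull_parseval (psi : T -> C) : L2 mu psi ->
  (forall f, L2 mu f -> (\esum_(p in [set: int * Z])
     (cabs2 (ip mu f (dilz A p.1 (transl p.2 psi))))%:E = n2 mu f)%E) ->
  parseval_frame_wavelet A0 (pull S psi).
Proof.
move=> lpsi H; have lp := L2_pull lpsi; split; first exact/inL2P.
move=> f /inL2P lf; have [mf _] := lf.
rewrite L2norm2E // -n2_pullV // -H; last exact: L2_pullV.
rewrite [RHS](@reindex_esum _ _ _ [set: int * Z] [set: int * Z] (fun p => (p.1, S *m p.2))); last first.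
  split=> // [[n l] [n' l'] _ _ /= [-> e]|[n l] _].
    by congr pair; rewrite -[l]mul1mx -[l']mul1mx -SiS -!mulmxA e.
  by exists (n, Si *m l) => //=; rewrite mulmxA SSi mul1mx.
apply: eq_esum => -[n l] _ /=.
rewrite (innerE lf (L2_dilz hdet0 n (L2_transl l lp))).
rewrite -pull_transl -pull_dilz ip_pull //.
by apply: (L2_dilz hdetA); exact: L2_transl.
Qed.

Variables (I : finType) (k : I -> Z) (h : I -> C) (phi : T -> C).
Hypothesis lphi : L2 mu phi.
Hypothesis two_scale_eq :
  n2 mu (fun t => phi t - \sum_i h i * dil A (transl (k i) phi) t) = 0%E.
Local Notation phi0 := (pull S phi).

Lemma pull_two_scale :
  n2 mu (fun t => phi0 t - \sum_i h i * dil A0 (transl (Si *m k i) phi0) t) = 0%E.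
Proof.
have mD : cmeas (fun t : T => phi t - \sum_i h i * dil A (transl (k i) phi) t).
  apply: cmeasB; first by case: lphi.
  by apply: cmeas_sum => i; apply: cmeasZ; apply: cmeas_dil; apply: cmeas_transl; case: lphi.
rewrite -[RHS]two_scale_eq -[RHS](n2_pull mD).
apply: eq_n2 => t; rewrite /pull; congr (_ - _); apply: eq_bigr => i _; congr (_ * _).
by rewrite -[RHS]/(pull S (dil A (transl (k i) phi)) t) pull_dil pull_transl_inv.
Qed.

Lemma n2_sum0 (J : Type) (r : seq J) (F : J -> T -> C) : (forall j, cmeas (F j)) ->
  (forall j, n2 mu (F j) = 0%E) -> n2 mu (fun t => \sum_(j <- r) F j t) = 0%E.
Proof.
move=> mF F0; elim: r => [|j r IH].
  by rewrite -[RHS](n20 mu); apply: eq_n2 => t; rewrite big_nil.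
apply/eqP; rewrite eq_le n2_ge0 andbT.
rewrite (@eq_n2 _ _ _ mu _ (fun t => F j t + \sum_(i <- r) F i t)); last first.
  by move=> t; rewrite big_cons.
apply: le_trans (n2D_le mu (mF j) (cmeas_sum r mF)) _.
by rewrite F0 IH !mule0 adde0.
Qed.

Lemma L2_span f g : L2 mu f -> span_transl f g -> L2 mu g.
Proof.
move=> lf [s ->]; apply: L2_sum => p; apply: L2Z; exact: L2_transl.
Qed.

Lemma span_V0 f g : L2 mu f -> span_transl f g -> V0 f g.
Proof.
move=> lf sg; have lg := L2_span lf sg; split; first exact/inL2P.
move=> ep ep0; exists g; split=> //.
rewrite dist2E; [|by case: lg|by case: lg].
rewrite (_ : n2 mu _ = 0%E) ?lte_fin //.
by rewrite -[RHS](n20 mu); apply: eq_n2 => t; rewrite subrr.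
Qed.

(** It suffices that [dilinv A0 u] lies in [V0] when [u] does. Approximate [u] by a finite
    combination of translates and replace each translate of [phi0] by its refinement: the result is
    the dilate of another such combination, up to a null function. *)
Lemma Vn_nested n : Vn A0 n phi0 `<=` Vn A0 (n + 1) phi0.
Proof.
have l0 := L2_pull lphi.
move=> _ [u [/inL2P lu hu] <-]; exists (dilinv A0 u); last by rewrite (dilzS hdet0) dilK.
have ld := L2_dilinv hdet0 lu.
split; first exact/inL2P.
move=> ep ep0; have e2 : 0 < ep / 2 / 2 by rewrite !divr_gt0.
have [g [sg dg]] := hu _ e2; have lg := L2_span l0 sg; have [s gE] := sg.
(* The translation by [l] of a dilate becomes a translation by [A0 *m l] inside the dilation, which
   is then added to the translation from the refinement. *)
pose s' := [seq (p.1 * h i, A0 *m p.2 + Si *m k i) | p <- s, i <- enum I].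
pose g' t := \sum_(p <- s') p.1 * transl p.2 phi0 t.
have sg' : span_transl phi0 g' by exists s'.
have lg' := L2_span l0 sg'.
exists g'; split=> //.
rewrite dist2E; [|by case: ld|by case: lg'].
rewrite -(n2_dil hdet0); last by apply: cmeasB; [case: ld|case: lg'].
pose D t := phi0 t - \sum_i h i * dil A0 (transl (Si *m k i) phi0) t.
have mD : cmeas (D : T -> C).
  apply: cmeasB; first by case: l0.
  by apply: cmeas_sum => i; apply: cmeasZ; apply: cmeas_dil; apply: cmeas_transl; case: l0.
have E t : dil A0 (fun v => dilinv A0 u v - g' v) t =
    (u t - g t) + \sum_(p <- s) p.1 * transl p.2 D t.
  have -> : dil A0 (fun v => dilinv A0 u v - g' v) t = u t - dil A0 g' t.
    by rewrite -[in RHS](dilK hdet0 u) /dil mulrBr.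
  rewrite -addrA; congr (_ + _); apply/eqP; rewrite eq_sym addrC subr_eq addrC; apply/eqP.
  rewrite gE /dil /g' /s' big_allpairs_dep /= mulr_sumr -sumrB; apply: eq_bigr => p _.
  rewrite /transl -/(dil A0 _) {1}/D mulrBr; congr (_ - _).
  rewrite mulr_sumr mulr_sumr big_enum; apply: eq_bigr => i _.
  rewrite /dil /transl cvRD (cvRM R A0) mulmxBr opprD addrA.
  move: (phi0 _) => y; ring.
rewrite (eq_n2 mu E).
have z0 : n2 mu (fun t => \sum_(p <- s) p.1 * transl p.2 D t) = 0%E.
  apply: n2_sum0 => p; first by apply: cmeasZ; exact: cmeas_transl.
  rewrite n2Z ?n2_transl //; last exact: cmeas_transl.
  by rewrite pull_two_scale mule0.
have mB : cmeas (fun t : T => u t - g t) by apply: cmeasB; [case: lu|case: lg].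
apply: le_lt_trans (n2D_le mu mB _) _.
  by apply: cmeas_sum => p; apply: cmeasZ; exact: cmeas_transl.
rewrite z0 mule0 adde0; move: dg; rewrite dist2E; [|by case: lu|by case: lg].
rewrite -NmE; last exact: L2B.
by rewrite -EFinM !lte_fin; lra.
Qed.

(** The approximation is made for [pull Si f] with the matrix [A] and transported by [pull S], which
    preserves the error. *)
Lemma Vn_dense : (forall f (eps : R), L2 mu f -> 0 < eps ->
   exists (k : nat) (s : seq Z), Nm mu (fun t => f t -
     \sum_(l <- s) ip mu f (dilz A k%:Z (transl l phi)) * dilz A k%:Z (transl l phi) t) < eps) ->
  L2closure (\bigcup_(n in [set: int]) Vn A0 n phi0) = [set f | inL2 f].
Proof.
move=> H; have l0 := L2_pull lphi; apply/seteqP; split=> [f []//|f /= lf'].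
split=> // ep ep0; have lf : L2 mu f by exact/inL2P.
have [m [s hs]] := H _ _ (L2_pullV lf) ep0.
pose c l := ip mu (pull Si f) (dilz A m%:Z (transl l phi)).
pose u t := \sum_(p <- [seq (c l, Si *m l) | l <- s]) p.1 * transl p.2 phi0 t.
have su : span_transl phi0 u by exists [seq (c l, Si *m l) | l <- s].
have lu := L2_dilz hdet0 m%:Z (L2_span l0 su).
exists (dilz A0 m%:Z u); split.
  by exists m%:Z => //; exists u => //; exact: span_V0.
have lS : L2 mu (fun t => \sum_(l <- s) c l * dilz A m%:Z (transl l phi) t).
  by apply: L2_sum => l; apply: L2Z; apply: (L2_dilz hdetA); exact: L2_transl.
have lB := L2B (L2_pullV lf) lS.
rewrite dist2E; [|by case: lf|by case: lu].
rewrite (@eq_n2 _ _ _ mu _ (pull S (fun t => pull Si f t - \sum_(l <- s) c l * dilz A m%:Z (transl l phi) t))).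
  by rewrite n2_pull; [rewrite -NmE // lte_fin|case: lB].
move=> t; rewrite -[in LHS](pullK f); congr (_ - _).
rewrite (dilz_sum A0 m%:Z [seq (c l, Si *m l) | l <- s] fst (fun p => transl p.2 phi0)) big_map.
apply: eq_bigr => l _ /=; rewrite -[RHS]/(c l * pull S (dilz A m%:Z (transl l phi)) t).
by rewrite pull_dilz pull_transl_inv.
Qed.

End ChangeOfLattice.

(** * Assembly of the four conclusions *)

Theorem theorem10p1 (R : realType) (d : nat)
  (A0 S A : 'M[int]_d) (lA qA : 'cV[int]_d) (N0 : nat)
  (h : 'cV[int]_d -> R[i]) (g phiA : 'cV[R]_d -> R[i]) :
  expansive R A0 ->
  (\det A0 = 2 \/ \det A0 = -2) ->
  (\det S = 1 \/ \det S = -1) ->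
  A0 = invmx S *m A *m S ->
  (forall v, inAZ A v <-> inAZ A^T v) ->
  (forall v, (inAZ A (v - lA) \/ inAZ A v) /\ ~ (inAZ A (v - lA) /\ inAZ A v)) ->
  (forall v, inAZ A v -> (2 %| dotZ qA v)%Z) ->
  (forall v, inAZ A (v - lA) -> ~~ (2 %| dotZ qA v)%Z) ->
  (forall m n, inAZ A m -> forall v,
      (inAZ A (n - v) \/ inAZ A (v - (lA - m - n))) /\
      ~ (inAZ A (n - v) /\ inAZ A (v - (lA - m - n)))) ->
  (forall m n, inAZ A (m - lA) -> forall v,
      inAZ A (n - v) <-> inAZ A (v - (lA - m - n))) ->
  (forall n, h n != 0 -> forall j, `|n j 0| <= N0%:Z) ->
  (forall k, inAZ A k ->
      \sum_(f : {ffun 'I_d -> 'I_(N0.*2.+1)}) h (boxv f) * (h (boxv f + k))^*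
      = (k == 0)%:R) ->
  \sum_(f : {ffun 'I_d -> 'I_(N0.*2.+1)}) h (boxv f) = sqrt2C R ->
  is_infprod_g A N0 h g ->
  is_invFT g phiA ->
  let psiA := fun t => \sum_(f : {ffun 'I_d -> 'I_(N0.*2.+1)})
      (-1) ^ (dotZ qA (lA - boxv f)) * (h (boxv f))^*
        * dil A (transl (lA - boxv f) phiA) t in
  let phiA0 := fun t => phiA (mxR R S *m t) in
  let psiA0 := fun t => psiA (mxR R S *m t) in
  [/\ parseval_frame_wavelet A0 psiA0,
      dist2 phiA0 (fun t => \sum_(f : {ffun 'I_d -> 'I_(N0.*2.+1)})
          h (boxv f) * dil A0 (transl (invmx S *m boxv f) phiA0) t) = 0%:E
      /\ dist2 psiA0 (fun t => \sum_(f : {ffun 'I_d -> 'I_(N0.*2.+1)})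
          (-1) ^ (dotZ qA (lA - boxv f)) * (h (boxv f))^*
            * dil A0 (transl (invmx S *m (lA - boxv f)) phiA0) t) = 0%:E,
      forall n : int, Vn A0 n phiA0 `<=` Vn A0 (n + 1) phiA0
    & L2closure (\bigcup_(n in [set: int]) Vn A0 n phiA0) = [set f | inL2 f]].
Proof.
move=> eA0 dA0 dS A0E _ c2 qe qo ce co hsupp horth hsum hg hphi psiA phiA0 psiA0.
have uS : S \in unitmx by rewrite unitmxE; case: dS => ->.
have SSi : S *m invmx S = 1%:M by rewrite mulmxV.
have SiS : invmx S *m S = 1%:M by rewrite mulVmx.
have AE : A = S *m A0 *m invmx S.
  by rewrite A0E !mulmxA SSi mul1mx -mulmxA SSi mulmx1.
have SA : S *m A0 = A *m S by rewrite A0E !mulmxA SSi mul1mx.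
have dA : \det A = 2 \/ \det A = -2.
  suff -> : \det A = \det A0 by [].
  rewrite AE -mulmxA det_mulmx mulrC -det_mulmx -mulmxA SiS mulmx1 //.
have dA0n : \det A0 != 0 by case: dA0 => ->.
have dAn : \det A != 0 by case: dA => ->.
have uA0 : mxR R A0 \in unitmx by exact: unit_mxR.
have uA : mxR R A \in unitmx by exact: unit_mxR.
have SSiR : mxR R S *m mxR R (invmx S) = 1%:M by rewrite -mxRM SSi mxR1.
have SiSR : mxR R (invmx S) *m mxR R S = 1%:M by rewrite -mxRM SiS mxR1.
(* Expansiveness is given for [A0]; the summability reaches [A] by conjugation with [S], and then
   its transpose. *)
have hA : pow_summable (invmx (mxR R A)).
  have -> : invmx (mxR R A) = mxR R S *m invmx (mxR R A0) *m mxR R (invmx S).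
    apply: (can_inj (mulKmx uA)); rewrite mulmxV // AE !mxRM.
    rewrite !mulmxA -(mulmxA _ (mxR R (invmx S)) (mxR R S)) SiSR mulmx1.
    by rewrite -(mulmxA _ (mxR R A0)) mulmxV // mulmx1.
  exact: pow_summable_conj SiSR SSiR (pow_summable_expansive eA0 dA0n).
have hB : pow_summable (invmx (mxR R A^T)).
  by rewrite mxR_tr -trmx_inv; exact: pow_summable_tr.
(* In dimension 0 the determinant is 1, which [dA0] excludes. *)
have d0 : (0 < d)%N.
  by move: dA0; clear; case: d A0 => // A0; rewrite det_mx00 => -[].
have lphi := L2_phi hphi.
have ts := two_scale dA hB hsum hg hphi.
have fle := filter_bessel dAn c2 qe qo ce co hsupp horth.
have feq := filter_parseval dAn c2 qe qo ce co hsupp horth.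
have fl G (nG : Nice G) := level_energy_cvg dA hB hsum hg hphi nG.
have cl f eps (nf : Nice f) (ep0 : 0 < eps) := coarse_energy lphi d0 dA hA nf ep0.
have lpsi : L2 (muT d) psiA by exact: L2_wavelet.
have l0 : L2 (muT d) phiA0 by exact: (L2_pull dS).
split.
- apply: (pull_parseval dA0 dA dS SSi SA lpsi) => f lf.
  exact: (wavelet_parseval dA lphi ts fle feq fl cl lf).
- split.
    rewrite dist2E; last 2 first.
    + by case: l0.
    + by apply: cmeas_sum => b; apply: cmeasZ; apply: cmeas_dil; apply: cmeas_transl; case: l0.
    exact: (pull_two_scale dS SSi SA lphi ts).
  (* As [psiA] is defined by its sum, the identity for [psiA0] holds at every point. *)
  rewrite (_ : (fun t => \sum_(f : {ffun 'I_d -> 'I_(N0.*2.+1)}) _) = psiA0).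
    rewrite dist2E; [|by case: (L2_pull dS lpsi)|by case: (L2_pull dS lpsi)].
    by rewrite -[RHS](n20 (muT d)); apply: eq_n2 => t; rewrite subrr.
  apply/funext => t; apply: eq_bigr => b _; congr (_ * _).
  rewrite -[RHS]/(pull S (dil A (transl (lA - boxv b) phiA)) t).
  by rewrite (pull_dil SA) (pull_transl_inv SSi).
- move=> n; exact: (Vn_nested dA0 dS SSi SA lphi ts).
- apply: (Vn_dense dA0 dA dS SSi SA lphi) => f eps lf ep0.
  exact: (scaling_dense dA lphi ts fle fl lf ep0).
Qed.
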